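(* For $j = 1, 2$ let $\Phi_j : \mathbb{C}^n \to \mathbb{R}$ be real-quadratic with $(\Phi_j)''_{\overline{x}x}$ positive definite, and let $\mathbf{A}_{\Phi_j}$ be the associated $2n\times 2n$ matrix (defined in the context). Then the embedding $$\iota : H_{\Phi_1} \to H_{\Phi_2}, \quad \iota f = f,$$ is bounded (that is, $H_{\Phi_1}\subseteq H_{\Phi_2}$ and there is $C\geq 0$ with $\|f\|_{H_{\Phi_2}} \leq C\|f\|_{H_{\Phi_1}}$ for all $f \in H_{\Phi_1}$) if and only if $\Phi_2(x) \geq \Phi_1(x)$ for all $x \in \mathbb{C}^n$. In this case, there exist $\mu_1, \dots, \mu_n \in (0, 1]$ such that, counting (algebraic) multiplicity, $$\operatorname{Spec} \mathbf{A}_{\Phi_2}^{-1}\mathbf{A}_{\Phi_1} = \{\mu_j\}_{j=1}^n \cup \{\mu_j^{-1}\}_{j=1}^n,$$ and the operator norm of $\iota$ is given by $$\|\iota\| = \left(\frac{\det (\Phi_1)''_{\overline{x}x}}{\det (\Phi_2)''_{\overline{x}x}}\prod_{j=1}^n \mu_j\right)^{1/4}.$$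
   Context: Write $x\cdot y = \sum_{j=1}^n x_j y_j$ for the bilinear (non-Hermitian) dot product on $\mathbb{C}^n$, and let $\mathcal{L}(\mathrm{d}x) = \mathrm{d}\operatorname{Re}x\,\mathrm{d}\operatorname{Im}x$ be Lebesgue measure on $\mathbb{C}^n$. A function $\Phi:\mathbb{C}^n\to\mathbb{R}$ is real-quadratic if it is a real-valued quadratic form on $\mathbb{C}^n\cong\mathbb{R}^{2n}$; equivalently, it can be written as $$\Phi(x) = \tfrac12 Lx\cdot\overline{x} + \tfrac12\operatorname{Re}(Px\cdot x),$$ where $L = 2\Phi''_{\overline{x}x} = 2\left(\partial_{\overline{x}_j}\partial_{x_k}\Phi\right)_{j,k}$ is an $n\times n$ Hermitian matrix and $P = 2\Phi''_{xx} = 2\left(\partial_{x_j}\partial_{x_k}\Phi\right)_{j,k}$ is an $n\times n$ complex symmetric matrix. For such $\Phi$, define $$\|f\|_{H_\Phi} = \left(\int_{\mathbb{C}^n}|f(x)|^2 e^{-4\pi\Phi(x)}\,\mathcal{L}(\mathrm{d}x)\right)^{1/2},\qquad H_\Phi = \{f:\mathbb{C}^n\to\mathbb{C}\text{ holomorphic} : \|f\|_{H_\Phi}<\infty\}.$$ When $L=2\Phi''_{\overline{x}x}$ is positive definite, and with $P = 2\Phi''_{xx}$, define the $2n\times 2n$ complex matrix $$\mathbf{A}_\Phi = \overline{\begin{pmatrix} iL & 0\\ iP & 1\end{pmatrix}^{-1}}\begin{pmatrix}0&1\\1&0\end{pmatrix}\begin{pmatrix} iL & 0\\ iP & 1\end{pmatrix},$$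 where the blocks $0$ and $1$ are the zero and identity matrices of size $n\times n$ and the bar denotes entrywise complex conjugation. *)

(* Defs.v *)
From HB Require Import structures.
From mathcomp Require Import all_boot all_order all_algebra.
From mathcomp Require Import all_classical all_reals all_analysis.
From mathcomp Require Import complex.

Set Implicit Arguments.
Unset Strict Implicit.
Unset Printing Implicit Defensive.

Import Order.TTheory GRing.Theory Num.Theory.
Import numFieldNormedType.Exports.

Local Open Scope classical_set_scope.
Local Open Scope complex_scope.
Local Open Scope ring_scope.

Section ConsMeasure.
Context d (T : measurableType d) (R : realType) (n : nat).
Variable m1 : {sigma_finite_measure set T -> \bar R}.
Variable mu : {sigma_finite_measure set (n.-tuple T) -> \bar R}.

Definition cons_pair (x : T * n.-tuple T) :
    n.+1.-tuple T :=
  [tuple of x.1 :: x.2].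

Lemma measurable_cons_pair : measurable_fun [set: _] cons_pair.
Proof. exact: (measurable_cons measurable_fst measurable_snd). Qed.

Definition cons_measure : set (n.+1.-tuple T) -> \bar R :=
  pushforward (m1 \x mu)%E cons_pair.

Let cons_measure0 : cons_measure set0 = 0%E.
Proof. by rewrite /cons_measure /pushforward preimage_set0 measure0. Qed.

Let cons_measure_ge0 A : (0 <= cons_measure A)%E.
Proof. by rewrite /cons_measure /pushforward; exact: measure_ge0. Qed.

Let cons_measure_sigma_additive : semi_sigma_additive cons_measure.
Proof.
have mf := measurable_cons_pair.
move=> F mF tF mUF; rewrite /cons_measure /pushforward preimage_bigcup.
apply: measure_semi_sigma_additive.
- by move=> k; rewrite -[X in measurable X]setTI; exact: mf.
- apply/trivIsetP => /= i j _ _ ij; rewrite -preimage_setI.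
  by move/trivIsetP : tF => /(_ _ _ _ _ ij) ->//; rewrite preimage_set0.
- by rewrite -preimage_bigcup -[X in measurable X]setTI; exact: mf.
Qed.

HB.instance Definition _ := isMeasure.Build _ _ _ cons_measure
  cons_measure0 cons_measure_ge0 cons_measure_sigma_additive.

(* Sigma-finiteness of [m1 \x mu] is not found by inference: its canonical
   instance is shadowed by the one for products of probabilities. *)
Let cons_measure_sigma_finite : sigma_finite setT cons_measure.
Proof.
have /sigma_finiteP[F [FT ndF Foo]] := sigma_finiteT m1.
have /sigma_finiteP[G [GT ndG Goo]] := sigma_finiteT mu.
pose hd (t : n.+1.-tuple T) := tnth t ord0.
pose tl (t : n.+1.-tuple T) : n.-tuple T := [tuple of behead t].
have mhd : measurable_fun [set: _] hd by exact: measurable_tnth.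
have mtl : measurable_fun [set: _] tl by exact: measurable_behead.
exists (fun k => hd @^-1` F k `&` tl @^-1` G k).
  apply/esym; rewrite -subTset => t _.
  have [i _ Fi] : (\bigcup_i F i) (hd t) by rewrite -FT.
  have [j _ Gj] : (\bigcup_i G i) (tl t) by rewrite -GT.
  exists (maxn i j) => //; split.
  - by have /subsetPset := ndF _ _ (leq_maxl i j); apply.
  - by have /subsetPset := ndG _ _ (leq_maxr i j); apply.
move=> k; have [mF Fk] := Foo k; have [mG Gk] := Goo k; split.
  by apply: measurableI; rewrite -[X in measurable X]setTI;
    [exact: mhd|exact: mtl].
rewrite /cons_measure /pushforward (_ : cons_pair @^-1` _ = F k `*` G k).
  by rewrite product_measure1E// lte_mul_pinfty// ge0_fin_numE.
apply/seteqP; split => -[x t]; rewrite /hd /tl /cons_pair /=.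
- by case=> ? Gt; split => //=; rewrite (_ : t = [tuple of behead (x :: t)]) //;
    exact: val_inj.
- by case=> /= ? Gt; split => //; rewrite (_ : [tuple of _] = t) //;
    exact: val_inj.
Qed.

HB.instance Definition _ := Measure_isSigmaFinite.Build _ _ _ cons_measure
  cons_measure_sigma_finite.

End ConsMeasure.

(* Borel-Lebesgue measure on R^n, as the n-fold product of [lebesgue_measure]. *)
Fixpoint lebesgue_tuple (R : realType) (n : nat) :
    {sigma_finite_measure set (n.-tuple (measurableTypeR R)) -> \bar R} :=
  if n is m.+1 then cons_measure (@lebesgue_measure R) (lebesgue_tuple R m)
  else dirac ([tuple] : 0.-tuple (measurableTypeR R)).

Section Fock.
Context {R : realType} {n : nat}.
Local Notation C := R[i].
Implicit Types (Phi : 'cV[C]_n -> R) (f : 'cV[C]_n -> C).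

Definition real_quadratic Phi : Prop :=
  exists Q : 'M[R]_(n + n), forall x : 'cV[C]_n,
    let v := col_mx (map_mx (@complex.Re R) x) (map_mx (@complex.Im R) x) in
    Phi x = (v^T *m Q *m v) 0 0.

(* Derivative at [x] along the real line [x + t v], taken componentwise since
   [derive1] needs a normed module over R as codomain. *)
Definition real_dderiv (g : 'cV[C]_n -> C) (v x : 'cV[C]_n) : C :=
  Complex (derive1 (fun t : R => complex.Re (g (x + t%:C%C *: v)) : R^o) 0)
          (derive1 (fun t : R => complex.Im (g (x + t%:C%C *: v)) : R^o) 0).

Definition d_Re (j : 'I_n) (g : 'cV[C]_n -> C) : 'cV[C]_n -> C :=
  real_dderiv g (delta_mx j 0).

Definition d_Im (j : 'I_n) (g : 'cV[C]_n -> C) : 'cV[C]_n -> C :=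
  real_dderiv g ('i%C *: delta_mx j 0).

(* Wirtinger derivatives. *)
Definition d_x (j : 'I_n) (g : 'cV[C]_n -> C) (x : 'cV[C]_n) : C :=
  (d_Re j g x - 'i%C * d_Im j g x) / 2.

Definition d_xbar (j : 'I_n) (g : 'cV[C]_n -> C) (x : 'cV[C]_n) : C :=
  (d_Re j g x + 'i%C * d_Im j g x) / 2.

(* The second derivatives of a quadratic form are constant: they are evaluated
   at the origin. *)
Definition hess_xbarx Phi : 'M[C]_n :=
  \matrix_(j, k) d_xbar j (d_x k (fun x => (Phi x)%:C%C)) 0.

Definition hess_xx Phi : 'M[C]_n :=
  \matrix_(j, k) d_x j (d_x k (fun x => (Phi x)%:C%C)) 0.

(* In the order of [R[i]], [0 < z] says that [z] is real and positive. *)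
Definition posdefmx m (A : 'M[C]_m) : Prop :=
  map_mx conjc A^T = A /\
  forall x : 'cV[C]_m, x != 0 -> 0 < ((map_mx conjc x)^T *m A *m x) 0 0.

(* The alias [C^o] selects the normed C-module structure, so that the
   differential is C-linear. *)
Definition holomorphic f : Prop :=
  forall x : 'cV[C]_n,
    differentiable (f : 'cV[C^o]_n -> C^o) (x : 'cV[C^o]_n).

Definition of_ReIm
    (ab : n.-tuple (measurableTypeR R) * n.-tuple (measurableTypeR R)) :
    'cV[C]_n :=
  \col_j Complex (tnth ab.1 j) (tnth ab.2 j).

(* The Lebesgue measure of C^n is carried by the pair (Re x, Im x). *)
Definition Hnorm Phi f : \bar R :=
  ((\int[lebesgue_tuple R n \x lebesgue_tuple R n]_ab
      (Normc.normc (f (of_ReIm ab)) ^+ 2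
       * expR (- (4 * pi * Phi (of_ReIm ab))))%:E) `^ 2^-1)%E.

Definition Hspace Phi : set ('cV[C]_n -> C) :=
  [set f | holomorphic f /\ (Hnorm Phi f < +oo)%E].

Definition embedding_bounded Phi1 Phi2 : Prop :=
  Hspace Phi1 `<=` Hspace Phi2 /\
  exists2 c : R, 0 <= c & forall f, Hspace Phi1 f ->
    (Hnorm Phi2 f <= c%:E * Hnorm Phi1 f)%E.

Definition embedding_norm Phi1 Phi2 : \bar R :=
  ereal_sup [set Hnorm Phi2 f | f in
    [set f | Hspace Phi1 f /\ (Hnorm Phi1 f <= 1)%E]].

Definition A_mx Phi : 'M[C]_(n + n) :=
  let L := 2 *: hess_xbarx Phi in
  let P := 2 *: hess_xx Phi in
  let B : 'M[C]_(n + n) := block_mx ('i%C *: L) 0 ('i%C *: P) 1%:M in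
  map_mx conjc (invmx B) *m block_mx 0 1%:M 1%:M 0 *m B.

(* [s] lists the spectrum of [M], each eigenvalue repeated according to its
   multiplicity as a root of the characteristic polynomial. *)
Definition spectrum_with_mult m (M : 'M[C]_m) (s : seq C) : Prop :=
  forall z : C, mup z (char_poly M) = count_mem z s.

End Fock.

(* Main.v *)
Require Import Defs.
From mathcomp Require Import all_boot all_order all_algebra.
From mathcomp Require Import all_classical all_reals all_analysis.
From mathcomp Require Import complex.
From mathcomp Require Import measurable_realfun.
From mathcomp Require Import ring lra.
Import Order.TTheory GRing.Theory Num.Theory.
Import numFieldNormedType.Exports.
Local Open Scope classical_set_scope.
Local Open Scope ring_scope.
Set Implicit Arguments.
Unset Strict Implicit.

(** Identify C^n with R^2n through [toC] and let J ([Jmx]) be multiplication by i.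
    A weight is then a real symmetric form Q, and |f|^2 exp(-4 pi Phi) becomes an
    integrand on R^2n.  Write Q^J for J^T Q J ([conjJ]).  The half of Q that J
    preserves carries the mixed Hessian L, the half that J negates ([anti])
    carries P; a form S of the second kind is pluriharmonic, so exp(S) is the
    square modulus of a zero-free holomorphic function ([exp_pluriharmonic]),
    and multiplying by it replaces (Q1, Q2) by (Q1 - S, Q2 - S) without changing
    the embedding.

    _Upper bound._  Suppose A < B are positive definite and A^-1 = B^-1 + D^-1
    with D invariant under J.  Gaussians convolve as exp(-B) * exp(-D) = const
    exp(-A), and |g|^2 is subharmonic on complex lines, so its average against
    the rotation invariant exp(-D) dominates its value ([gaussian_mean]).
    Together: the integral of |g|^2 exp(-B) is at most sqrt(det A / det B) times
    that of |g|^2 exp(-A), with equality for g = 1 ([convolution_le]).  For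
    A = Q1 - S and B = Q2 - S the hypothesis on D is the Euler equation of the
    problem of maximising det(Q1 - S) / det(Q2 - S) over pluriharmonic S with
    Q1 - S >= 0, a compact problem whose maximum is interior when Q1 < Q2
    ([extremal_shift]).  Thus the norm to the fourth power is
    det(Q1 - S) / det(Q2 - S) ([strict_sharp]).

    _Spectrum._  For that S the inverse complex Hessians of Q1 - S and Q2 - S
    have the same off-diagonal blocks, and a common change of basis turns
    A_2^-1 A_1 into a block diagonal matrix with blocks similar, up to transpose,
    to H and H^-1, where H = C2 C1^-1 and 0 < C2 <= C1 are Hermitian
    ([quotient_form]).  The eigenvalues of H are the mu_j, and Schur complements
    express det(Q1 - S) / det(Q2 - S) as det L1 / det L2 times det H
    ([strict_spectrum]).

    _Degenerate gap._  If Q2 - Q1 is only nonnegative, replace Q2 by Q2 + eps.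
    The norms converge monotonically ([sharp_limit]); the mu_j(eps) cluster in
    the compact cube, and the polynomial identities that they satisfy pass to
    the limit ([degenerate_spectrum]).

    _Necessity._  A test function whose square modulus is the exponential
    of the pluriharmonic part of Q1 plus a linear term has, in the first norm, a
    Gaussian integrand centred at any chosen u; comparing norms as u = t x0 and t tends to
    infinity forces Q1(x0) <= Q2(x0) ([necessity]). *)

(** * Real quadratic forms and positive definite matrices *)

Section QuadraticForms.
Context {R : realFieldType}.

Definition bil n (Q : 'M[R]_n) (x y : 'cV[R]_n) : R := (x^T *m Q *m y) 0 0.
Definition qf n (Q : 'M[R]_n) (x : 'cV[R]_n) : R := bil Q x x.
Definition posdef n (Q : 'M[R]_n) := Q^T = Q /\ forall x, x != 0 -> 0 < qf Q x.

Section Basic.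
Variable n : nat.
Implicit Types (A B D Q T : 'M[R]_n) (x y z : 'cV[R]_n).

Lemma bilDl A x y z : bil A (x + y) z = bil A x z + bil A y z.
Proof. by rewrite /bil linearD /= !mulmxDl mxE. Qed.
Lemma bilDr A x y z : bil A z (x + y) = bil A z x + bil A z y.
Proof. by rewrite /bil mulmxDr mxE. Qed.
Lemma bilZl A k x y : bil A (k *: x) y = k * bil A x y.
Proof. by rewrite /bil linearZ /= -!scalemxAl mxE. Qed.
Lemma bilZr A k x y : bil A x (k *: y) = k * bil A x y.
Proof. by rewrite /bil -scalemxAr mxE. Qed.
Lemma bilNl A x y : bil A (- x) y = - bil A x y.
Proof. by rewrite -scaleN1r bilZl mulN1r. Qed.
Lemma bilNr A x y : bil A x (- y) = - bil A x y.
Proof. by rewrite -scaleN1r bilZr mulN1r. Qed.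
Lemma bil0l A y : bil A 0 y = 0.
Proof. by rewrite /bil trmx0 !mul0mx mxE. Qed.
Lemma bilC A x y : A^T = A -> bil A x y = bil A y x.
Proof.
move=> As; rewrite /bil.
have -> : x^T *m A *m y = (y^T *m A^T *m x)^T by rewrite !trmx_mul !trmxK mulmxA.
by rewrite [LHS]mxE As.
Qed.
Lemma bil_mulmxl A B x y : bil A (B *m x) y = bil (B^T *m A) x y.
Proof. by rewrite /bil trmx_mul !mulmxA. Qed.
Lemma bil_mulmxr A B x y : bil A x (B *m y) = bil (A *m B) x y.
Proof. by rewrite /bil !mulmxA. Qed.
Lemma bil_addmx A B x y : bil (A + B) x y = bil A x y + bil B x y.
Proof. by rewrite /bil mulmxDr mulmxDl mxE. Qed.
Lemma bil_oppmx A x y : bil (- A) x y = - bil A x y.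
Proof. by rewrite /bil mulmxN mulNmx mxE. Qed.
Lemma bil_scalemx k A x y : bil (k *: A) x y = k * bil A x y.
Proof. by rewrite /bil -scalemxAr -scalemxAl mxE. Qed.

Lemma qf_addmx A B x : qf (A + B) x = qf A x + qf B x.
Proof. exact: bil_addmx. Qed.
Lemma qf_oppmx A x : qf (- A) x = - qf A x.
Proof. exact: bil_oppmx. Qed.
Lemma qf_scalemx k A x : qf (k *: A) x = k * qf A x.
Proof. exact: bil_scalemx. Qed.
Lemma qf0 A : qf A 0 = 0.
Proof. exact: bil0l. Qed.
Lemma qfN A x : qf A (- x) = qf A x.
Proof. by rewrite /qf bilNl bilNr opprK. Qed.
Lemma qfZ A k x : qf A (k *: x) = k ^+ 2 * qf A x.
Proof. by rewrite /qf bilZl bilZr mulrA expr2. Qed.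
Lemma qfD A x y : A^T = A -> qf A (x + y) = qf A x + qf A y + 2 * bil A x y.
Proof. by move=> As; rewrite /qf bilDl !bilDr (bilC y x As); ring. Qed.
Lemma qfB A x y : A^T = A -> qf A (x - y) = qf A x + qf A y - 2 * bil A x y.
Proof. by move=> As; rewrite qfD // qfN bilNr; ring. Qed.
Lemma qf_mulmx A B x : qf A (B *m x) = qf (B^T *m A *m B) x.
Proof. by rewrite /qf bil_mulmxl bil_mulmxr. Qed.

Lemma qfE A x : qf A x = \sum_i \sum_j x i 0 * A i j * x j 0.
Proof.
rewrite /qf /bil mxE exchange_big /=; apply: eq_bigr => j _; rewrite mxE mulr_suml.
by apply: eq_bigr => i _; rewrite !mxE.
Qed.

Lemma posdef_sym A : posdef A -> A^T = A. Proof. by case. Qed.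
Lemma posdef_ge0 A x : posdef A -> 0 <= qf A x.
Proof.
case=> _ pA; have [->|/pA/ltW//] := eqVneq x 0.
by rewrite qf0.
Qed.

Lemma posdefD A B : posdef A -> B^T = B -> (forall x, 0 <= qf B x) -> posdef (A + B).
Proof.
move=> [As pA] Bs pB; split; first by rewrite linearD /= As Bs.
by move=> x x0; rewrite qf_addmx ltr_wpDr // pA.
Qed.

Lemma posdef_scale k A : 0 < k -> posdef A -> posdef (k *: A).
Proof.
move=> k0 [As pA]; split; first by rewrite linearZ /= As.
by move=> x x0; rewrite qf_scalemx mulr_gt0 // pA.
Qed.

Lemma bil_CS A x y : A^T = A -> (forall z, 0 <= qf A z) -> bil A x y ^+ 2 <= qf A x * qf A y.
Proof.
move=> As pA.
have H t : 0 <= qf A x * t ^+ 2 + 2 * bil A x y * t + qf A y.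
  have := pA (t *: x + y); rewrite qfD // qfZ bilZl; lra.
have [q0|qn0] := eqVneq (qf A x) 0.
  rewrite q0 mul0r; have [b0|bn0] := eqVneq (bil A x y) 0; first by rewrite b0 expr0n.
  have := H (- (qf A y + 1) / (2 * bil A x y)); rewrite q0.
  have -> : 0 * (- (qf A y + 1) / (2 * bil A x y)) ^+ 2 +
     2 * bil A x y * (- (qf A y + 1) / (2 * bil A x y)) + qf A y = - 1 by field.
  by lra.
have q1 : 0 < qf A x by rewrite lt_def qn0 pA.
have := H (- bil A x y / qf A x).
have -> : qf A x * (- bil A x y / qf A x) ^+ 2 + 2 * bil A x y * (- bil A x y / qf A x) + qf A y =
  (qf A x * qf A y - bil A x y ^+ 2) / qf A x by field.
by rewrite pmulr_lge0 ?invr_gt0 // subr_ge0.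
Qed.

End Basic.

(** The form that remains after completing the square in the first coordinate;
    it drives the inductions on the dimension below. *)
Definition schur n (Q : 'M[R]_(1 + n)) : 'M[R]_n :=
  drsubmx Q - (Q 0 0)^-1 *: (dlsubmx Q *m ursubmx Q).

Lemma symmx_blocks m n (Q : 'M[R]_(m + n)) : Q^T = Q ->
  [/\ (ulsubmx Q)^T = ulsubmx Q, dlsubmx Q = (ursubmx Q)^T & (drsubmx Q)^T = drsubmx Q].
Proof.
move=> Qs; split; apply/matrixP => i j; rewrite !mxE -[in RHS]Qs !mxE //.
Qed.

Lemma schur_qf n (Q : 'M[R]_(1 + n)) (a : R) y : Q^T = Q -> Q 0 0 != 0 ->
  qf Q (col_mx a%:M y) = Q 0 0 * (a + (ursubmx Q *m y) 0 0 / Q 0 0) ^+ 2 + qf (schur Q) y.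
Proof.
move=> /symmx_blocks[_ dlE _] q0; set q := Q 0 0.
have ulE : ulsubmx Q = q%:M.
  by rewrite [LHS]mx11_scalar !mxE; congr (Q _ _)%:M; exact: val_inj.
rewrite /schur -/q dlE qf_addmx qf_oppmx qf_scalemx.
set r := ursubmx Q; set b := (r *m y) 0 0.
have rb : r *m y = b%:M by rewrite [LHS]mx11_scalar.
have -> : qf (r^T *m r) y = b ^+ 2.
  rewrite /qf /bil mulmxA -mulmxA rb -trmx_mul rb tr_scalar_mx -scalar_mxM !mxE /=.
  by rewrite mulr1n expr2.
rewrite /qf /bil -{1}[Q]submxK ulE dlE -/r tr_col_mx tr_scalar_mx mul_row_block mul_row_col.
rewrite !mulmxDl -!mulmxA rb.
have -> : y^T *m (r^T *m a%:M) = (b * a)%:M.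
  by rewrite mulmxA -trmx_mul rb tr_scalar_mx -scalar_mxM.
rewrite -!scalar_mxM; set z := y^T *m _.
rewrite !mxE /= !mulr1n.
by field.
Qed.

Lemma schur_det n (Q : 'M[R]_(1 + n)) : Q 0 0 != 0 -> \det Q = Q 0 0 * \det (schur Q).
Proof.
move=> q0; set q := Q 0 0.
have ulE : ulsubmx Q = q%:M.
  by rewrite [LHS]mx11_scalar !mxE; congr (Q _ _)%:M; exact: val_inj.
have E : block_mx 1%:M 0 (- q^-1 *: dlsubmx Q) 1%:M *m Q
    = block_mx q%:M (ursubmx Q) 0 (schur Q).
  rewrite -{2}[Q]submxK mulmx_block ulE !mul1mx !mul0mx !addr0; congr block_mx.
    rewrite mul_mx_scalar scalerA mulrN mulfV // scaleN1r; exact: addNr.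
  by rewrite /schur -scalemxAl scaleNr addrC.
have := congr1 determinant E; rewrite det_mulmx det_lblock det_ublock !det1 !mul1r.
by rewrite det_scalar1.
Qed.

Lemma posdef_schur n (Q : 'M[R]_(1 + n)) : posdef Q -> 0 < Q 0 0 /\ posdef (schur Q).
Proof.
move=> pQ; have Qs := posdef_sym pQ.
have q0 : 0 < Q 0 0.
  have -> : Q 0 0 = qf Q (delta_mx 0 0) by rewrite /qf /bil trmx_delta -rowE -colE !mxE.
  apply: (pQ.2); apply/eqP => /matrixP/(_ 0 0); rewrite !mxE !eqxx /= => /eqP.
  by rewrite oner_eq0.
split => //; split.
  have [_ dlE drE] := symmx_blocks Qs.
  by rewrite /schur linearB /= drE linearZ /= trmx_mul dlE trmxK.
move=> y y0; have := schur_qf (- ((ursubmx Q *m y) 0 0 / Q 0 0)) y Qs (lt0r_neq0 q0).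
rewrite addNr expr0n /= mulr0 add0r => <-; apply: pQ.2.
by apply: contra_neq y0 => /(congr1 dsubmx); rewrite col_mxKd linear0.
Qed.

Lemma posdef_det_gt0 n (Q : 'M[R]_n) : posdef Q -> 0 < \det Q.
Proof.
elim: n Q => [|n IH] Q pQ; first by rewrite det_mx00.
have [q0 pS] := posdef_schur (pQ : posdef (Q : 'M[R]_(1 + n))).
by rewrite (@schur_det n Q) ?lt0r_neq0 // mulr_gt0 // IH.
Qed.

Section Inverse.
Variable n : nat.
Implicit Types (A B D Q T : 'M[R]_n) (x y z : 'cV[R]_n).

Lemma posdef_unitmx A : posdef A -> A \in unitmx.
Proof. by move/posdef_det_gt0 => d; rewrite unitmxE unitfE gt_eqF. Qed.

Lemma qf_invmx A x : A^T = A -> A \in unitmx -> qf (invmx A) x = qf A (invmx A *m x).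
Proof. by move=> As uA; rewrite qf_mulmx trmx_inv As mulVmx // mul1mx. Qed.

Lemma posdef_invmx A : posdef A -> posdef (invmx A).
Proof.
move=> pA; have uA := posdef_unitmx pA; split; first by rewrite trmx_inv posdef_sym.
move=> x x0; rewrite qf_invmx //; last exact: posdef_sym.
apply: pA.2; apply: contra_neq x0 => H.
by rewrite -[x]mul1mx -(mulmxV uA) -mulmxA H mulmx0.
Qed.

Lemma psd_posdef A : A^T = A -> (forall x, 0 <= qf A x) -> A \in unitmx -> posdef A.
Proof.
move=> As pA uA; split => // x x0; rewrite lt_def pA andbT; apply/eqP => q0.
have := bil_CS x (A *m x) As pA; rewrite q0 mul0r /bil => H.
have : (x^T *m A *m (A *m x)) 0 0 == 0 by rewrite -sqrf_eq0 eq_le H sqr_ge0.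
rewrite -{1}As -trmx_mul mxE => /eqP s0.
have Ax : A *m x = 0.
  apply/colP => i; rewrite [RHS]mxE; apply/eqP; rewrite -sqrf_eq0.
  have H2 : forall i, true -> (A *m x)^T 0 i * (A *m x) i 0 = 0.
    by apply: psumr_eq0P => // j _; rewrite mxE -expr2 sqr_ge0.
  by have := H2 i isT; rewrite mxE -expr2 => ->.
by move/eqP: x0; apply; rewrite -[x]mul1mx -(mulVmx uA) -mulmxA Ax mulmx0.
Qed.

(** With a = A^-1 x and b = B^-1 x, expanding A(b - a) >= 0 gives
    2 B(b) <= A(b) + A(a), while A(b) < B(b). *)
Lemma posdef_inv_lt A B : posdef A -> posdef B -> (forall x, x != 0 -> qf A x < qf B x) ->
  posdef (invmx A - invmx B).
Proof.
move=> pA pB AB; have uA := posdef_unitmx pA; have uB := posdef_unitmx pB.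
have As := posdef_sym pA; have Bs := posdef_sym pB.
split; first by rewrite linearB /= !trmx_inv As Bs.
move=> x x0; set a := invmx A *m x; set b := invmx B *m x.
have b0 : b != 0.
  by apply: contra_neq x0 => H; rewrite -[x]mul1mx -(mulmxV uB) -mulmxA -/b H mulmx0.
have E : bil A b a = qf B b.
  by rewrite /qf /bil -!mulmxA /a mulKVmx // /b mulKVmx.
have := posdef_ge0 (b - a) pA; rewrite qfB // E.
have := AB _ b0; rewrite qf_addmx qf_oppmx !qf_invmx // -/a -/b; lra.
Qed.

(** Coordinates are controlled by Cauchy-Schwarz for A against A^-1 e_i. *)
Lemma posdef_dominates A T : posdef A -> exists2 c, 0 < c & forall x, `|qf T x| <= c * qf A x.
Proof.
move=> pA; have uA := posdef_unitmx pA; have As := posdef_sym pA.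
have pI := posdef_invmx pA.
pose e i : 'cV[R]_n := delta_mx i 0.
pose g i := qf (invmx A) (e i).
have g0 i : 0 <= g i by exact: posdef_ge0.
have xi x i : x i 0 ^+ 2 <= g i * qf A x.
  have -> : x i 0 = bil A (invmx A *m e i) x.
    by rewrite bil_mulmxl trmx_inv As mulVmx // /bil mulmx1 trmx_delta -rowE mxE.
  by rewrite /g qf_invmx //; apply: bil_CS => // z; exact: posdef_ge0.
exists (1 + \sum_i \sum_j `|T i j| * (g i + g j)).
  rewrite ltr_pwDl // sumr_ge0 // => i _; apply: sumr_ge0 => j _.
  by rewrite mulr_ge0 // addr_ge0.
move=> x; rewrite mulrDl mul1r ler_wpDl ?posdef_ge0 // qfE.
apply: le_trans (ler_norm_sum _ _ _) _; rewrite mulr_suml; apply: ler_sum => i _.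
apply: le_trans (ler_norm_sum _ _ _) _; rewrite mulr_suml; apply: ler_sum => j _.
rewrite !normrM mulrAC (mulrC _ `|T i j|) -mulrA ler_wpM2l //.
rewrite -normrM ler_norml.
have := xi x i; have := xi x j.
have := sqr_ge0 (x i 0 + x j 0); have := sqr_ge0 (x i 0 - x j 0).
have := mulr_ge0 (g0 i) (posdef_ge0 x pA); have := mulr_ge0 (g0 j) (posdef_ge0 x pA).
by move=> h1 h2 h3 h4 h5 h6; apply/andP; split; nra.
Qed.

(** A is the parallel sum of B and D: the covariance of a sum of independent
    Gaussians is the sum of the covariances. *)
Lemma parallel_sum A B D : posdef B -> posdef D -> invmx A = invmx B + invmx D ->
  A \in unitmx ->
  A = B - B *m invmx (B + D) *m B /\ \det A * \det (B + D) = \det B * \det D.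
Proof.
move=> pB pD AE uA; have uB := posdef_unitmx pB; have uD := posdef_unitmx pD.
have pBD : posdef (B + D) by apply: posdefD pB (posdef_sym pD) _ => x; exact: posdef_ge0.
have uBD := posdef_unitmx pBD.
have E : invmx A = invmx D *m (B + D) *m invmx B.
  by rewrite mulmxDr mulVmx // mulmxDl mul1mx -mulmxA mulmxV // mulmx1 addrC.
have A1 : A = B *m invmx (B + D) *m D.
  rewrite -[A]invmxK E; apply: (can_inj (mulKmx (_ : invmx D *m (B + D) *m invmx B \in unitmx))).
    by rewrite !unitmx_mul !unitmx_inv uB uD uBD.
  rewrite mulmxV ?unitmx_mul ?unitmx_inv ?uB ?uD ?uBD // -!mulmxA (mulKmx uB).
  by rewrite (mulKVmx uBD) mulVmx.
split.
  have -> : B - B *m invmx (B + D) *m B = B *m invmx (B + D) *m (B + D - B).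
    by rewrite mulmxBr mulmxKV.
  have -> : B + D - B = D by rewrite (addrC B) addrK.
  exact: A1.
have := congr1 determinant A1; rewrite !det_mulmx => ->.
rewrite det_inv; field.
by rewrite lt0r_neq0 // posdef_det_gt0.
Qed.

(** Completing the square in w, so that exp(-B) * exp(-D) integrates to a
    multiple of exp(-A). *)
Lemma gauss_square A B D y w : posdef B -> posdef D -> invmx A = invmx B + invmx D ->
  A \in unitmx ->
  qf B (y - w) + qf D w = qf (B + D) (w - invmx (B + D) *m B *m y) + qf A y.
Proof.
move=> pB pD AE uA; have [-> _] := parallel_sum pB pD AE uA.
have Bs := posdef_sym pB; have Ds := posdef_sym pD.
have pBD : posdef (B + D) by apply: posdefD pB (posdef_sym pD) _ => x; exact: posdef_ge0.
have BDs := posdef_sym pBD; have uBD := posdef_unitmx pBD.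
rewrite (qfB _ _ Bs) (qfB _ _ BDs) [qf (B - _) _]qf_addmx qf_oppmx [qf (B + D) w]qf_addmx.
have -> : qf (B + D) (invmx (B + D) *m B *m y) = qf (B *m invmx (B + D) *m B) y.
  by rewrite qf_mulmx trmx_mul Bs trmx_inv BDs -!mulmxA (mulKVmx uBD).
have -> : bil (B + D) w (invmx (B + D) *m B *m y) = bil B w y.
  by rewrite bil_mulmxr mulmxA mulmxV // mul1mx.
by rewrite (bilC y w Bs); ring.
Qed.

End Inverse.
End QuadraticForms.

(** * Lebesgue measure on real column vectors *)

Section Measure.
Context {R : realType}.
Notation X := (measurableTypeR R).
Notation mu := (@lebesgue_measure R).

Lemma integral_preserving d (T : measurableType d) (m : {measure set T -> \bar R})
  (phi : T -> T) (F : T -> \bar R) :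
  measurable_fun setT phi -> (forall A, measurable A -> m (phi @^-1` A) = m A) ->
  measurable_fun setT F -> (forall x, 0 <= F x)%E ->
  (\int[m]_x F (phi x) = \int[m]_x F x)%E.
Proof.
move=> mphi pres mF F0.
rewrite -[LHS](@ge0_integral_pushforward _ _ _ _ _ phi mphi m setT F) //.
by apply: eq_measure_integral => A mA _; rewrite -pres.
Qed.

Lemma lebesgue_shift (u : R) (A : set R) : measurable A ->
  mu ((fun x : R => x + u) @^-1` A) = mu A.
Proof.
move=> mA.
have ms : measurable_fun setT (fun x : X => x + u : X) by exact: measurable_funD.
apply/esym; rewrite -[RHS]/(pushforward mu (fun x : X => x + u : X) A).
apply: (lebesgue_measure_unique) => // _ [[a b]] _ <-.
rewrite /= /pushforward.
have -> : (fun x : R => x + u) @^-1` `]a, b] = `](a - u), (b - u)]%classic.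
  by apply/seteqP; split => x /=; rewrite !in_itv/= ltrBlDr lerBrDr.
rewrite !lebesgue_measure_itv /= !lte_fin ltrD2r.
by case: ifP => // _; rewrite -!EFinB; congr EFin; ring.
Qed.

Lemma integral_shift1 (u : R) (F : R -> \bar R) :
  measurable_fun setT F -> (forall x, 0 <= F x)%E ->
  (\int[mu]_x F (x + u)%R = \int[mu]_x F x)%E.
Proof.
move=> mF F0; apply: (@integral_preserving _ X mu (fun x : X => x + u : X)) => //.
  exact: measurable_funD.
move=> A mA; exact: lebesgue_shift.
Qed.

Lemma gauss1 (q c : R) : 0 < q ->
  (\int[mu]_x (expR (- (q * (x + c) ^+ 2)))%:E = (Num.sqrt (pi / q))%:E)%E.
Proof.
move=> q0.
pose s := Num.sqrt (q^-1 / 2).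
have s2 : s ^+ 2 = q^-1 / 2 by rewrite sqr_sqrtr // divr_ge0 // invr_ge0 ltW.
have s0 : s != 0 by rewrite gt_eqF // sqrtr_gt0 divr_gt0 // invr_gt0.
have pk : normal_peak s != 0 by rewrite gt_eqF // normal_peak_gt0.
have HZ : (\int[mu]_x ((normal_peak s)%:E * (normal_fun (- c) s x)%:E) =
    (normal_peak s)%:E * \int[mu]_x (normal_fun (- c) s x)%:E)%E.
  apply: ge0_integralZl => //.
  - by apply/measurable_EFinP; exact: measurable_normal_fun.
  - by move=> x _; rewrite lee_fin normal_fun_ge0.
  - by rewrite lee_fin normal_peak_ge0.
have := integral_normal_pdf (- c) s; rewrite /normal_pdf (negbTE s0).
under eq_integral => x _ do rewrite EFinM.
rewrite HZ {HZ}.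
move=> H.
under eq_integral => x _.
  have -> : - (q * (x + c) ^+ 2) = - (x - - c) ^+ 2 / (s ^+ 2 *+ 2).
    by rewrite s2 opprK; field; rewrite gt_eqF.
  over.
rewrite -/(normal_fun (- c) s) in H *.
have : ((normal_peak s)^-1%:E * ((normal_peak s)%:E * \int[mu]_x (normal_fun (- c) s x)%:E) = (normal_peak s)^-1%:E)%E.
  by rewrite H mule1.
rewrite muleA -EFinM mulVf // mul1e => ->.
by rewrite /normal_peak invrK s2; congr (Num.sqrt _)%:E; field; rewrite gt_eqF.
Qed.

(** Tuples carry the measure and column vectors the matrix action. *)
Definition tcol n (a : n.-tuple X) : 'cV[R]_n := \col_i tnth a i.
Definition tup n (x : 'I_n -> R) : n.-tuple X := [tuple (x i : X) | i < n].

Lemma tcol_tup n (x : 'I_n -> R) : tcol (tup x) = \col_i x i.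
Proof. by apply/colP => i; rewrite !mxE tnth_mktuple. Qed.

Lemma measurable_tup d (T : measurableType d) n (c : T -> 'I_n -> R) :
  (forall i, measurable_fun setT (fun t => c t i)) ->
  measurable_fun setT (fun t => tup (c t)).
Proof.
move=> mc; apply/measurable_fun_tnthP => i.
suff -> : (@tnth n X ^~ i) \o (fun t => tup (c t)) = (fun t => c t i) by exact: mc.
by apply/funext => t /=; rewrite tnth_mktuple.
Qed.

Lemma measurable_tcol n i : measurable_fun setT (fun a : n.-tuple X => tcol a i 0).
Proof.
rewrite (_ : (fun _ => _) = (@tnth n X ^~ i)); first exact: measurable_tnth.
by apply/funext => a; rewrite mxE.
Qed.

Definition vmeas n (h : 'cV[R]_n -> \bar R) := measurable_fun setT (h \o @tcol n).

Lemma vmeas_comp d (T : measurableType d) n (c : T -> 'cV[R]_n) h :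
  (forall i, measurable_fun setT (fun t => c t i 0)) -> vmeas h ->
  measurable_fun setT (fun t => h (c t)).
Proof.
move=> mc mh.
rewrite (_ : (fun _ => _) = (h \o @tcol n) \o (fun t => tup (fun i => c t i 0))).
  by apply: measurableT_comp => //; exact: measurable_tup.
apply/funext => t /=; rewrite tcol_tup; congr h; apply/colP => i; by rewrite mxE.
Qed.

Definition vint n (h : 'cV[R]_n -> \bar R) := (\int[lebesgue_tuple R n]_a h (tcol a))%E.

Lemma int_tupleS n (F : n.+1.-tuple X -> \bar R) :
  measurable_fun setT F -> (forall x, 0 <= F x)%E ->
  (\int[lebesgue_tuple R n.+1]_a F a =
   \int[mu]_x \int[lebesgue_tuple R n]_t F (cons_pair (x, t)))%E.
Proof.
move=> mF F0.
rewrite -(@fubini_tonelli1 _ _ _ _ _ mu (lebesgue_tuple R n) (fun p => F (cons_pair p))) //; last first.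
  by apply: measurableT_comp => //; exact: measurable_cons_pair.
rewrite -[RHS](@ge0_integral_pushforward _ _ _ _ _ _ (@measurable_cons_pair _ X n) _ setT F) //.
Qed.

Lemma int_tuple0 (F : 0.-tuple X -> \bar R) : measurable_fun setT F ->
  (\int[lebesgue_tuple R 0]_a F a = F [tuple])%E.
Proof. by move=> mF; rewrite /= integral_dirac // diracT mul1e. Qed.

Lemma measurable_consp d (T : measurableType d) n (f : T -> X) (g : T -> n.-tuple X) :
  measurable_fun setT f -> measurable_fun setT g ->
  measurable_fun setT (fun t => cons_pair (f t, g t)).
Proof. exact: measurable_cons. Qed.

Lemma measurable_catp d (T : measurableType d) m n (f : T -> m.-tuple X) (g : T -> n.-tuple X) :
  measurable_fun setT f -> measurable_fun setT g ->
  measurable_fun setT (fun t => [tuple of f t ++ g t]).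
Proof.
move=> mf mg; apply/measurable_fun_tnthP => i.
case: (splitP i) => j ij.
  have -> : (@tnth (m + n) X ^~ i) \o (fun t => [tuple of f t ++ g t]) = (@tnth m X ^~ j) \o f.
    apply/funext => t /=; rewrite (_ : i = lshift n j) ?tnth_lshift //.
    exact: val_inj.
  by apply: measurableT_comp => //; exact: measurable_tnth.
have -> : (@tnth (m + n) X ^~ i) \o (fun t => [tuple of f t ++ g t]) = (@tnth n X ^~ j) \o g.
  apply/funext => t /=; rewrite (_ : i = rshift m j) ?tnth_rshift //.
  exact: val_inj.
by apply: measurableT_comp => //; exact: measurable_tnth.
Qed.

(** Translation invariance, one coordinate at a time. *)
Lemma tuple_shift n (u : 'I_n -> R) (F : n.-tuple X -> \bar R) :
  measurable_fun setT F -> (forall x, 0 <= F x)%E ->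
  (\int[lebesgue_tuple R n]_a F (tup (fun i => tnth a i + u i)%R) = \int[lebesgue_tuple R n]_a F a)%E.
Proof.
elim: n u F => [|n IH] u F mF F0.
  by apply: eq_integral => a _; congr F; rewrite [LHS]tuple0 [RHS]tuple0.
have msh m (v : 'I_m -> R) : measurable_fun setT (fun a : m.-tuple X => tup (fun i => tnth a i + v i)).
  by apply: measurable_tup => i; apply: measurable_funD => //; exact: measurable_tnth.
have mFs : measurable_fun setT (fun a : n.+1.-tuple X => F (tup (fun i => tnth a i + u i))).
  by apply: measurableT_comp => //; exact: msh.
apply: etrans (int_tupleS mFs (fun x => F0 _)) _.
apply: etrans (esym (int_tupleS mF F0)).
pose G x := (\int[lebesgue_tuple R n]_t F (cons_pair (x, t)))%E.
have mF' x : measurable_fun setT (fun t => F (cons_pair (x, t))).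
  by apply: measurableT_comp => //; exact: measurable_consp.
have mG : measurable_fun setT G.
  apply: (measurable_fun_fubini_tonelli_F (fun p => F (cons_pair p))) => //.
  by apply: measurableT_comp => //; exact: measurable_cons_pair.
have G0 x : (0 <= G x)%E by exact: integral_ge0.
apply: etrans (integral_shift1 (u ord0) mG G0).
apply: eq_integral => x _.
apply: etrans (IH (fun i => u (lift ord0 i)) _ (mF' _) (fun t => F0 _)).
apply: eq_integral => t _; congr F.
apply: eq_from_tnth => i; rewrite tnth_mktuple /cons_pair /=.
case: (unliftP ord0 i) => [j ->|->]; last by rewrite !tnth0.
by rewrite !tnthS tnth_mktuple.
Qed.

Lemma int_tuple_cat m n (F : (m + n).-tuple X -> \bar R) :
  measurable_fun setT F -> (forall x, 0 <= F x)%E ->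
  (\int[lebesgue_tuple R (m + n)]_a F a =
   \int[lebesgue_tuple R m]_a \int[lebesgue_tuple R n]_b F [tuple of a ++ b])%E.
Proof.
elim: m F => [|m IH] F mF F0.
  have E (a : 0.-tuple X) (b : n.-tuple X) : [tuple of a ++ b] = b :> n.-tuple X.
    by apply: val_inj; rewrite /= (tuple0 a).
  rewrite int_tuple0; last first.
    apply: (@measurable_fun_fubini_tonelli_F _ _ _ _ _ (lebesgue_tuple R n) (fun p : _.-tuple X * n.-tuple X => F [tuple of p.1 ++ p.2])) => //.
    by apply: measurableT_comp => //; exact: measurable_catp.
  by apply: eq_integral => b _; congr F; rewrite E.
rewrite (@int_tupleS (m + n) F) // (@int_tupleS m); last 2 first.
- apply: (@measurable_fun_fubini_tonelli_F _ _ _ _ _ (lebesgue_tuple R n) (fun p : _.-tuple X * n.-tuple X => F [tuple of p.1 ++ p.2])) => //.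
  by apply: measurableT_comp => //; exact: measurable_catp.
- by move=> x; exact: integral_ge0.
apply: eq_integral => x _.
have mFx : measurable_fun setT (fun t : (m + n).-tuple X => F (cons_pair (x, t))).
  by apply: measurableT_comp => //; exact: measurable_consp.
apply: etrans (IH (fun t => F (cons_pair (x, t))) mFx (fun t => F0 _)) _.
apply: eq_integral => a _; apply: eq_integral => b _; congr F.
exact: val_inj.
Qed.

Lemma tcol_cat m n (a : m.-tuple X) (b : n.-tuple X) :
  tcol [tuple of a ++ b] = col_mx (tcol a) (tcol b).
Proof.
apply/colP => i; rewrite !mxE; case: (splitP i) => j ij; rewrite mxE.
  by rewrite (_ : i = lshift n j) ?tnth_lshift //; exact: val_inj.
by rewrite (_ : i = rshift m j) ?tnth_rshift //; exact: val_inj.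
Qed.

Lemma eq_vint n (h1 h2 : 'cV[R]_n -> \bar R) : h1 =1 h2 -> vint h1 = vint h2.
Proof. by move=> E; apply: eq_integral => a _; rewrite E. Qed.

Lemma vint_ge0 n (h : 'cV[R]_n -> \bar R) : (forall x, 0 <= h x)%E -> (0 <= vint h)%E.
Proof. by move=> h0; exact: integral_ge0. Qed.

Lemma vint_shift n (u : 'cV[R]_n) (h : 'cV[R]_n -> \bar R) :
  vmeas h -> (forall x, 0 <= h x)%E -> vint (fun x => h (x + u)) = vint h.
Proof.
move=> mh h0; rewrite /vint -(@tuple_shift n (fun i => u i 0) (h \o @tcol n)) //; last by move=> a; exact: h0.
apply: eq_integral => a _ /=; congr h; rewrite tcol_tup.
by apply/colP => i; rewrite !mxE.
Qed.

Lemma vmeas_cat m n (h : 'cV[R]_(m + n) -> \bar R) : vmeas h ->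
  measurable_fun setT (fun p : m.-tuple X * n.-tuple X => h (col_mx (tcol p.1) (tcol p.2))).
Proof.
move=> mh; apply: vmeas_comp => // i.
under eq_fun => t do rewrite -tcol_cat mxE.
apply: (@measurableT_comp _ _ _ _ _ _ (@tnth (m + n) X ^~ i)).
  exact: measurable_tnth.
exact: measurable_catp.
Qed.

Lemma vint_tonelli m n (k : 'cV[R]_m -> 'cV[R]_n -> \bar R) :
  measurable_fun setT (fun p : m.-tuple X * n.-tuple X => k (tcol p.1) (tcol p.2)) ->
  (forall x y, 0 <= k x y)%E ->
  vint (fun x => vint (k x)) = vint (fun y => vint (k ^~ y)).
Proof.
move=> mk k0; rewrite /vint.
exact: (@fubini_tonelli _ _ _ _ _ (lebesgue_tuple R m) (lebesgue_tuple R n)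
  (fun p => k (tcol p.1) (tcol p.2))).
Qed.

Lemma vint_catl m n (h : 'cV[R]_(m + n) -> \bar R) : vmeas h -> (forall x, 0 <= h x)%E ->
  vint h = vint (fun x => vint (fun y => h (col_mx x y))).
Proof.
move=> mh h0; apply: etrans (int_tuple_cat mh (fun a => h0 _)) _.
by apply: eq_integral => a _; apply: eq_integral => b _ /=; rewrite tcol_cat.
Qed.

Lemma vint_catr m n (h : 'cV[R]_(m + n) -> \bar R) : vmeas h -> (forall x, 0 <= h x)%E ->
  vint h = vint (fun y => vint (fun x => h (col_mx x y))).
Proof.
move=> mh h0; apply: etrans (vint_catl mh h0) _.
by apply: (@vint_tonelli m n (fun x y => h (col_mx x y))); first exact: vmeas_cat.
Qed.

Lemma vmeas_colu m n (y : n.-tuple X) (h : 'cV[R]_(m + n) -> \bar R) : vmeas h ->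
  vmeas (fun x => h (col_mx x (tcol y))).
Proof.
move=> mh; apply: (@measurableT_comp _ _ _ _ _ _ (fun p : m.-tuple X * n.-tuple X => h (col_mx (tcol p.1) (tcol p.2)))
   _ (fun x => (x, y))); first exact: vmeas_cat.
exact: measurable_pair2.
Qed.

Lemma vmeas_cold m n (x : m.-tuple X) (h : 'cV[R]_(m + n) -> \bar R) : vmeas h ->
  vmeas (fun y => h (col_mx (tcol x) y)).
Proof.
move=> mh; apply: (@measurableT_comp _ _ _ _ _ _ (fun p : m.-tuple X * n.-tuple X => h (col_mx (tcol p.1) (tcol p.2)))
   _ (fun y => (x, y))); first exact: vmeas_cat.
exact: measurable_pair1.
Qed.

Definition rot n (c s : R) (x : 'cV[R]_(n + n)) : 'cV[R]_(n + n) :=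
  col_mx (c *: usubmx x - s *: dsubmx x) (s *: usubmx x + c *: dsubmx x).
(** Shears are translations of one half of the coordinates by an amount that
    depends on the other half, so they preserve the measure by Tonelli. *)
Definition shearu n (k : R) (x : 'cV[R]_(n + n)) := col_mx (usubmx x + k *: dsubmx x) (dsubmx x).
Definition sheard n (k : R) (x : 'cV[R]_(n + n)) := col_mx (usubmx x) (dsubmx x + k *: usubmx x).

Lemma vmeas_lin n m (M : 'cV[R]_m -> 'cV[R]_n) (h : 'cV[R]_n -> \bar R) :
  (forall i, exists c : 'I_m -> R, forall x, M x i 0 = \sum_j c j * x j 0) ->
  vmeas h -> vmeas (h \o M).
Proof.
move=> HM mh; apply: (vmeas_comp (c := fun t => M (tcol t))) => // i.
have [c cP] := HM i; under eq_fun => t do rewrite cP.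
apply: measurable_sum => j; apply: measurable_funM => //; exact: measurable_tcol.
Qed.

Lemma vint_shearu n k (h : 'cV[R]_(n + n) -> \bar R) : vmeas h -> vmeas (h \o @shearu n k) ->
  (forall x, 0 <= h x)%E -> vint (h \o @shearu n k) = vint h.
Proof.
move=> mh mh' h0; apply: etrans (vint_catr mh' (fun x => h0 _)) _.
apply: etrans (esym (vint_catr mh h0)); apply: eq_integral => b _.
apply: etrans (@vint_shift n (k *: tcol b) (fun a => h (col_mx a (tcol b))) (vmeas_colu b mh) (fun x => h0 _)).
by apply: eq_integral => a _ /=; rewrite /shearu col_mxKu col_mxKd.
Qed.

Lemma vint_sheard n k (h : 'cV[R]_(n + n) -> \bar R) : vmeas h -> vmeas (h \o @sheard n k) ->
  (forall x, 0 <= h x)%E -> vint (h \o @sheard n k) = vint h.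
Proof.
move=> mh mh' h0; apply: etrans (vint_catl mh' (fun x => h0 _)) _.
apply: etrans (esym (vint_catl mh h0)); apply: eq_integral => b _.
apply: etrans (@vint_shift n (k *: tcol b) (fun a => h (col_mx (tcol b) a)) (vmeas_cold b mh) (fun x => h0 _)).
by apply: eq_integral => a _ /=; rewrite /sheard col_mxKu col_mxKd.
Qed.

Lemma vmeas_mulmx n m (A : 'M[R]_(n, m)) (h : 'cV[R]_n -> \bar R) :
  vmeas h -> vmeas (fun x => h (A *m x)).
Proof.
apply: (@vmeas_lin n m (fun x => A *m x)) => i.
by exists (A i) => x; rewrite mxE.
Qed.

Definition rotmx n (c s : R) : 'M[R]_(n + n) := block_mx c%:M (- s%:M) s%:M c%:M.

Lemma block_mx_col n (a b c d : R) (x : 'cV[R]_(n + n)) :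
  block_mx a%:M b%:M c%:M d%:M *m x =
  col_mx (a *: usubmx x + b *: dsubmx x) (c *: usubmx x + d *: dsubmx x).
Proof. by rewrite -{1}[x]vsubmxK mul_block_col !mul_scalar_mx. Qed.

Lemma shearuE n k (x : 'cV[R]_(n + n)) : shearu k x = block_mx 1%:M k%:M 0%:M 1%:M *m x.
Proof. by rewrite block_mx_col !scale1r scale0r add0r. Qed.
Lemma sheardE n k (x : 'cV[R]_(n + n)) : sheard k x = block_mx 1%:M 0%:M k%:M 1%:M *m x.
Proof. by rewrite block_mx_col !scale1r scale0r addr0 addrC. Qed.
Lemma rotmxE n c s (x : 'cV[R]_(n + n)) : rotmx n c s *m x = rot c s x.
Proof. by rewrite /rotmx -(raddfN (@scalar_mx R n)) block_mx_col scaleNr. Qed.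

(** A rotation by an angle other than pi is a product of three shears, with
    k = - tan(angle / 2); the angle pi is twice a quarter turn. *)
Lemma vint_rot n c s (h : 'cV[R]_(n + n) -> \bar R) : vmeas h ->
  (forall x, 0 <= h x)%E -> c ^+ 2 + s ^+ 2 = 1 ->
  vint (fun x => h (rotmx n c s *m x)) = vint h.
Proof.
have main c' s' (h' : 'cV[R]_(n + n) -> \bar R) : vmeas h' -> (forall x, 0 <= h' x)%E ->
    c' ^+ 2 + s' ^+ 2 = 1 -> c' != -1 ->
    vint (fun x => h' (rotmx n c' s' *m x)) = vint h'.
  move=> mh h0 cs c1.
  have c10 : 1 + c' != 0 by rewrite addrC addr_eq0.
  pose k := - s' / (1 + c').
  have msu (g : 'cV[R]_(n + n) -> \bar R) : vmeas g -> vmeas (g \o shearu k).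
    by move=> mg; rewrite (_ : g \o _ = fun x => g (block_mx 1%:M k%:M 0%:M 1%:M *m x)); [exact: vmeas_mulmx|apply/funext => x /=; rewrite shearuE].
  have msd (g : 'cV[R]_(n + n) -> \bar R) : vmeas g -> vmeas (g \o sheard s').
    by move=> mg; rewrite (_ : g \o _ = fun x => g (block_mx 1%:M 0%:M s'%:M 1%:M *m x)); [exact: vmeas_mulmx|apply/funext => x /=; rewrite sheardE].
  have E x : rotmx n c' s' *m x = shearu k (sheard s' (shearu k x)).
    rewrite rotmxE /rot /shearu /sheard !col_mxKu !col_mxKd.
    have e1 : 1 + k * s' = c'.
      apply: (mulfI c10); rewrite /k mulrDr mulr1 mulrA mulrA.
      have -> : (1 + c') * - s' / (1 + c') * s' = - s' ^+ 2 by field.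
      have -> : s' ^+ 2 = 1 - c' ^+ 2 by rewrite -cs; ring.
      by ring.
    have e2 : k + k * c' = - s' by rewrite /k; field.
    congr col_mx.
      rewrite !scalerDr !scalerA; apply/colP => i; rewrite !mxE.
      transitivity ((1 + k * s') * usubmx x i 0 + (k + k * (1 + k * s')) * dsubmx x i 0); last first.
        rewrite !mxE; ring.
      by rewrite e1 e2 !mxE; ring.
    rewrite !scalerDr !scalerA; apply/colP => i; rewrite !mxE.
    transitivity (s' * usubmx x i 0 + (1 + k * s') * dsubmx x i 0); last first.
      rewrite !mxE; ring.
    by rewrite e1 !mxE.
  apply: etrans (eq_vint (fun x => congr1 h' (E x))) _.
  have m1 := msu _ mh; have m2 := msd _ m1; have m3 := msu _ m2.
  apply: etrans (vint_shearu m2 m3 (fun x => h0 _)) _.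
  apply: etrans (vint_sheard m1 m2 (fun x => h0 _)) _.
  exact: vint_shearu mh m1 h0.
move=> mh h0 cs; have [c1|] := eqVneq c (-1); last exact: main.
have s0 : s = 0.
  by apply/eqP; rewrite -sqrf_eq0 -subr_eq0; apply/eqP; rewrite subr0; move: cs; rewrite c1; lra.
have c0 : (0 : R) != -1 by rewrite eq_sym oppr_eq0 oner_eq0.
have E (x : 'cV[R]_(n + n)) : rotmx n c s *m x = rotmx n 0 1 *m (rotmx n 0 1 *m x).
  rewrite !rotmxE /rot c1 s0 !col_mxKu !col_mxKd !scale0r !scale1r !scaleN1r.
  by rewrite !add0r !addr0 subr0.
apply: etrans (eq_vint (fun x => congr1 h (E x))) _.
have cs01 : (0 : R) ^+ 2 + 1 ^+ 2 = 1 by ring.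
have m1 := vmeas_mulmx (rotmx n 0 1) mh.
exact: etrans (main 0 1 _ m1 (fun x => h0 _) cs01 c0) (main 0 1 h mh h0 cs01 c0).
Qed.

End Measure.

(** * Goursat's theorem and circular means *)

Notation normC := (@Normc.normc _).
Section ComplexDifferentiation.
Context {R : realType}.
Notation C := R[i].

Lemma cgt0E (e : C) : 0 < e -> 0 < complex.Re e /\ e = (complex.Re e)%:C%C.
Proof.
by case: e => a b; rewrite ltcE /= => /andP[/eqP -> a0].
Qed.

Lemma lec_norm (z : C) (e : R) : (`|z| <= e%:C%C) = (normC z <= e).
Proof. exact: lecR. Qed.
Lemma ltc_norm (z : C) (e : R) : (`|z| < e%:C%C) = (normC z < e).
Proof. exact: ltcR. Qed.

Lemma nbhsC_normP (z : C) (P : C -> Prop) :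
  (\forall y \near (z : C^o), P y) <->
  exists2 d : R, 0 < d & forall y, normC (y - z) < d -> P y.
Proof.
split=> [/nbhs_ballP[d /= d0 dP]|[d d0 dP]].
  have [d0' dE] := cgt0E d0; exists (complex.Re d) => // y yd.
  by apply: dP; rewrite -ball_normE /ball_ /= distrC dE ltc_norm.
apply/nbhs_ballP; exists d%:C%C => /=; first by rewrite ltcR.
move=> y; rewrite -ball_normE /ball_ /= distrC ltc_norm; exact: dP.
Qed.

(** Complex differentiability in epsilon-delta form, with derivative c: the
    arguments below work with explicit radii. *)
Definition cdiff (F : C -> C) (z c : C) := forall e : R, 0 < e ->
  exists2 d : R, 0 < d &
  forall h, normC h < d -> normC (F (z + h) - F z - c * h) <= e * normC h.

Lemma differentiable_cdiff (F : C -> C) z :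
  differentiable (F : C^o -> C^o) (z : C^o) -> exists c, cdiff F z c.
Proof.
move=> /derivable1_diffP /cvg_ex[l Hl]; exists (l : C) => e e0.
have ec0 : (0 : C) < e%:C%C by rewrite ltcR.
have /cvgrPdist_le/(_ _ ec0)/nbhsC_normP[d d0 dP] := Hl.
exists d => // h hd; have [->|hn0] := eqVneq h 0.
  by rewrite addr0 mulr0 !subrr Normc.normc0 mulr0.
have := dP h; rewrite subr0 => /(_ hd hn0); rewrite lec_norm => H.
have -> : F (z + h) - F z - l * h = - ((l - h^-1 * (F (h + z) - F z)) * h).
  by rewrite (addrC h); field.
rewrite normcN Normc.normcM; apply: ler_wpM2r; last first.
  by move: H; rewrite /shift /= /GRing.scale /= mulr1.
by have := normr_ge0 h; rewrite lecR.
Qed.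

Lemma normc_ge0 (z : C) : 0 <= normC z.
Proof. by have := normr_ge0 z; rewrite lecR. Qed.

Lemma cdiff_differentiable (F : C -> C) z c :
  cdiff F z c -> differentiable (F : C^o -> C^o) (z : C^o).
Proof.
move=> H; apply/derivable1_diffP/cvg_ex; exists (c : C).
apply/cvgrPdist_le => e /cgt0E[e0 eE].
have [d d0 dP] := H _ e0.
apply/nbhsC_normP; exists d => // h; rewrite subr0 => hd hn0.
rewrite eE lec_norm /shift /= /GRing.scale /= mulr1.
have := dP h hd; have -> : F (z + h) - F z - c * h = - ((c - h^-1 * (F (h + z) - F z)) * h).
  by rewrite (addrC h); field.
rewrite normcN Normc.normcM ler_pM2r //.
rewrite lt_def normc_ge0 andbT; apply: contra_neq hn0; exact: Normc.eq0_normc.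
Qed.

(** The complex exponential, from its real and imaginary parts. *)
Definition cexp (z : C) : C :=
  Complex (expR (complex.Re z) * cos (complex.Im z)) (expR (complex.Re z) * sin (complex.Im z)).

Lemma cexpD z w : cexp (z + w) = cexp z * cexp w.
Proof.
case: z => a b; case: w => c d; rewrite /cexp /= expRD cosD sinD.
by apply/eqP; rewrite eq_complex /=; apply/andP; split; apply/eqP; ring.
Qed.

Lemma normc_cexp z : normC (cexp z) = expR (complex.Re z).
Proof.
case: z => a b; rewrite /cexp /=.
have -> : (expR a * cos b) ^+ 2 + (expR a * sin b) ^+ 2 = expR a ^+ 2 * (cos b ^+ 2 + sin b ^+ 2) by ring.
by rewrite cos2Dsin2 mulr1 sqrtr_sqr ger0_norm // expR_ge0.
Qed.

Lemma normRe_le (z : C) : `|complex.Re z| <= normC z.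
Proof. by have := normc_ge_Re z; rewrite lecR. Qed.

Lemma normIm_le (z : C) : `|complex.Im z| <= normC z.
Proof.
case: z => a b /=; rewrite -sqrtr_sqr ler_wsqrtr //.
by rewrite lerDr sqr_ge0.
Qed.

Lemma normc_le_ReIm (z : C) : normC z <= `|complex.Re z| + `|complex.Im z|.
Proof.
case: z => a b /=; rewrite -[leRHS]ger0_norm ?addr_ge0// -sqrtr_sqr ler_wsqrtr //.
rewrite sqrrD !real_normK ?num_real//.
have := mulr_ge0 (normr_ge0 a) (normr_ge0 b); lra.
Qed.

Lemma is_derive_eps (f : R -> R) (x l : R) : is_derive x (1:R) f l -> forall e : R, 0 < e ->
  exists2 d : R, 0 < d & forall h, `|h| < d -> `|f (x + h) - f x - l * h| <= e * `|h|.
Proof.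
case=> df fl e e0; move: df fl => /[dup]/cvg_ex[l' Hl] _.
rewrite /derive => fl.
have ll' : l' = l by rewrite -fl; apply/esym/(cvg_lim _ Hl).
have /cvgrPdist_le/(_ _ e0)/nbhs_ballP[d /= d0 dP] := Hl; exists d => // h hd.
have [->|hn0] := eqVneq h 0.
  by rewrite addr0 mulr0 !subrr normr0 mulr0.
have := dP h; rewrite /ball /= sub0r normrN => /(_ hd hn0).
rewrite /shift /= /GRing.scale /= mulr1 ll' => H.
have -> : f (x + h) - f x - l * h = - ((l - h^-1 * (f (h + x) - f x)) * h).
  by rewrite (addrC h); field.
by rewrite normrN normrM ler_wpM2r.
Qed.

Lemma cdiff_cexp0 : cdiff cexp 0 1.
Proof.
move=> e e0.
have e4 : 0 < Num.min (e / 10) 1 by rewrite lt_min ltr01 andbT; lra.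
have [d1 d10 H1] := is_derive_eps (is_derive_expR (0:R)) e4.
have [d2 d20 H2] := is_derive_eps (is_derive_cos (0:R)) e4.
have [d3 d30 H3] := is_derive_eps (is_derive_sin (0:R)) e4.
set e' := Num.min _ _ in e4 H1 H2 H3.
have e'1 : e' <= 1 by rewrite ge_min lexx orbT.
have e'e : e' <= e / 10 by rewrite ge_min lexx.
exists (Num.min (Num.min d1 d2) (Num.min d3 e')) => [|[a b]].
  by rewrite lt_min; apply/andP; split; rewrite lt_min ?d10 ?d20 ?d30.
rewrite !lt_min => /andP[/andP[h1 h2] /andP[h3 /andP[h5 h4]]].
have Ne' : normC (Complex a b) <= e' by rewrite le_min !ltW.
have aN := normRe_le (Complex a b); have bN := normIm_le (Complex a b).
rewrite [complex.Re _]/= [complex.Im _]/= in aN bN.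
set N := normC _ in h1 h2 h3 h4 aN bN Ne' *.
have {}H1 := H1 a (le_lt_trans aN h1).
have {}H2 := H2 b (le_lt_trans bN h2).
have {}H3 := H3 b (le_lt_trans bN h3).
move: H1 H2 H3; rewrite !add0r expR0 cos0 sin0 oppr0 mul0r !subr0 !mul1r addr0.
set A := expR a; set Cb := cos b; set Sb := sin b => H1 H2 H3.
apply: le_trans (normc_le_ReIm _) _.
rewrite /cexp /= expR0 cos0 sin0 !mul1r -/A -/Cb -/Sb oppr0 addr0.
have N0 : 0 <= N by exact: normc_ge0.
have Cb1 : `|Cb| <= 1 by rewrite ler_norml cos_geN1 cos_le1.
have A1 : `|A - 1| <= 2 * N.
  have -> : A - 1 = (A - 1 - a) + a by ring.
  apply: le_trans (ler_normD _ _) _.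
  have : e' * `|a| <= 1 * `|a| by rewrite ler_wpM2r.
  lra.
have e'a : e' * `|a| <= e' * N by rewrite ler_wpM2l // ltW.
have e'b : e' * `|b| <= e' * N by rewrite ler_wpM2l // ltW.
have eN : 0 <= e' * N by rewrite mulr_ge0 // ltW.
have K1 : `|A * Cb - 1 - a| <= e' * N * 4.
  have -> : A * Cb - 1 - a = (A - 1 - a) + (A - 1) * (Cb - 1) + (Cb - 1) by ring.
  apply: le_trans (ler_normD _ _) _.
  apply: le_trans (lerD (ler_normD _ _) (lexx _)) _.
  rewrite normrM.
  have : `|A - 1| * `|Cb - 1| <= 2 * N * (e' * N) by apply: ler_pM => //; lra.
  have := ler_wpM2r eN (ltW h4).
  lra.
have K2 : `|A * Sb - b| <= e' * N * 5.
  have -> : A * Sb - b = (A - 1) * (Sb - b) + (A - 1) * b + (Sb - b) by ring.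
  apply: le_trans (ler_normD _ _) _.
  apply: le_trans (lerD (ler_normD _ _) (lexx _)) _.
  rewrite !normrM.
  have : `|A - 1| * `|Sb - b| <= 2 * N * (e' * N) by apply: ler_pM => //; lra.
  have := ler_wpM2r eN (ltW h4).
  have : `|A - 1| * `|b| <= 2 * N * e'.
    by apply: ler_pM => //; exact: le_trans bN Ne'.
  lra.
have : e' * N * 10 <= e / 10 * N * 10 by rewrite ler_wpM2r// ler_wpM2r.
lra.
Qed.

Lemma cdiff_cexp z : cdiff cexp z (cexp z).
Proof.
move=> e e0.
have c0 : 0 < normC (cexp z) by rewrite normc_cexp expR_gt0.
have [d d0 H] := cdiff_cexp0 (divr_gt0 e0 c0).
exists d => // h hd; have := H h hd; rewrite add0r.
have c1 : cexp 0 = 1 by rewrite /cexp /= expR0 cos0 sin0 mulr1 mulr0.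
rewrite c1 mul1r cexpD => H'.
have -> : cexp z * cexp h - cexp z - cexp z * h = cexp z * (cexp h - 1 - h) by ring.
rewrite Normc.normcM -ler_pdivlMl // mulrA (mulrC _ e); exact: H'.
Qed.

Lemma differentiable_cexp (z : C) : differentiable (cexp : C^o -> C^o) (z : C^o).
Proof. exact: cdiff_differentiable (@cdiff_cexp z). Qed.

Lemma cdiff_cont (F : C -> C) z c : cdiff F z c -> forall e : R, 0 < e ->
  exists2 d : R, 0 < d & forall h, normC h < d -> normC (F (z + h) - F z) <= e.
Proof.
move=> H e e0; have [d d0 dP] := H 1 ltr01.
have c1 : 0 < 1 + normC c by rewrite ltr_pwDl ?normc_ge0.
exists (Num.min d (e / (1 + normC c))) => [|h].
  by rewrite lt_min d0 divr_gt0.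
rewrite lt_min => /andP[hd]; rewrite ltr_pdivlMr // => he.
have -> : F (z + h) - F z = (F (z + h) - F z - c * h) + c * h by ring.
apply: le_trans (le_normcD _ _) _; rewrite Normc.normcM.
by apply: le_trans (lerD (dP h hd) (lexx _)) _; rewrite -mulrDl mulrC ltW.
Qed.

Lemma mvt_bound (g dg : R -> R) (a b al e : R) : a <= b ->
  (forall t, a <= t <= b -> is_derive t (1:R) g (dg t)) ->
  (forall t, a <= t <= b -> `|dg t - al| <= e) ->
  `|g b - g a - al * (b - a)| <= e * (b - a).
Proof.
move=> ab dgP He.
have [||c cab ->] := @MVT_segment R g dg a b ab.
- by move=> x /[!in_itv]/= /andP[ax xb]; apply: dgP; rewrite !ltW.
- apply: derivable_within_continuous => x /[!in_itv]/= xab.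
  by have := dgP x xab; case.
move: cab => /[!in_itv]/= cab.
rewrite -mulrBl normrM (ger0_norm (_ : 0 <= b - a)) ?subr_ge0//.
by rewrite ler_wpM2r ?subr_ge0// He.
Qed.

Lemma mvt_const (g dg : R -> R) (a b : R) : a <= b ->
  (forall t, a <= t <= b -> is_derive t (1:R) g (dg t)) ->
  (forall t, a <= t <= b -> dg t = 0) -> g b = g a.
Proof.
move=> ab dgP dg0; have := @mvt_bound g dg a b 0 0 ab dgP.
rewrite !mul0r subr0 normr_le0 subr_eq0 => H; apply/eqP/H => t tab.
by rewrite dg0// subrr normr0.
Qed.

(** The left endpoints of nested intervals have a supremum in all of them. *)
Lemma nested_point (p l : nat -> R) : (forall k, p k <= p k.+1) ->
  (forall k, p k.+1 + l k.+1 <= p k + l k) -> (forall k, 0 <= l k) ->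
  exists x, forall k, p k <= x <= p k + l k.
Proof.
move=> p1 p2 l0.
have pm : {homo p : i j / (i <= j)%N >-> i <= j} by apply/nondecreasing_seqP.
have qm : forall i j, (i <= j)%N -> p j + l j <= p i + l i.
  move=> i j /subnK <-; elim: (j - i)%N => // k IH.
  by rewrite addSn; exact: le_trans (p2 _) IH.
have pq i j : p i <= p j + l j.
  have [ij|/ltnW ji] := leqP i j.
    by apply: le_trans (pm _ _ ij) _; rewrite lerDl.
  by apply: le_trans (qm _ _ ji); rewrite lerDl.
have ub j : ubound (range p) (p j + l j) by move=> _ [i _ <-].
exists (sup (range p)) => k; apply/andP; split.
  apply: ub_le_sup; [by exists (p 0%N + l 0%N)|by exists k].
by apply: ge_sup => //; exists (p 0%N), 0%N.
Qed.

(** Only pointwise differentiability of F is known, so path integrals of F are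
    replaced by antiderivatives along coordinate lines: U integrates Re F
    vertically and V integrates Im F horizontally.  The imaginary part of the
    integral of F around a rectangle is the second difference [rect_diff]. *)
Section Goursat.
Variables (F : C -> C) (K : R) (U V : R -> R -> R).
Hypothesis dF : forall z, exists c, cdiff F z c.
Hypothesis dU : forall s t, -K < t < K ->
  is_derive t (1:R) (U s) (complex.Re (F (Complex s t))).
Hypothesis dV : forall t s, -K < s < K ->
  is_derive s (1:R) (V ^~ t) (complex.Im (F (Complex s t))).

Definition rect_diff (p q a b : R) : R :=
  (U (p + a) (q + b) - U p (q + b) - U (p + a) q + U p q)
  - (V (p + a) (q + b) - V p (q + b) - V (p + a) q + V p q).

Lemma rect_diff_quarter p q a b :
  rect_diff p q (a + a) (b + b) = rect_diff p q a b + rect_diff (p + a) q a b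
   + rect_diff p (q + b) a b + rect_diff (p + a) (q + b) a b.
Proof. rewrite /rect_diff !addrA; ring. Qed.

(** Near (x, y), F is affine up to e (a + b), and affine functions contribute
    nothing: both second differences equal Re c times the area. *)
Lemma rect_diff_small x y : forall e : R, 0 < e ->
  exists2 d : R, 0 < d & forall p q a b, 0 <= a -> 0 <= b -> a + b < d ->
    -K < p -> p + a < K -> -K < q -> q + b < K ->
    p <= x <= p + a -> q <= y <= q + b ->
    `|rect_diff p q a b| <= e * (a + b) ^+ 2.
Proof.
move=> e e0; have [c Hc] := dF (Complex x y).
have [d d0 dP] := Hc (e / 2) (divr_gt0 e0 (ltr0Sn R 1)).
exists d => // p q a b a0 b0 abd Kp pK Kq qK /andP[px xp] /andP[qy yq].
have est s t : p <= s <= p + a -> q <= t <= q + b ->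
    normC (F (Complex s t) - F (Complex x y) - c * Complex (s - x) (t - y)) <= e / 2 * (a + b).
  move=> /andP[s1 s2] /andP[t1 t2].
  have hN : normC (Complex (s - x) (t - y)) <= a + b.
    apply: le_trans (normc_le_ReIm _) _ => /=.
    by apply: lerD; rewrite ler_norml; lra.
  have -> : Complex s t = Complex x y + Complex (s - x) (t - y).
    by apply/eqP; rewrite eq_complex /= !(addrC x) !(addrC y) !subrK !eqxx.
  apply: le_trans (dP _ (le_lt_trans hN abd)) _.
  by rewrite ler_wpM2l // ltW // divr_gt0.
have EU : `|(U (p + a) (q + b) - U p (q + b)) - (U (p + a) q - U p q)
     - (complex.Re c * a) * (q + b - q)| <= e * (a + b) * (q + b - q).
  apply: (@mvt_bound (fun t => U (p + a) t - U p t)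
    (fun t => complex.Re (F (Complex (p + a) t)) - complex.Re (F (Complex p t)))).
  - by rewrite lerDl.
  - move=> t /andP[t1 t2]; apply: is_deriveB; apply: dU; apply/andP; split; lra.
  - move=> t tq.
    have E1 := est (p + a) t _ tq; have E2 := est p t _ tq.
    have {}E1 := le_trans (normRe_le _) (E1 ltac:(apply/andP; split; lra)).
    have {}E2 := le_trans (normRe_le _) (E2 ltac:(apply/andP; split; lra)).
    move: E1 E2; case: (F (Complex (p+a) t)) (F (Complex p t)) (F (Complex x y)) (c) => [a1 b1] [a2 b2] [a3 b3] [c1 c2] /=.
    rewrite !ler_norml => /andP[??] /andP[??]; apply/andP; split; lra.
have EV : `|(V (p + a) (q + b) - V (p + a) q) - (V p (q + b) - V p q)
     - (complex.Re c * b) * (p + a - p)| <= e * (a + b) * (p + a - p).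
  apply: (@mvt_bound (fun s => V s (q + b) - V s q)
    (fun s => complex.Im (F (Complex s (q + b))) - complex.Im (F (Complex s q)))).
  - by rewrite lerDl.
  - move=> t /andP[t1 t2]; apply: is_deriveB; apply: dV; apply/andP; split; lra.
  - move=> t tq.
    have E1 := est t (q + b) tq; have E2 := est t q tq.
    have {}E1 := le_trans (normIm_le _) (E1 ltac:(apply/andP; split; lra)).
    have {}E2 := le_trans (normIm_le _) (E2 ltac:(apply/andP; split; lra)).
    move: E1 E2; case: (F (Complex t (q + b))) (F (Complex t q)) (F (Complex x y)) (c) => [a1 b1] [a2 b2] [a3 b3] [c1 c2] /=.
    rewrite !ler_norml => /andP[??] /andP[??]; apply/andP; split; lra.
move: EU EV; rewrite /rect_diff !(addrC _ a) !(addrC _ b) !addrK expr2.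
rewrite !ler_norml => /andP[??] /andP[??]; apply/andP; split; lra.
Qed.

(** Goursat's bisection: among the four quarters one keeps at least a quarter of
    the defect, and the nested rectangles shrink to a point where
    [rect_diff_small] bounds the defect by an arbitrarily small multiple of the
    squared size. *)
Lemma rect_diff0 p q a b : 0 <= a -> 0 <= b ->
  -K < p -> p + a < K -> -K < q -> q + b < K -> rect_diff p q a b = 0.
Proof.
move=> a0 b0 Kp pK Kq qK.
pose aa k : R := a / 2 ^+ k; pose bb k : R := b / 2 ^+ k.
have aaS k : aa k = aa k.+1 + aa k.+1.
  by rewrite /aa exprS; field; rewrite expf_neq0.
have bbS k : bb k = bb k.+1 + bb k.+1.
  by rewrite /bb exprS; field; rewrite expf_neq0.
have aa0 k : 0 <= aa k by rewrite divr_ge0// exprn_ge0.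
have bb0 k : 0 <= bb k by rewrite divr_ge0// exprn_ge0.
pose D k (r : R * R) := `|rect_diff r.1 r.2 (aa k) (bb k)|.
pose Q k (r r' : R * R) := [/\ D k r <= 4 * D k.+1 r', r.1 <= r'.1, r.2 <= r'.2,
   r'.1 + aa k.+1 <= r.1 + aa k & r'.2 + bb k.+1 <= r.2 + bb k].
have QP k r : exists r', Q k r r'.
  case: r => x y.
  have : D k (x, y) <= D k.+1 (x, y) + D k.+1 (x + aa k.+1, y)
        + D k.+1 (x, y + bb k.+1) + D k.+1 (x + aa k.+1, y + bb k.+1).
    rewrite {1}/D /= aaS bbS rect_diff_quarter.
    by do 3 (apply: le_trans (ler_normD _ _) _; apply: lerD => //).
  have := aa0 k.+1; have := bb0 k.+1; rewrite /Q (aaS k) (bbS k) /=.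
  move=> H1 H2 H3.
  have [|n1] := leP (D k (x, y)) (4 * D k.+1 (x, y)).
    by exists (x, y); split => //=; lra.
  have [|n2] := leP (D k (x, y)) (4 * D k.+1 (x + aa k.+1, y)).
    by exists (x + aa k.+1, y); split => //=; lra.
  have [|n3] := leP (D k (x, y)) (4 * D k.+1 (x, y + bb k.+1)).
    by exists (x, y + bb k.+1); split => //=; lra.
  by exists (x + aa k.+1, y + bb k.+1); split => //=; lra.
have [step stepP] := choice (fun kr : nat * (R * R) => QP kr.1 kr.2).
pose r := fix r k := if k is k'.+1 then step (k', r k') else (p, q).
have rP k : Q k (r k) (r k.+1) by exact: (stepP (k, r k)).
have [x xP] : exists x, forall k, (r k).1 <= x <= (r k).1 + aa k.
  by apply: nested_point => // k; case: (rP k).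
have [y yP] : exists x, forall k, (r k).2 <= x <= (r k).2 + bb k.
  by apply: nested_point => // k; case: (rP k).
have r1 k : p <= (r k).1 /\ (r k).1 + aa k <= p + a.
  elim: k => [|k [IH1 IH2]]; first by rewrite /= /aa expr0 divr1.
  case: (rP k) => _ h1 _ h2 _; split; [exact: le_trans h1|exact: le_trans IH2].
have r2 k : q <= (r k).2 /\ (r k).2 + bb k <= q + b.
  elim: k => [|k [IH1 IH2]]; first by rewrite /= /bb expr0 divr1.
  case: (rP k) => _ _ h1 _ h2; split; [exact: le_trans h1|exact: le_trans IH2].
have Dk k : `|rect_diff p q a b| <= 4 ^+ k * D k (r k).
  elim: k => [|k IH]; first by rewrite expr0 mul1r /D /= /aa /bb expr0 !divr1.
  apply: le_trans IH _; case: (rP k) => + _ _ _ _ => H.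
  by rewrite exprSr -mulrA ler_wpM2l // exprn_ge0.
apply/eqP; rewrite -normr_le0; apply/ler_addgt0Pr => e e0; rewrite add0r.
have ab1 : 0 < 1 + (a + b) ^+ 2 by rewrite ltr_pwDl ?sqr_ge0.
have [d d0 dP] := rect_diff_small x y (divr_gt0 e0 ab1).
have [k kP] : exists k, aa k + bb k < d.
  exists (Num.truncn ((a + b) / d)).+1.
  rewrite /aa /bb -mulrDl ltr_pdivrMr ?exprn_gt0//.
  have h : (a + b) / d < 2 ^+ (Num.truncn ((a + b) / d)).+1.
    apply: lt_le_trans (truncnS_gt _) _.
    by rewrite -natrX ler_nat ltnW // ltn_expl.
  by move: h; rewrite ltr_pdivrMr // mulrC.
have [? ?] := r1 k; have [? ?] := r2 k.
apply: le_trans (Dk k) _.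
have := dP (r k).1 (r k).2 (aa k) (bb k) (aa0 k) (bb0 k) kP.
move=> /(_ ltac:(lra) ltac:(lra) ltac:(lra) ltac:(lra) (xP k) (yP k)) HD.
apply: le_trans (ler_wpM2l (exprn_ge0 k (ler0n R 4)) HD) _.
have -> : (aa k + bb k) ^+ 2 = (a + b) ^+ 2 / 4 ^+ k.
  have -> : (4 : R) = 2 ^+ 2 by ring.
  by rewrite /aa /bb -mulrDl expr_div_n -!exprM mulnC.
have -> : 4 ^+ k * (e / (1 + (a + b) ^+ 2) * ((a + b) ^+ 2 / 4 ^+ k)) =
   e * (a + b) ^+ 2 / (1 + (a + b) ^+ 2).
  by field; rewrite expf_neq0 // gt_eqF.
by rewrite ler_pdivrMr // ler_wpM2l ?ltW// ltr_pwDl.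
Qed.

End Goursat.

Lemma cdiff_comp (F G : C -> C) :
  (forall z, exists c, cdiff F z c) -> (forall z, exists c, cdiff G z c) ->
  forall z, exists c, cdiff (fun z => F (G z)) z c.
Proof.
move=> dF dG z; apply: differentiable_cdiff.
have [c1 /cdiff_differentiable H1] := dG z.
have [c2 /cdiff_differentiable H2] := dF (G z).
exact: (@differentiable_comp _ _ _ _ _ _ (z : C^o) H1 H2).
Qed.

Lemma line_continuous (F : C -> C) (p : R -> C) (pr : C -> R) :
  (forall z, exists c, cdiff F z c) ->
  (forall x h, normC (p (x + h) - p x) <= `|h|) ->
  (forall z w, `|pr z - pr w| <= normC (z - w)) ->
  continuous (fun t : R => pr (F (p t)) : R).
Proof.
move=> dF pl prl x; apply/cvgrPdist_le => e e0.
have [c /cdiff_cont/(_ e e0)[d d0 dP]] := dF (p x).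
apply/nbhs_ballP; exists d => //= y; rewrite /ball /= distrC => yd.
rewrite distrC; apply: le_trans (prl _ _) _.
have -> : p y = p x + (p y - p x) by rewrite addrC subrK.
apply: dP; apply: le_lt_trans yd.
by have := pl x (y - x); rewrite (addrC x) subrK.
Qed.

Lemma primitive (h : R -> R) (K : R) : continuous h ->
  exists H : R -> R, forall t, -K < t < K -> is_derive t (1:R) H (h t).
Proof.
move=> ch.
exists (fun x => \int[lebesgue_measure]_(t in [set` `[-K, x]]) h t)%R.
move=> t /andP[t1 t2].
have [|||H1 H2] := @continuous_FTC1_closed R h (-K) t K t2.
- apply: continuous_compact_integrable; first exact: segment_compact.
  exact: continuous_subspaceT.
- exact: t1.
- exact: ch.
exact: DeriveDef H1 (etrans (esym (derive1E _ _)) H2).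
Qed.

(** In the coordinate s + i t of z = exp(s + i t), circles are vertical segments of
    length 2 pi.  Goursat on [s, 0] x [0, 2 pi] and periodicity show that the
    integral of Re (phi o exp) over such a segment does not depend on s; as s
    tends to -oo the integrand tends to Re (phi 0). *)
Section CircleMean.
Variable phi : C -> C.
Hypothesis dphi : forall z, exists c, cdiff phi z c.

Let F (z : C) := phi (cexp z).
Let dF : forall z, exists c, cdiff F z c.
Proof. by apply: cdiff_comp => // z; exists (cexp z); exact: cdiff_cexp. Qed.

Lemma circle_continuous s : continuous (fun t : R => complex.Re (F (Complex s t)) : R).
Proof.
apply: (@line_continuous F (fun t => Complex s t)) => //.
- move=> x h; apply: le_trans (normc_le_ReIm _) _ => /=.
  by rewrite subrr normr0 add0r addrAC subrr add0r.
- by move=> z w; rewrite -raddfB; exact: normRe_le.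
Qed.

Lemma circle_mean :
  (\int[lebesgue_measure]_(t in `[0%R, (2 * pi)%R]) (complex.Re (phi (cexp (Complex 0 t))))%:E
   = (2 * pi * complex.Re (phi 0))%:E)%E.
Proof.
have pi0 := pi_gt0 R; pose T : R := 2 * pi; have T0 : 0 < T by rewrite mulr_gt0.
have cRe s : continuous (fun t : R => complex.Re (F (Complex s t)) : R).
  exact: circle_continuous.
have cIm t : continuous (fun s : R => complex.Im (F (Complex s t)) : R).
  apply: (@line_continuous F (fun s => Complex s t)) => //.
  - move=> x h; apply: le_trans (normc_le_ReIm _) _ => /=.
    by rewrite subrr normr0 addr0 addrAC subrr add0r.
  - by move=> z w; rewrite -raddfB; exact: normIm_le.
have Fper s : F (Complex s T) = F (Complex s 0).
  by rewrite /F /cexp /= /T mulr2n mulrDl mul1r -mulr2n -[pi *+ 2]add0r cosD2pi sinD2pi.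
have main (e : R) : 0 < e -> exists2 H : R -> R,
    (forall t, -(T + 1) < t < T + 1 -> is_derive t (1:R) H (complex.Re (F (Complex 0 t)))) &
    `|H T - H 0 - complex.Re (phi 0) * T| <= e * T.
  move=> e0; have [c /cdiff_cont/(_ e e0)[d d0 dP]] := dphi 0.
  pose s := Num.min (ln d - 1) (-1).
  have s1 : expR s < d.
    rewrite -[ltRHS](lnK d0) ltr_expR /s; apply: le_lt_trans (_ : ln d - 1 < _); last lra.
    by rewrite ge_min lexx.
  have s0 : s < 0 by rewrite /s gt_min orbC ltrN10.
  pose K := T + 1 - s.
  have [U UP] := choice (fun s => primitive K (cRe s)).
  have [V VP] := choice (fun t => primitive K (cIm t)).
  exists (U 0); first by move=> t tK; apply: UP; rewrite /K; apply/andP; split; lra.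
  have D0 : rect_diff U (fun s t => V t s) s 0 (- s) T = 0.
    by apply: (@rect_diff0 F K) => //; rewrite /K; lra.
  (* The horizontal sides cancel by periodicity. *)
  have VT : V T 0 - V 0 0 = V T s - V 0 s.
    apply: (@mvt_const (fun s => V T s - V 0 s)
      (fun s => complex.Im (F (Complex s T)) - complex.Im (F (Complex s 0)))).
    - exact: ltW.
    - by move=> t /andP[t1 t2]; apply: is_deriveB; apply: VP; rewrite /K; apply/andP; split; lra.
    - by move=> t _; rewrite Fper subrr.
  have E : `|U s T - U s 0 - complex.Re (phi 0) * (T - 0)| <= e * (T - 0).
    apply: (@mvt_bound _ (fun t => complex.Re (F (Complex s t)))) => [|t /andP[t1 t2]|t _].
    - exact: ltW.
    - by apply: UP; rewrite /K; apply/andP; split; lra.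
    - rewrite -raddfB; apply: le_trans (normRe_le _) _.
      by have := dP (cexp (Complex s t)); rewrite add0r; apply; rewrite normc_cexp.
  move: E D0 VT; rewrite /rect_diff subr0 add0r subrr.
  move=> + ? ?; have -> // : U s T - U s 0 = U 0 T - U 0 0.
  lra.
(* Antiderivatives for different e differ by a constant. *)
have [H HP _] := main 1 ltr01.
rewrite (@continuous_FTC2 R _ H) //.
- rewrite -EFinB; congr (_%:E); apply/eqP; rewrite -subr_eq0 -normr_le0.
  apply/ler_addgt0Pr => e e0; rewrite add0r.
  have [H' HP' H'e] := main (e / T) (divr_gt0 e0 T0).
  have : H T - H' T = H 0 - H' 0.
    apply: (@mvt_const (fun t => H t - H' t)
      (fun t => complex.Re (F (Complex 0 t)) - complex.Re (F (Complex 0 t)))).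
    - exact: ltW.
    - by move=> t /andP[t1 t2]; apply: is_deriveB; [apply: HP|apply: HP']; apply/andP; split; lra.
    - by move=> t _; rewrite subrr.
  move=> E; move: H'e; rewrite divfK ?gt_eqF //.
  have -> // : H' T - H' 0 = H T - H 0 by lra.
  by rewrite mulrC.
- by apply: continuous_subspaceT; exact: cRe.
- split.
  + by move=> t; rewrite in_itv /= -/T => /andP[? ?]; case: (HP t) => //; apply/andP; split; lra.
  + apply: cvg_at_right_filter; apply: differentiable_continuous.
    by apply/derivable1_diffP; case: (HP 0) => //; apply/andP; split; lra.
  + apply: cvg_at_left_filter; apply: differentiable_continuous.
    by apply/derivable1_diffP; case: (HP T) => //; apply/andP; split; lra.
- move=> t; rewrite in_itv /= -/T => /andP[? ?]; rewrite derive1E.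
  by case: (HP t) => //; apply/andP; split; lra.
Qed.

End CircleMean.

Section Holomorphic.
Variable n : nat.
Implicit Types (f : 'cV[C]_n -> C) (x w : 'cV[C]_n).

Lemma holomorphic_slice f x w : holomorphic f ->
  forall z, exists c, cdiff (fun z => f (x + z *: w)) z c.
Proof.
move=> hf z; apply: differentiable_cdiff.
apply: (@differentiable_comp _ C^o 'cV[C^o]_n C^o (fun z => x + z *: w)); last exact: hf.
apply: differentiableD; first exact: differentiable_cst.
exact: (@differentiableZl _ C^o 'cV[C^o]_n (fun z : C^o => z)).
Qed.

Lemma holomorphic_cont f x : holomorphic f -> forall e : R, 0 < e ->
  exists2 d : R, 0 < d & forall y : 'cV[C]_n, (forall j, normC (y j 0 - x j 0) < d) ->
    normC (f y - f x) <= e.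
Proof.
move=> hf e e0.
have /differentiable_continuous/cvgrPdist_le := hf x.
have ec0 : (0 : C) < e%:C%C by rewrite ltcR.
move=> /(_ _ ec0)/nbhs_ballP[d /= /cgt0E[d0 dE] dP].
exists (complex.Re d) => // y yd; rewrite -lec_norm distrC; apply: dP.
split; first by rewrite dE ltcR.
move=> i j; rewrite (ord1 j) -ball_normE /ball_ /= distrC dE ltc_norm.
exact: yd.
Qed.

(** Lower bound of an integral by that of a continuous minorant, which may change
    sign. *)
Lemma integral_ge_cst (a b c : R) (g : R -> R) : a <= b ->
  measurable_fun [set: R] g -> (forall t, 0 <= g t) ->
  forall h : R -> R, continuous h -> (forall t, h t <= g t) ->
  (\int[lebesgue_measure]_(t in `[a, b]) (h t)%:E = c%:E)%E ->
  (c%:E <= \int[lebesgue_measure]_(t in `[a, b]) (g t)%:E)%E.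
Proof.
move=> ab mg g0 h ch hg <-.
have mh : measurable_fun [set: R] h.
  by apply: open_continuous_measurable_fun => [|x _]; [exact: openT|exact: ch].
have mI : measurable (`[a, b] : set (measurableTypeR R)) by exact: measurable_itv.
rewrite integralE; apply: (@le_trans _ _ (\int[lebesgue_measure]_(t in `[a, b]) ((EFin \o h)^\+ t)))%E.
  by apply: geeDl; rewrite oppe_le0; apply: integral_ge0.
apply: ge0_le_integral => //.
- by apply: measurable_funepos; apply/measurable_EFinP; exact: measurable_funS mh.
- by apply/measurable_EFinP; exact: measurable_funS mg.
- by move=> t _; rewrite funeposE ge_max !lee_fin hg g0.
Qed.

(** With a = f x, |f|^2 >= 2 Re (conj a f) - |a|^2 pointwise, and the right-hand
    side is the real part of a holomorphic function equal to |a|^2 at the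
    centre. *)
Lemma circle_submean f x w : holomorphic f ->
  measurable_fun [set: R] (fun t => normC (f (x + cexp (Complex 0 t) *: w)) ^+ 2) ->
  ((2 * pi * normC (f x) ^+ 2)%:E <=
   \int[lebesgue_measure]_(t in `[0%R, (2 * pi)%R])
      (normC (f (x + cexp (Complex 0 t) *: w)) ^+ 2)%:E)%E.
Proof.
move=> hf mf.
set a := f x; set N := normC a ^+ 2.
pose phi z : C := 2 * conjc a * f (x + z *: w) - N%:C%C.
have dphi z : exists c, cdiff phi z c.
  apply: differentiable_cdiff.
  have [c /cdiff_differentiable H] := holomorphic_slice x w hf z.
  apply: differentiableB; last exact: differentiable_cst.
  exact: (differentiableZ (2 * conjc a : C) H).
have aa : complex.Re (conjc a * a) = N.
  rewrite /N; case: (a) => p q /=; rewrite sqr_sqrtr ?addr_ge0 ?sqr_ge0//; ring.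
have phi0 : complex.Re (phi 0) = N.
  rewrite /phi scale0r addr0 -/a -mulrA raddfB /=.
  have -> : complex.Re (2 * (conjc a * a)) = 2 * N.
    by rewrite -aa; case: (conjc a * a) => u v /=; ring.
  by rewrite mulr_natl mulr2n addrK.
have := circle_mean dphi; rewrite phi0.
apply: integral_ge_cst => //.
- by rewrite mulr_ge0// pi_ge0.
- move=> t; exact: sqr_ge0.
- exact: circle_continuous dphi 0.
- move=> t; rewrite /phi; case: (f _) => u v; rewrite /N; case: (a) => p q /=.
  rewrite !sqr_sqrtr ?addr_ge0 ?sqr_ge0//.
  have := sqr_ge0 (p - u); have := sqr_ge0 (q - v). nra.
Qed.
End Holomorphic.
End ComplexDifferentiation.

(** * Gaussian integrals and the convolution inequality *)

Section Gaussian.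
Context {R : realType}.
Notation X := (measurableTypeR R).
Notation mu := (@lebesgue_measure R).
Notation C := R[i].

Lemma vintZ n (k : R) (h : 'cV[R]_n -> \bar R) : 0 <= k -> vmeas h -> (forall x, 0 <= h x)%E ->
  vint (fun x => k%:E * h x)%E = (k%:E * vint h)%E.
Proof.
move=> k0 mh h0; apply: (@ge0_integralZl _ _ _ (lebesgue_tuple R n) setT measurableT (h \o @tcol R n)) => //.
by move=> a _; exact: h0.
Qed.

Lemma le_vint n (h1 h2 : 'cV[R]_n -> \bar R) : vmeas h1 -> vmeas h2 -> (forall x, 0 <= h1 x)%E ->
  (forall x, h1 x <= h2 x)%E -> (vint h1 <= vint h2)%E.
Proof.
move=> m1 m2 h10 h12; apply: ge0_le_integral => //.
Qed.

Lemma measurable_qf n (Q : 'M[R]_n) d (T : measurableType d) (c : T -> 'cV[R]_n) :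
  (forall i, measurable_fun setT (fun t => c t i 0)) ->
  measurable_fun setT (fun t => qf Q (c t)).
Proof.
move=> mc; under eq_fun => t do rewrite qfE.
apply: measurable_sum => i; apply: measurable_sum => j.
by apply: measurable_funM => //; apply: measurable_funM.
Qed.

Lemma vmeas_EFin n (h : 'cV[R]_n -> R) : measurable_fun setT (h \o @tcol R n) ->
  vmeas (fun x => (h x)%:E).
Proof. by move=> mh; apply/measurable_EFinP. Qed.

Lemma measurable_gaussian n (Q : 'M[R]_n) d (T : measurableType d) (c : T -> 'cV[R]_n) :
  (forall i, measurable_fun setT (fun t => c t i 0)) ->
  measurable_fun setT (fun t => expR (- qf Q (c t))).
Proof.
move=> mc; apply: measurableT_comp; first exact: measurable_expR.
by apply: measurableT_comp => //; exact: measurable_qf.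
Qed.

Lemma vmeas_gaussian n (Q : 'M[R]_n) : vmeas (fun x => (expR (- qf Q x))%:E).
Proof.
apply: vmeas_EFin; apply: measurable_gaussian => i; exact: measurable_tcol.
Qed.

Lemma vint1 (h : 'cV[R]_1 -> \bar R) : vmeas h -> (forall x, 0 <= h x)%E ->
  vint h = (\int[mu]_x h x%:M)%E.
Proof.
move=> mh h0; apply: etrans (int_tupleS mh (fun a => h0 _)) _.
apply: eq_integral => x _.
rewrite int_tuple0; last by apply: measurableT_comp => //; exact: measurable_consp.
by congr h; apply/colP => i; rewrite (ord1 i) !mxE (tnth_nth 0) /= mulr1n.
Qed.

(** Integrate out the first coordinate and recurse on the Schur complement. *)
Lemma gaussian_integral n (Q : 'M[R]_n) : posdef Q ->
  vint (fun x => (expR (- qf Q x))%:E) = (Num.sqrt (pi ^+ n / \det Q))%:E.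
Proof.
elim: n Q => [|n IH] Q pQ.
  rewrite /vint int_tuple0; last exact: vmeas_gaussian.
  rewrite det_mx00 expr0 divr1 sqrtr1 (_ : tcol _ = 0) ?qf0 ?oppr0 ?expR0 //.
  by apply/colP => -[].
have [q0 pS] := posdef_schur (pQ : posdef (Q : 'M[R]_(1 + n))).
have Qs := posdef_sym pQ.
pose h (x : 'cV[R]_(1 + n)) := (expR (- qf (Q : 'M[R]_(1 + n)) x))%:E.
have mh : vmeas h by exact: vmeas_gaussian.
have h0 x : (0 <= h x)%E by rewrite lee_fin expR_ge0.
apply: etrans (vint_catr mh h0) _.
have inner y : vint (fun x : 'cV_1 => h (col_mx x (tcol y))) =
    ((Num.sqrt (pi / Q 0 0))%:E * (expR (- qf (schur (Q : 'M[R]_(1 + n))) (tcol y)))%:E)%E.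
  rewrite vint1 //; last exact: vmeas_colu.
  under eq_integral => x _.
    rewrite /h schur_qf // ?lt0r_neq0 // opprD expRD mulrC EFinM.
    over.
  rewrite (@ge0_integralZl _ _ _ mu setT measurableT (fun x => (expR (- (Q 0 0 * (x + (ursubmx (Q : 'M[R]_(1 + n)) *m tcol y) 0 0 / Q 0 0) ^+ 2)))%:E)) //.
  - by rewrite gauss1 // muleC.
  - apply/measurable_EFinP; apply: measurableT_comp; first exact: measurable_expR.
    apply: measurableT_comp => //; apply: measurable_funM => //; apply: measurable_funX.
    exact: measurable_funD.
rewrite {1}/vint; under eq_integral => y _ do rewrite inner.
apply: etrans (vintZ _ (vmeas_gaussian (schur (Q : 'M[R]_(1 + n)))) _) _.
- exact: sqrtr_ge0.
- by move=> x; rewrite lee_fin expR_ge0.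
rewrite IH // -EFinM -sqrtrM ?divr_ge0 ?pi_ge0 ?ltW //; congr (Num.sqrt _)%:E.
have := schur_det (lt0r_neq0 q0); rewrite -/(1 + n)%N => ->.
rewrite exprS; field; rewrite lt0r_neq0 //=.
  by rewrite lt0r_neq0 // posdef_det_gt0.
exact: posdef_det_gt0 pS.
Qed.

(** Continuity in finitely many real coordinates.  A holomorphic function is such
    a function, and [measurable_contV] deduces measurability by dyadic rounding,
    which takes countably many values. *)
Definition contV m (G : ('I_m -> R) -> R) := forall x (e : R), 0 < e ->
  exists2 d : R, 0 < d & forall y, (forall i, `|y i - x i| < d) -> `|G y - G x| <= e.

Lemma measurable_contV d (T : measurableType d) m (c : T -> 'I_m -> R) G :
  (forall i, measurable_fun setT (fun t => c t i)) -> contV G ->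
  measurable_fun setT (fun t => G (c t)).
Proof.
move=> mc cG.
pose fl (k : nat) (t : T) : {ffun 'I_m -> int} := [ffun i => Num.floor (2 ^+ k * c t i)].
pose ap k (z : {ffun 'I_m -> int}) := G (fun i => (z i)%:~R / 2 ^+ k).
apply: (@measurable_fun_cvg _ _ _ setT (fun k t => ap k (fl k t))) => [k|t _].
  move=> _ Y mY; rewrite setTI.
  have mfl z : measurable (fl k @^-1` [set z]).
    have -> : fl k @^-1` [set z] = \bigcap_(i in [set: 'I_m])
        ((fun t => 2 ^+ k * c t i) @^-1` `[(z i)%:~R, (z i + 1)%:~R[).
      apply/seteqP; split => [t /= <- i _|t /= H].
        by rewrite /= in_itv /= ffunE floor_itv.
      apply/ffunP => i; rewrite ffunE; apply: floor_def.
      by have := H i I; rewrite /= in_itv.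
    apply: fin_bigcap_measurable => // i _.
    rewrite -[X in measurable X]setTI; apply: (_ : measurable_fun setT (fun t => 2 ^+ k * c t i)) => //.
    exact: measurable_funM.
  have -> : (fun t => ap k (fl k t)) @^-1` Y =
      \bigcup_(z in [set: {ffun 'I_m -> int}]) (if `[< Y (ap k z) >] then fl k @^-1` [set z] else set0).
    apply/seteqP; split => [t /= Yt|t [z _]].
      by exists (fl k t) => //; rewrite asboolT.
    by have [Yz /= E|//] := asboolP (Y (ap k z)); move: Yz; rewrite -E.
  apply: countable_bigcupT_measurable => // z.
  by case: asboolP.
apply/cvgrPdist_le => e e0.
have [dl dl0 dP] := cG (c t) e e0.
exists (Num.truncn dl^-1).+1 => // k /= Nk.
rewrite distrC; apply: dP => i; rewrite ffunE.
have p0 : 0 < 2 ^+ k :> R by rewrite exprn_gt0.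
have k2 : dl^-1 < 2 ^+ k.
  apply: lt_le_trans (truncnS_gt _) _; rewrite -natrX ler_nat.
  by apply: leq_trans Nk _; rewrite ltnW // ltn_expl.
have /andP[f1 f2] := floor_itv (2 ^+ k * c t i).
have -> : (Num.floor (2 ^+ k * c t i))%:~R / 2 ^+ k - c t i =
   - ((2 ^+ k * c t i - (Num.floor (2 ^+ k * c t i))%:~R) / 2 ^+ k).
  by field; rewrite gt_eqF.
rewrite normrN ger0_norm; last by rewrite divr_ge0 ?subr_ge0 // ltW.
rewrite ltr_pdivrMr //; rewrite intrD1 in f2.
apply: (@lt_trans _ _ 1); first by rewrite ltrBlDl.
by have := k2; rewrite -(ltr_pM2l dl0) mulfV ?lt0r_neq0.
Qed.

(** R^2n as C^n: real parts first, imaginary parts second. *)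
Definition toC n (v : 'cV[R]_(n + n)) : 'cV[C]_n :=
  \col_j Complex (usubmx v j 0) (dsubmx v j 0).

Lemma of_ReImE n (ab : n.-tuple X * n.-tuple X) :
  of_ReIm ab = toC (col_mx (tcol ab.1) (tcol ab.2)).
Proof. by apply/colP => j; rewrite [LHS]mxE [RHS]mxE col_mxKu col_mxKd !mxE. Qed.

Lemma int_pair n (h : 'cV[R]_(n + n) -> \bar R) : vmeas h -> (forall x, 0 <= h x)%E ->
  (\int[lebesgue_tuple R n \x lebesgue_tuple R n]_ab h (col_mx (tcol ab.1) (tcol ab.2)))%E = vint h.
Proof.
move=> mh h0; apply: etrans (esym (vint_catl mh h0)).
exact: (@fubini_tonelli1 _ _ _ _ _ (lebesgue_tuple R n) (lebesgue_tuple R n)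
  (fun ab => h (col_mx (tcol ab.1) (tcol ab.2))) (vmeas_cat mh) (fun ab => h0 _)).
Qed.

Lemma measurable_holo n (f : 'cV[C]_n -> C) d (T : measurableType d) (c : T -> 'cV[C]_n) :
  holomorphic f ->
  (forall i, measurable_fun setT (fun t => complex.Re (c t i 0))) ->
  (forall i, measurable_fun setT (fun t => complex.Im (c t i 0))) ->
  measurable_fun setT (fun t => Normc.normc (f (c t)) ^+ 2).
Proof.
move=> hf mRe mIm.
apply: measurable_funX.
pose y t (i : 'I_(n + n)) : R :=
  match fintype.split i with inl j => complex.Re (c t j 0) | inr j => complex.Im (c t j 0) end.
pose G (y : 'I_(n + n) -> R) : R :=
  Normc.normc (f (\col_j Complex (y (lshift n j)) (y (rshift n j)))).
have -> : (fun t => Normc.normc (f (c t))) = (fun t => G (y t)).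
  apply/funext => t; rewrite /G; congr (Normc.normc (f _)); apply/colP => j; rewrite mxE.
  rewrite /y (unsplitK (inl j)) (unsplitK (inr j)).
  by case: (c t j 0).
apply: measurable_contV => [i|].
  by rewrite /y; case: (fintype.split i) => j.
move=> x e e0.
have [dl dl0 dP] := holomorphic_cont (\col_j Complex (x (lshift n j)) (x (rshift n j))) hf e0.
exists (dl / 2) => [|z zx]; first by rewrite divr_gt0.
rewrite /G; set a := f _; set b := f _.
have : Normc.normc (a - b) <= e.
  apply: dP => j; rewrite !mxE; apply: le_lt_trans (normc_le_ReIm _) _ => /=.
  by rewrite [ltRHS](splitr dl) ltrD.
apply: le_trans.
have t1 : Normc.normc a <= Normc.normc (a - b) + Normc.normc b.
  by have := le_normcD (a - b) b; rewrite subrK.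
have t2 : Normc.normc b <= Normc.normc (a - b) + Normc.normc a.
  by have := le_normcD (b - a) a; rewrite subrK -(opprB a b) normcN.
by rewrite ler_norml; apply/andP; split; lra.
Qed.

Lemma toC_rot n (c s : R) (x w : 'cV[R]_(n + n)) :
  toC (x + rotmx n c s *m w) = toC x + Complex c s *: toC w.
Proof.
apply/colP => j; rewrite rotmxE /rot [LHS]mxE !linearD /= col_mxKu col_mxKd !mxE.
by apply/eqP; rewrite eq_complex /=; apply/andP; split; apply/eqP; ring.
Qed.

Section MeanValue.
Variable n : nat.
Variable g : 'cV[C]_n -> C.
Hypothesis hg : holomorphic g.
Implicit Types (A B D : 'M[R]_(n + n)) (x w : 'cV[R]_(n + n)).
Let N x : R := Normc.normc (g (toC x)) ^+ 2.
Let Zc (Q : 'M[R]_(n + n)) : R := Num.sqrt (pi ^+ (n + n) / \det Q).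

Lemma measurable_N d (T : measurableType d) (c : T -> 'cV[R]_(n + n)) :
  (forall i, measurable_fun setT (fun t => c t i 0)) ->
  measurable_fun setT (fun t => N (c t)).
Proof.
move=> mc; apply: measurable_holo => // i.
  by under eq_fun => t do rewrite !mxE; exact: mc.
by under eq_fun => t do rewrite !mxE; exact: mc.
Qed.

Lemma N_ge0 x : 0 <= N x. Proof. exact: sqr_ge0. Qed.

Let mcol m i : measurable_fun setT (fun a : m.-tuple X => tcol a i 0) := @measurable_tcol R m i.

Lemma vmeas_Ng Q : vmeas (fun x => (N x * expR (- qf Q x))%:E).
Proof.
apply: vmeas_EFin; apply: measurable_funM; first exact: (measurable_N (@mcol _)).
exact: (measurable_gaussian _ (@mcol _)).
Qed.

Lemma vmeas_Nsg Q x : vmeas (fun w => (N (x + w) * expR (- qf Q w))%:E).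
Proof.
apply: vmeas_EFin; apply: measurable_funM; last exact: (measurable_gaussian _ (@mcol _)).
apply: (measurable_N (c := fun w : (n + n).-tuple X => x + tcol w)) => i.
under eq_fun => t do rewrite mxE.
by apply: measurable_funD => //; exact: mcol.
Qed.

Definition rot_invariant Q := forall c s w, c ^+ 2 + s ^+ 2 = 1 -> qf Q (rotmx n c s *m w) = qf Q w.

Lemma measurable_rot d (T : measurableType d) (a b : T -> R) (w : T -> 'cV[R]_(n + n)) :
  measurable_fun setT a -> measurable_fun setT b ->
  (forall i, measurable_fun setT (fun t => w t i 0)) ->
  forall i, measurable_fun setT (fun t => (rotmx n (a t) (b t) *m w t) i 0).
Proof.
move=> ma mb mw i; under eq_fun => t do rewrite rotmxE /rot mxE.
by case: (fintype.split i) => j; under eq_fun => t do rewrite !mxE;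
  [apply: measurable_funB|apply: measurable_funD]; apply: measurable_funM.
Qed.

(** Averaging w over its rotations exp(i t) w leaves the right-hand side unchanged,
    by invariance of D and of the measure; on each circle |g|^2 has the
    sub-mean value property. *)
Lemma gaussian_mean D x : posdef D -> rot_invariant D ->
  ((N x * Zc D)%:E <= vint (fun w => (N (x + w) * expR (- qf D w))%:E))%E.
Proof.
move=> pD rD; have pi0 := pi_gt0 R.
set I2 := vint _.
pose I : set X := `[0%R, (2 * pi)%R]%classic.
have mI : measurable I by exact: measurable_itv.
have muI : mu I = (2 * pi)%:E.
  by rewrite /I lebesgue_measure_itv /= lte_fin mulr_gt0 // oppr0 adde0.
have i0 t : 0 <= \1_I t :> R by rewrite indicE.
pose k (t : X) w : \bar R := (\1_I t * (N (x + rotmx n (cos t) (sin t) *m w) * expR (- qf D w)))%:E.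
have mcos : measurable_fun setT (cos : R -> R).
  by apply: continuous_measurable_fun; exact: continuous_cos.
have msin : measurable_fun setT (sin : R -> R).
  by apply: continuous_measurable_fun; exact: continuous_sin.
have mN' d (T : measurableType d) (t : T -> R) (w : T -> 'cV[R]_(n + n)) :
    measurable_fun setT t -> (forall i, measurable_fun setT (fun s => w s i 0)) ->
    measurable_fun setT (fun s => N (x + rotmx n (cos (t s)) (sin (t s)) *m w s)).
  move=> mt mw; apply: measurable_N => i; under eq_fun => s do rewrite mxE.
  apply: measurable_funD => //; apply: measurable_rot => //.
    exact: (measurableT_comp mcos).
  exact: (measurableT_comp msin).
have mk : measurable_fun setT (fun p : X * (n + n).-tuple X => k p.1 (tcol p.2)).
  apply/measurable_EFinP; apply: measurable_funM.
    by apply: measurableT_comp => //; exact: measurable_indic.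
  apply: measurable_funM; last first.
    by apply: measurable_gaussian => i; apply: (measurableT_comp (@mcol _ i)).
  by apply: mN' => // i; apply: (measurableT_comp (@mcol _ i)).
have k0 p : (0 <= k p.1 (tcol p.2))%E.
  by rewrite lee_fin mulr_ge0 ?i0 // mulr_ge0 ?N_ge0 ?expR_ge0.
have := @fubini_tonelli _ _ _ _ _ mu (lebesgue_tuple R (n + n)) _ mk (fun p => k0 p).
rewrite /=.
have inner1 t : (\int[lebesgue_tuple R (n + n)]_w k t (tcol w) = (\1_I t)%:E * I2)%E.
  pose h w : \bar R := (N (x + w) * expR (- qf D w))%:E.
  have mh : vmeas h := vmeas_Nsg D x.
  have h0 w : (0 <= h w)%E by rewrite lee_fin mulr_ge0 ?N_ge0 ?expR_ge0.
  transitivity (vint (fun w => (\1_I t)%:E * h (rotmx n (cos t) (sin t) *m w))%E).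
    by apply: eq_integral => w _; rewrite /k /h EFinM rD // cos2Dsin2.
  apply: etrans (vintZ (i0 t) (vmeas_mulmx (rotmx n (cos t) (sin t)) mh) (fun w => h0 _)) _.
  exact: (congr1 (fun z => (\1_I t)%:E * z)%E (@vint_rot R n (cos t) (sin t) h mh h0 (cos2Dsin2 t))).
have inner2 (w : (n + n).-tuple X) : ((2 * pi * N x * expR (- qf D (tcol w)))%:E <= \int[mu]_t k t (tcol w))%E.
  have := @circle_submean R n g (toC x) (toC (tcol w)) hg.
  have E t : toC x + cexp (Complex 0 t) *: toC (tcol w) = toC (x + rotmx n (cos t) (sin t) *m tcol w).
    by rewrite toC_rot /cexp /= expR0 !mul1r.
  under [X in measurable_fun _ X -> _]eq_fun => t do rewrite E.
  under eq_integral => t _ do rewrite E.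
  have mNt : measurable_fun setT (fun t : X => N (x + rotmx n (cos t) (sin t) *m tcol w)).
    by apply: mN' => // i; exact: measurable_cst.
  move=> /(_ mNt) H.
  have -> : (\int[mu]_t k t (tcol w) = \int[mu]_(t in I)
      ((expR (- qf D (tcol w)))%:E * (N (x + rotmx n (cos t) (sin t) *m tcol w))%:E))%E.
    rewrite [RHS]integral_mkcond; apply: eq_integral => t _; rewrite patchE /k indicE -EFinM.
    by case: ifP => _; rewrite ?mul0r // mul1r mulrC.
  have mNt' : measurable_fun I (fun t : X => (N (x + rotmx n (cos t) (sin t) *m tcol w))%:E).
    by apply/measurable_EFinP; exact: measurable_funS mNt.
  rewrite (@ge0_integralZl _ _ _ mu I mI _ mNt' (expR (- qf D (tcol w)))%:E (fun t _ => N_ge0 _) (expR_ge0 _)).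
  rewrite EFinM muleC; apply: lee_wpmul2l; first by rewrite lee_fin expR_ge0.
  exact: H.
under eq_integral => t _ do rewrite inner1.
have m1I : measurable_fun setT (fun t : X => (\1_I t : R)%:E).
  by apply/measurable_EFinP; exact: measurable_indic.
have I20 : (0 <= I2)%E.
  by apply: vint_ge0 => w; rewrite lee_fin mulr_ge0 ?N_ge0 ?expR_ge0.
rewrite (@ge0_integralZr _ _ _ mu _ measurableT _ m1I) // integral_indic // setIT.
rewrite [X in (X * I2)%E](_ : _ = (2 * pi)%:E); last exact: muI.
move=> E.
have H : ((2 * pi)%:E * (N x * Zc D)%:E <= (2 * pi)%:E * I2)%E.
  rewrite E -EFinM mulrA (EFinM _ (Zc D)) -(gaussian_integral pD).
  have p0 : 0 <= 2 * pi * N x by rewrite mulr_ge0 ?N_ge0 // mulr_ge0 // ltW.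
  rewrite -(vintZ p0 (vmeas_gaussian D) (fun w => expR_ge0 _)).
  have m1 : vmeas (fun w => (2 * pi * N x)%:E * (expR (- qf D w))%:E)%E.
    exact: measurable_funeM (vmeas_gaussian D).
  have m2 := measurable_fun_fubini_tonelli_G (m1 := mu) _ mk k0.
  apply: ge0_le_integral => //.
    by move=> w _; rewrite -EFinM lee_fin mulr_ge0 ?expR_ge0.
  by move=> w _; rewrite -EFinM; exact: inner2.
by move: H; rewrite lee_pmul2l // lte_fin mulr_gt0.
Qed.

(** The double integral of |g(x + w)|^2 exp(-D(w) - B(x)) is bounded below by the
    mean value property in w; integrating over x + w fixed instead, it is a
    Gaussian convolution and equals a multiple of the integral of
    |g|^2 exp(-A). *)
Lemma convolution_le A B D : posdef A -> posdef B -> posdef D -> rot_invariant D ->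
  invmx A = invmx B + invmx D ->
  (vint (fun x => (N x * expR (- qf B x))%:E) <=
   (Num.sqrt (\det A / \det B))%:E * vint (fun x => (N x * expR (- qf A x))%:E))%E.
Proof.
move=> pA pB pD rD AE; have uA := posdef_unitmx pA.
have pBD : posdef (B + D).
  by apply: posdefD pB (posdef_sym pD) _ => x; exact: posdef_ge0.
have dA := posdef_det_gt0 pA; have dB := posdef_det_gt0 pB.
have dD := posdef_det_gt0 pD; have dBD := posdef_det_gt0 pBD.
have [_ dets] := parallel_sum pB pD AE uA.
pose k x w : \bar R := (N (x + w) * expR (- qf D w) * expR (- qf B x))%:E.
have NeA := vmeas_Ng A. have NeB := vmeas_Ng B.
have ge0A x : (0 <= (N x * expR (- qf A x))%:E)%E by rewrite lee_fin mulr_ge0 ?N_ge0 ?expR_ge0.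
have ge0B x : (0 <= (N x * expR (- qf B x))%:E)%E by rewrite lee_fin mulr_ge0 ?N_ge0 ?expR_ge0.
have k0 x w : (0 <= k x w)%E by rewrite lee_fin mulr_ge0 ?expR_ge0 // mulr_ge0 ?N_ge0 ?expR_ge0.
have mk : measurable_fun setT (fun p : (n + n).-tuple X * (n + n).-tuple X => k (tcol p.1) (tcol p.2)).
  apply/measurable_EFinP; apply: measurable_funM; last first.
    by apply: measurable_gaussian => i; exact: (measurableT_comp (@mcol _ i)).
  apply: measurable_funM; last first.
    by apply: measurable_gaussian => i; exact: (measurableT_comp (@mcol _ i)).
  apply: (measurable_N (c := fun p : (n + n).-tuple X * (n + n).-tuple X => tcol p.1 + tcol p.2)) => i.
  under eq_fun => t do rewrite mxE.
  by apply: measurable_funD; exact: (measurableT_comp (@mcol _ i)).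
have Zc0 Q : 0 <= Zc Q by exact: sqrtr_ge0.
have lower : ((Zc D)%:E * vint (fun x => (N x * expR (- qf B x))%:E) <=
     vint (fun x => vint (k x)))%E.
  rewrite -(vintZ (Zc0 D) NeB ge0B); apply: le_vint.
  - exact: measurable_funeM NeB.
  - exact: (measurable_fun_fubini_tonelli_F (m2 := lebesgue_tuple R (n + n)) _ mk (fun p => k0 _ _)).
  - by move=> x; rewrite mule_ge0 // lee_fin.
  - move=> x; have -> : vint (k x) = ((expR (- qf B x))%:E * vint (fun w => (N (x + w) * expR (- qf D w))%:E))%E.
      rewrite -(vintZ (expR_ge0 _) (vmeas_Nsg D x)).
        by apply: eq_vint => w; rewrite /k -EFinM mulrC.
      by move=> w; rewrite lee_fin mulr_ge0 ?N_ge0 ?expR_ge0.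
    apply: le_trans (lee_wpmul2l _ (gaussian_mean x pD rD)); last by rewrite lee_fin expR_ge0.
    by rewrite -!EFinM lee_fin le_eqVlt; apply/orP; left; apply/eqP; ring.
have upper : vint (fun x => vint (k x)) = ((Zc (B + D))%:E * vint (fun x => (N x * expR (- qf A x))%:E))%E.
  pose k' y w : \bar R := (N y * expR (- qf A y) * expR (- qf (B + D) (w - invmx (B + D) *m B *m y)))%:E.
  have kk' w x : k x w = k' (x + w) w.
    rewrite /k /k'; congr (_%:E); rewrite -[LHS]mulrA -[RHS]mulrA -!expRD.
    apply: (congr1 (fun z => N (x + w) * expR z)).
    have := gauss_square (x + w) w pB pD AE uA; rewrite addrK; lra.
  have k'0 y w : (0 <= k' y w)%E by rewrite lee_fin mulr_ge0 ?expR_ge0 // mulr_ge0 ?N_ge0 ?expR_ge0.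
  have mqa (M : 'M[R]_(n + n)) d (T : measurableType d) (c e : T -> 'cV[R]_(n + n)) :
    (forall i, measurable_fun setT (fun t => c t i 0)) -> (forall i, measurable_fun setT (fun t => e t i 0)) ->
    forall i, measurable_fun setT (fun t => (c t - M *m e t) i 0).
    move=> mc me i; under eq_fun => t do rewrite !mxE.
    apply: measurable_funB => //; apply: measurable_sum => j; exact: measurable_funM.
  have mk' : measurable_fun setT (fun p : (n + n).-tuple X * (n + n).-tuple X => k' (tcol p.1) (tcol p.2)).
    apply/measurable_EFinP; apply: measurable_funM; last first.
      apply: measurable_gaussian; apply: mqa => i; exact: (measurableT_comp (@mcol _ i)).
    apply: measurable_funM.
      by apply: measurable_N => i; exact: (measurableT_comp (@mcol _ i)).
    by apply: measurable_gaussian => i; exact: (measurableT_comp (@mcol _ i)).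
  apply: etrans (vint_tonelli mk k0) _.
  transitivity (vint (fun w => vint (fun y => k' y w))).
    apply: eq_integral => w _.
    transitivity (vint (fun x => k' (x + tcol w) (tcol w))); first exact: eq_vint.
    have mkw : vmeas (fun y => k' y (tcol w)) by exact: (measurableT_comp mk' (measurable_pair2 w)).
    exact: (@vint_shift R (n + n) (tcol w) (fun y => k' y (tcol w)) mkw (fun y => k'0 _ _)).
  apply: etrans (esym (vint_tonelli mk' k'0)) _.
  rewrite -(vintZ (Zc0 _) NeA ge0A); apply: eq_vint => y.
  transitivity (vint (fun w => (N y * expR (- qf A y))%:E * (expR (- qf (B + D) (w - invmx (B + D) *m B *m y)))%:E)%E).
    by apply: eq_vint => w; rewrite -EFinM.
  have mE : vmeas (fun w => (expR (- qf (B + D) (w - invmx (B + D) *m B *m y)))%:E).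
    apply: vmeas_EFin; apply: measurable_gaussian => i.
    under eq_fun => t do rewrite mxE.
    by apply: measurable_funD => //; exact: mcol.
  have c0 : 0 <= N y * expR (- qf A y) by rewrite mulr_ge0 ?N_ge0 ?expR_ge0.
  apply: etrans (vintZ c0 mE (fun w => expR_ge0 _)) _.
  have Esh := etrans (@vint_shift R (n + n) (- (invmx (B + D) *m B *m y)) (fun w => (expR (- qf (B + D) w))%:E)
    (vmeas_gaussian (B + D)) (fun w => expR_ge0 _)) (gaussian_integral pBD).
  apply: etrans (congr1 (fun z => (N y * expR (- qf A y))%:E * z)%E Esh) _.
  exact: muleC.
rewrite upper in lower.
have ZD0 : 0 < Zc D by rewrite /Zc sqrtr_gt0 divr_gt0 // exprn_gt0 // pi_gt0.
rewrite -(@lee_pmul2l _ (Zc D)%:E) ?lte_fin //.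
apply: le_trans lower _; rewrite muleA -EFinM.
suff -> : Zc (B + D) = Zc D * Num.sqrt (\det A / \det B) by [].
rewrite /Zc -sqrtrM ?divr_ge0 ?exprn_ge0 ?pi_ge0 ?ltW //; congr Num.sqrt.
have -> : \det A / \det B = \det D / \det (B + D).
  by rewrite -[LHS](mulfK (lt0r_neq0 dBD)) [_ / _ * _]mulrAC dets; field; rewrite !lt0r_neq0.
by field; rewrite !lt0r_neq0.
Qed.

End MeanValue.
End Gaussian.

(** * The extremal pluriharmonic correction *)

Section Maximiser.
Context {R : realType}.

Section ContinuousAlgebra.
Variables (T : topologicalType) (K : numFieldType).
Implicit Types f g : T -> K.

Lemma continuous_cstR (a : K) : continuous (fun _ : T => a).
Proof. by move=> v; exact: cvg_cst. Qed.
Lemma continuous_addR f g : continuous f -> continuous g -> continuous (fun v => f v + g v).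
Proof. by move=> cf cg v; exact: (cvgD (cf v) (cg v)). Qed.
Lemma continuous_subR f g : continuous f -> continuous g -> continuous (fun v => f v - g v).
Proof. by move=> cf cg v; exact: (cvgB (cf v) (cg v)). Qed.
Lemma continuous_mulR f g : continuous f -> continuous g -> continuous (fun v => f v * g v).
Proof. by move=> cf cg v; exact: (cvgM (cf v) (cg v)). Qed.

Lemma continuous_divR_at f g w : continuous f -> continuous g -> g w != 0 ->
  {for w, continuous (fun v => f v / g v)}.
Proof. by move=> cf cg g0; exact: (cvgM (cf w) (cvgV g0 (cg w))). Qed.

Lemma continuous_sumR (I : Type) (r : seq I) (P : pred I) (F : I -> T -> K) :
  (forall i, continuous (F i)) -> continuous (fun v => \sum_(i <- r | P i) F i v).
Proof.
move=> cF; elim: r => [|i r IH].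
  by under eq_fun => v do rewrite big_nil; exact: cst_continuous.
under eq_fun => v do rewrite big_cons.
case: (P i) => //; exact: continuous_addR.
Qed.

Lemma continuous_prodR (I : Type) (r : seq I) (P : pred I) (F : I -> T -> K) :
  (forall i, continuous (F i)) -> continuous (fun v => \prod_(i <- r | P i) F i v).
Proof.
move=> cF; elim: r => [|i r IH].
  by under eq_fun => v do rewrite big_nil; exact: cst_continuous.
under eq_fun => v do rewrite big_cons.
case: (P i) => //; exact: continuous_mulR.
Qed.

Lemma continuous_detR m (X : T -> 'M[K]_m) :
  (forall i j, continuous (fun v => X v i j)) -> continuous (fun v => \det (X v)).
Proof.
move=> cX; rewrite /determinant; apply: continuous_sumR => s.
apply: continuous_mulR; first exact: continuous_cstR.
by apply: continuous_prodR => i; exact: cX.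
Qed.

Lemma closed_ge0 (f : T -> R) : continuous f -> closed [set v | 0 <= f v].
Proof.
move=> cf; rewrite (_ : [set v | 0 <= f v] = f @^-1` [set x | 0 <= x]) //.
apply: closed_comp; last exact: closed_ge.
by move=> v _; exact: cf.
Qed.

Lemma closed_all (I : Type) (P : I -> T -> Prop) :
  (forall i, closed [set v | P i v]) -> closed [set v | forall i, P i v].
Proof.
move=> cP; rewrite (_ : [set v | _] = \bigcap_(i in setT) [set v | P i v]).
  by apply: closed_bigI => i _; exact: cP.
by apply/seteqP; split => v /= H i; [move=> _; exact: H|exact: H].
Qed.
End ContinuousAlgebra.

Lemma horner_char_poly (F : fieldType) m (A : 'M[F]_m) x : (char_poly A).[x] = \det (x%:M - A).
Proof.
rewrite /char_poly -horner_evalE -det_map_mx; congr determinant.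
apply/matrixP => i j; rewrite !mxE /= horner_evalE.
by rewrite hornerD hornerN hornerMn hornerX hornerC.
Qed.

(** det(1 - t X) is the reversed characteristic polynomial, whose first two
    coefficients are 1 and - tr X. *)
Lemma det_expansion m (X : 'M[R]_m) : exists2 c : R, 0 <= c & forall t, `|t| <= 1 ->
  `|\det (1%:M - t *: X) - (1 - t * \tr X)| <= c * t ^+ 2.
Proof.
case: m X => [|m] X.
  by exists 0 => // t _; rewrite det_mx00 /mxtrace big_ord0 mulr0 subr0 subrr normr0 mul0r.
set p := char_poly X.
exists (\sum_(i < m) `|p`_i|); first by apply: sumr_ge0.
move=> t t1; have [->|t0] := eqVneq t 0.
  by rewrite scale0r subr0 det1 mul0r subr0 subrr normr0 expr0n mulr0.
have -> : \det (1%:M - t *: X) = t ^+ m.+1 * p.[t^-1].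
  rewrite horner_char_poly.
  by rewrite -detZ scalerBr scale_scalar_mx mulfV.
have -> : t ^+ m.+1 * p.[t^-1] = \sum_(i < m) p`_i * t ^+ (m.+1 - i) + (1 - t * \tr X).
  rewrite horner_coef size_char_poly big_ord_recr big_ord_recr /= mulrDr mulrDr -addrA.
  congr (_ + _).
    rewrite mulr_sumr; apply: eq_bigr => i _.
    rewrite exprVn mulrCA; congr (_ * _).
    by rewrite expfB_cond // (negbTE t0) add0n leqW // ltnW.
  have -> : p`_m.+1 = 1.
    by have /monicP := char_poly_monic X; rewrite lead_coefE size_char_poly.
  have -> : p`_m = - \tr X by exact: char_poly_trace.
  by rewrite mul1r !exprVn mulfV ?expf_neq0 // exprS; field; rewrite expf_neq0.
rewrite addrK; apply: le_trans (ler_norm_sum _ _ _) _.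
rewrite mulr_suml; apply: ler_sum => i _; rewrite normrM ler_wpM2l //.
rewrite normrX -(real_normK (num_real t)).
have im := ltn_ord i.
have -> : (m.+1 - i = m - i.+1 + 2)%N by rewrite subSn ?(ltnW im) // -(subnSK im) addn2.
by rewrite exprD ler_piMl ?sqr_ge0 // exprn_ile1.
Qed.

(** Two functions with the same value at 0 and one below the other have the same
    derivative there. *)
Lemma first_order_eq (p1 p2 : R -> R) (a1 a2 c1 c2 d : R) : 0 < d ->
  0 <= c1 -> 0 <= c2 ->
  (forall t, `|t| <= 1 -> `|p1 t - (1 - t * a1)| <= c1 * t ^+ 2) ->
  (forall t, `|t| <= 1 -> `|p2 t - (1 - t * a2)| <= c2 * t ^+ 2) ->
  (forall t, `|t| <= d -> p1 t <= p2 t) -> a1 = a2.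
Proof.
move=> d0 c10 c20 H1 H2 H.
have key s : `|s| = 1 -> s * (a2 - a1) <= 0.
  move=> s1; apply/ler_addgt0Pr => e e0; rewrite add0r.
  have c0 : 0 < c1 + c2 + 1 by lra.
  pose t := Num.min (Num.min d 1) (e / (c1 + c2 + 1)).
  have t0 : 0 < t by rewrite !lt_min d0 ltr01 divr_gt0.
  have td : t <= d by rewrite /t !ge_min lexx.
  have t1 : t <= 1 by rewrite /t !ge_min lexx orbT.
  have te : t <= e / (c1 + c2 + 1) by rewrite /t ge_min lexx orbT.
  have nt : `|s * t| = t by rewrite normrM s1 mul1r gtr0_norm.
  have := H (s * t); have := H1 (s * t); have := H2 (s * t); rewrite nt.
  have -> : (s * t) ^+ 2 = t ^+ 2 by rewrite -(real_normK (num_real (s * t))) nt.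
  move=> /(_ t1) h2 /(_ t1) h1 /(_ td) h.
  move: h1 h2; rewrite !ler_norml => /andP[h1 _] /andP[_ h2].
  have : t * (s * (a2 - a1)) <= t * (t * (c1 + c2)) by rewrite expr2 in h1 h2; lra.
  rewrite ler_pM2l // => h3.
  move: te; rewrite ler_pdivlMr //; lra.
have k1 := key 1 (normr1 _); have k2 := key (-1) (normrN1 _); lra.
Qed.

Section Jmatrix.
Variable n : nat.
Implicit Types (Q S E T : 'M[R]_(n + n)).
(** Multiplication by i. *)
Definition Jmx : 'M[R]_(n + n) := rotmx n 0 1.

Lemma JmxE : Jmx = block_mx 0 (- 1%:M) 1%:M 0.
Proof. by rewrite /Jmx /rotmx raddf0. Qed.
Lemma trJmx : Jmx^T = - Jmx.
Proof. by rewrite JmxE tr_block_mx !linearN /= !trmx0 !trmx1 opp_block_mx oppr0 opprK. Qed.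
Lemma JmxJ : Jmx *m Jmx = - 1%:M.
Proof.
rewrite JmxE mulmx_block !mul0mx !mulmx0 !add0r !addr0 mulmx1 mul1mx.
by rewrite (@scalar_mx_block _ n n) opp_block_mx oppr0.
Qed.
Lemma rotmxJ c s : rotmx n c s = c%:M + s *: Jmx.
Proof.
rewrite JmxE /rotmx (@scalar_mx_block _ n n) scale_block_mx add_block_mx.
by rewrite !scaler0 !addr0 !add0r scalerN !scalemx1.
Qed.

Definition conjJ Q := Jmx^T *m Q *m Jmx.
(** The pluriharmonic quadratic forms. *)
Definition anti S := S^T = S /\ conjJ S = - S.

Lemma conjJB Q T : conjJ (Q - T) = conjJ Q - conjJ T.
Proof. by rewrite /conjJ mulmxBr mulmxBl. Qed.
Lemma conjJD Q T : conjJ (Q + T) = conjJ Q + conjJ T.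
Proof. by rewrite /conjJ mulmxDr mulmxDl. Qed.
Lemma conjJZ k Q : conjJ (k *: Q) = k *: conjJ Q.
Proof. by rewrite /conjJ -scalemxAr -scalemxAl. Qed.
Lemma conjJK Q : conjJ (conjJ Q) = Q.
Proof.
rewrite /conjJ trJmx !mulNmx !mulmxN !mulNmx !opprK !mulmxA JmxJ mulNmx mul1mx.
by rewrite -mulmxA JmxJ mulmxN mulmx1 opprK.
Qed.
Lemma tr_conjJ Q : (conjJ Q)^T = conjJ Q^T.
Proof. by rewrite /conjJ !trmx_mul trmxK mulmxA. Qed.
Lemma qf_conjJ Q x : qf (conjJ Q) x = qf Q (Jmx *m x).
Proof. by rewrite qf_mulmx. Qed.

Lemma trace_conjJ Q T : \tr (conjJ Q *m T) = \tr (Q *m conjJ T).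
Proof.
have -> : conjJ Q *m T = Jmx^T *m (Q *m (Jmx *m T)) by rewrite /conjJ !mulmxA.
rewrite mxtrace_mulC -!mulmxA /conjJ; congr (\tr (Q *m _)).
by rewrite trJmx !mulmxN !mulNmx mulmxA.
Qed.

Lemma rot_invariant_conjJ E : E^T = E -> conjJ E = E -> rot_invariant E.
Proof.
move=> Es EJ c s w cs; rewrite rotmxJ mulmxDl mul_scalar_mx -scalemxAl qfD //.
rewrite !qfZ bilZl bilZr -qf_conjJ EJ.
have -> : bil E w (Jmx *m w) = 0.
  have : bil (conjJ E) w (Jmx *m w) = - bil E w (Jmx *m w).
    rewrite /conjJ -bil_mulmxr -bil_mulmxl mulmxA JmxJ mulNmx mul1mx bilNr.
    by rewrite bilC.
  by rewrite EJ; lra.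
by rewrite !mulr0 addr0 -mulrDl cs mul1r.
Qed.

Lemma conjJ_sub_anti E : E^T = E -> anti (E - conjJ E).
Proof.
move=> Es; split; first by rewrite linearB /= tr_conjJ Es.
by rewrite conjJB conjJK opprB.
Qed.

Lemma trace_self_eq0 m (T : 'M[R]_m) : T^T = T -> \tr (T *m T) = 0 -> T = 0.
Proof.
move=> Ts tr0; apply/matrixP => i j; rewrite [RHS]mxE; apply/eqP; rewrite -sqrf_eq0.
have E : \tr (T *m T) = \sum_k \sum_l T k l ^+ 2.
  apply: eq_bigr => k _; rewrite mxE; apply: eq_bigr => l _.
  by rewrite -{2}Ts mxE expr2.
have s0 k : true -> 0 <= \sum_l T k l ^+ 2 by move=> _; apply: sumr_ge0 => l _; exact: sqr_ge0.
rewrite E in tr0; have := psumr_eq0P s0 tr0 (i := i) isT => ti0.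
by have := psumr_eq0P (fun l _ => sqr_ge0 (T i l)) ti0 (i := j) isT => ->.
Qed.

(** Test against T = E - E^J: the trace form is positive definite on symmetric
    matrices. *)
Lemma trace_orth_anti E : E^T = E -> (forall T, anti T -> \tr (E *m T) = 0) -> conjJ E = E.
Proof.
move=> Es H; have aT := conjJ_sub_anti Es; set T := E - conjJ E in aT.
have TT : \tr (T *m T) = 0.
  rewrite {1}/T mulmxBl linearB /= trace_conjJ aT.2 mulmxN linearN /= H //.
  by rewrite oppr0 subr0.
have /eqP := trace_self_eq0 aT.1 TT.
by rewrite subr_eq0 => /eqP <-.
Qed.

Lemma antiD S T : anti S -> anti T -> anti (S + T).
Proof. by move=> [h1 h2] [h3 h4]; split; [rewrite linearD /= h1 h3|rewrite conjJD h2 h4 opprD]. Qed.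

Lemma antiZ k S : anti S -> anti (k *: S).
Proof. by move=> [h1 h2]; split; [rewrite linearZ /= h1|rewrite conjJZ h2 scalerN]. Qed.

(** S <= Q and -S = S^J <= Q^J bound S on both sides; this is why the maximisation
    below is over a compact set. *)
Lemma anti_bounded Q : Q^T = Q -> exists M : R, forall S, anti S ->
  (forall x, 0 <= qf (Q - S) x) -> forall i j, `|S i j| <= M.
Proof.
move=> Qs.
pose b x : R := `|qf Q x| + `|qf Q (Jmx *m x)|.
pose e i : 'cV[R]_(n + n) := delta_mx i 0.
exists (\sum_i \sum_j (b (e i + e j) + b (e i - e j))) => S [Ss aS] pS i j.
have Sb x : `|qf S x| <= b x.
  have h1 := pS x; have h2 := pS (Jmx *m x).
  rewrite qf_addmx qf_oppmx in h1; rewrite qf_addmx qf_oppmx -(qf_conjJ S) aS qf_oppmx in h2.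
  rewrite /b ler_norml; have := ler_norm (qf Q x); have := ler_norm (qf Q (Jmx *m x)).
  have := normr_ge0 (qf Q x); have := normr_ge0 (qf Q (Jmx *m x)).
  by move=> ????; apply/andP; split; lra.
have SE : S i j = bil S (e i) (e j).
  by rewrite /bil trmx_delta -rowE -colE !mxE.
have h := Sb (e i + e j); have h' := Sb (e i - e j).
rewrite qfD // in h; rewrite qfB // in h'.
apply: (@le_trans _ _ (b (e i + e j) + b (e i - e j))).
  rewrite SE; move: h h'; rewrite !ler_norml => /andP[? ?] /andP[? ?].
  have b1 : 0 <= b (e i + e j) by rewrite /b addr_ge0.
  have b2 : 0 <= b (e i - e j) by rewrite /b addr_ge0.
  apply/andP; split; lra.
have b0 k l : 0 <= b (e k + e l) + b (e k - e l) by rewrite !addr_ge0.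
rewrite (bigD1 i) //= (bigD1 j) //= -addrA lerDl addr_ge0 //.
  by apply: sumr_ge0 => l _.
by apply: sumr_ge0 => k _; apply: sumr_ge0 => l _.
Qed.

Lemma posdef_perturb (A T : 'M[R]_(n + n)) : posdef A -> T^T = T ->
  exists2 d : R, 0 < d & forall t, `|t| <= d -> forall x, 0 <= qf (A - t *: T) x.
Proof.
move=> pA Ts; have [c c0 cP] := posdef_dominates T pA.
exists c^-1; first by rewrite invr_gt0.
move=> t tc x; rewrite qf_addmx qf_oppmx qf_scalemx subr_ge0.
apply: le_trans (ler_norm _) _; rewrite normrM.
apply: le_trans (ler_pM (normr_ge0 _) (normr_ge0 _) tc (cP x)) _.
by rewrite mulrA mulVf ?mul1r // gt_eqF.
Qed.

(** Maximise det(Q1 - S) / det(Q2 - S).  The denominator never vanishes because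
    Q2 - S >= Q2 - Q1 > 0; the maximum is positive, since it is so for the
    pluriharmonic half of Q1, hence it is attained where Q1 - S > 0.  There every
    pluriharmonic direction T is admissible and the first variation
    tr(((Q1 - S)^-1 - (Q2 - S)^-1) T) vanishes. *)
Lemma extremal_shift Q1 Q2 : Q1^T = Q1 -> Q2^T = Q2 -> posdef (Q1 + conjJ Q1) ->
  posdef (Q2 - Q1) ->
  exists S, [/\ anti S, posdef (Q1 - S), posdef (Q2 - S) &
     conjJ (invmx (Q1 - S) - invmx (Q2 - S)) = invmx (Q1 - S) - invmx (Q2 - S)].
Proof.
move=> Q1s Q2s pQ1 pQ.
have p2 S : S^T = S -> (forall x, 0 <= qf (Q1 - S) x) -> posdef (Q2 - S).
  move=> Ss pS; have -> : Q2 - S = (Q2 - Q1) + (Q1 - S) by rewrite addrA subrK.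
  by apply: posdefD => //; rewrite linearB /= Q1s Ss.
pose Sm (v : 'rV[R]_((n + n) * (n + n))) : 'M[R]_(n + n) := vec_mx v.
pose A := [set v | anti (Sm v) /\ forall x, 0 <= qf (Q1 - Sm v) x].
have cS i j : continuous (fun v => Sm v i j).
  by under eq_fun => v do rewrite /Sm mxE; exact: coord_continuous.
have cQ Q i j : continuous (fun v => (Q - Sm v) i j).
  rewrite (_ : (fun _ => _) = (fun v => Q i j - Sm v i j)); last first.
    by apply/funext => v; rewrite !mxE.
  apply: continuous_subR; [exact: continuous_cstR|exact: cS].
have clA : closed A.
  have cl0 (f : 'rV[R]_((n + n) * (n + n)) -> R) : continuous f -> closed [set v | f v = 0].
    move=> cf; rewrite (_ : [set v | f v = 0] = f @^-1` [set x | x = 0]) //.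
    by apply: closed_comp; [move=> v _; exact: cf|exact: closed_eq].
  have cqf x : continuous (fun v => qf (Q1 - Sm v) x).
    under eq_fun => v do rewrite qfE.
    apply: continuous_sumR => i; apply: continuous_sumR => j.
    apply: continuous_mulR; last exact: continuous_cstR.
    apply: continuous_mulR; first exact: continuous_cstR.
    exact: cQ.
  have -> : A = [set v | forall i j, Sm v i j - Sm v j i = 0] `&`
      [set v | forall i j, conjJ (Sm v) i j + Sm v i j = 0] `&`
      [set v | forall x, 0 <= qf (Q1 - Sm v) x].
    apply/seteqP; split => [v [[h1 h2] h3]|v [[h1 h2] h3]].
      split; [split|] => //= i j; first by rewrite -{1}h1 mxE subrr.
      by rewrite h2 mxE addNr.
    split => //; split; apply/matrixP => i j.
      by rewrite mxE; apply/eqP; rewrite -subr_eq0 h1.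
    by rewrite [RHS]mxE; apply/eqP; rewrite -addr_eq0 h2.
  apply: closedI; first apply: closedI.
  - apply: closed_all => i; apply: closed_all => j; apply: cl0.
    by apply: continuous_subR; exact: cS.
  - apply: closed_all => i; apply: closed_all => j; apply: cl0.
    apply: continuous_addR; last exact: cS.
    rewrite /conjJ; under eq_fun => w do rewrite mxE.
    apply: continuous_sumR => k; apply: continuous_mulR; last exact: continuous_cstR.
    under eq_fun => w do rewrite mxE.
    apply: continuous_sumR => l; apply: continuous_mulR; first exact: continuous_cstR.
    exact: cS.
  - by apply: closed_all => x; apply: closed_ge0.
have cA : compact A.
  apply: bounded_closed_compact => //.
  have [M MP] := anti_bounded Q1s.
  exists (Num.max M 0); split; first exact: num_real.
  move=> M' MM' v [aS pS]; rewrite /Num.norm /= mx_normrE.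
  apply/bigmax_leP; split; first by rewrite ltW // (le_lt_trans _ MM') // le_max lexx orbT.
  move=> [i k] _ /=; rewrite (ord1 i); case/mxvec_indexP: k => k l.
  have -> : v 0 (mxvec_index k l) = Sm v k l by rewrite mxE.
  by apply: le_trans (MP _ aS pS _ _) _; rewrite ltW // (le_lt_trans _ MM') // le_max lexx.
have [S0 [aS0 pS0 S0u]] : exists S0, [/\ anti S0, forall x, 0 <= qf (Q1 - S0) x & 0 < \det (Q1 - S0)].
  exists (2^-1 *: (Q1 - conjJ Q1)).
  have E : Q1 - 2^-1 *: (Q1 - conjJ Q1) = 2^-1 *: (Q1 + conjJ Q1).
    by apply/matrixP => i j; rewrite !mxE; field.
  have p : posdef (2^-1 *: (Q1 + conjJ Q1)) by apply: posdef_scale.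
  rewrite E; split; [exact/antiZ/conjJ_sub_anti/Q1s|by move=> x; exact: posdef_ge0|exact: posdef_det_gt0].
have [v vA vmax] : exists2 v, v \in A & forall w, w \in A ->
    \det (Q1 - Sm w) / \det (Q2 - Sm w) <= \det (Q1 - Sm v) / \det (Q2 - Sm v).
  apply: EVT_max_rV => //.
    by exists (mxvec S0); rewrite /A /Sm /= mxvecK.
  apply: continuous_in_subspaceT => w; rewrite inE => -[[wS _] wp].
  have d0 : \det (Q2 - Sm w) != 0 by rewrite gt_eqF // posdef_det_gt0 //; exact: p2.
  have cd := continuous_divR_at (continuous_detR (cQ Q1)) (continuous_detR (cQ Q2)) d0.
  exact: cd.
move: vA; rewrite inE => -[aS pS]; set S := Sm v in aS pS vmax.
have pB := p2 _ aS.1 pS; have dB := posdef_det_gt0 pB.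
have dA : 0 < \det (Q1 - S).
  have := vmax (mxvec S0); rewrite inE /A /Sm /= mxvecK => /(_ (conj aS0 pS0)).
  have dB0 := posdef_det_gt0 (p2 _ aS0.1 pS0).
  move=> h; have : 0 < \det (Q1 - S) / \det (Q2 - S) by apply: lt_le_trans h; rewrite divr_gt0.
  by rewrite pmulr_lgt0 // invr_gt0.
have Ss := aS.1.
have As : (Q1 - S)^T = Q1 - S by rewrite linearB /= Q1s Ss.
have uA : Q1 - S \in unitmx by rewrite unitmxE unitfE gt_eqF.
have pA := psd_posdef As pS uA; have uB := posdef_unitmx pB.
exists S; split => //.
apply: trace_orth_anti.
  by rewrite linearB /= !trmx_inv As (posdef_sym pB).
move=> T aT.
have detE (M : 'M[R]_(n + n)) t : M \in unitmx -> \det (M - t *: T) = \det M * \det (1%:M - t *: (invmx M *m T)).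
  by move=> uM; rewrite -det_mulmx mulmxBr mulmx1 -scalemxAr mulKVmx.
have [c1 c10 H1] := det_expansion (invmx (Q1 - S) *m T).
have [c2 c20 H2] := det_expansion (invmx (Q2 - S) *m T).
have [d d0 dP] := posdef_perturb pA aT.1.
rewrite mulmxBl linearB /=; apply/eqP; rewrite subr_eq0; apply/eqP.
apply: (first_order_eq d0 c10 c20 H1 H2) => t td.
have aSt : anti (S + t *: T) by apply: antiD => //; exact: antiZ.
have pSt x : 0 <= qf (Q1 - (S + t *: T)) x by rewrite opprD addrA; exact: dP.
have := vmax (mxvec (S + t *: T)); rewrite inE /A /Sm /= mxvecK => /(_ (conj aSt pSt)).
have dBt := posdef_det_gt0 (p2 _ aSt.1 pSt).
rewrite ler_pdivrMr // mulrAC ler_pdivlMr //; move: dBt.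
rewrite opprD !addrA !detE // => dBt.
by rewrite -mulrA ler_pM2l // mulrC ler_pM2l.
Qed.

End Jmatrix.
End Maximiser.

(** * Block algebra of the matrices A *)

Section Spectrum.

Section FieldLemmas.
Variable F : fieldType.

Lemma char_poly_sim m (P M : 'M[F]_m) : P \in unitmx ->
  char_poly (invmx P *m M *m P) = char_poly M.
Proof.
move=> uP; rewrite /char_poly /char_poly_mx.
have E : map_mx polyC (invmx P) *m map_mx polyC P = 1%:M.
  by rewrite -map_mxM mulVmx // map_scalar_mx rmorph1.
have -> : 'X%:M - map_mx polyC (invmx P *m M *m P) =
   map_mx polyC (invmx P) *m ('X%:M - map_mx polyC M) *m map_mx polyC P.
  rewrite mulmxBr mulmxBl !map_mxM /=; congr (_ - _).
  by rewrite scalar_mxC -mulmxA E mulmx1.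
rewrite !det_mulmx mulrAC -det_mulmx E det1 mul1r //.
Qed.

Lemma char_poly_block m1 m2 (A : 'M[F]_m1) (D : 'M[F]_m2) :
  char_poly (block_mx A 0 0 D) = char_poly A * char_poly D.
Proof.
rewrite /char_poly /char_poly_mx (@scalar_mx_block _ m1 m2) map_block_mx opp_block_mx add_block_mx.
have z p q : map_mx polyC (0 : 'M[F]_(p, q)) = 0 by apply/matrixP => i j; rewrite !mxE.
by rewrite !z !subr0 det_ublock.
Qed.

Lemma invmx_mul m (A B : 'M[F]_m) : A \in unitmx -> B \in unitmx ->
  invmx (A *m B) = invmx B *m invmx A.
Proof.
move=> uA uB; have uAB : A *m B \in unitmx by rewrite unitmx_mul uA.
apply: (can_inj (mulKmx uAB)); rewrite mulmxV // mulmxA -(mulmxA A) mulmxV // mulmx1 mulmxV //.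
Qed.

Lemma char_poly_tr m (A : 'M[F]_m) : char_poly A^T = char_poly A.
Proof.
rewrite /char_poly /char_poly_mx -[RHS]det_tr; congr determinant.
by rewrite linearB /= tr_scalar_mx map_trmx.
Qed.

(** Cramer's rule for a corner of the inverse: multiply by [[C, 0], [Gb, 1]]. *)
Lemma two_block_det n (L P Lb Pb C Gb : 'M[F]_n) :
  L *m C + Pb *m Gb = 1%:M -> P *m C + Lb *m Gb = 0 ->
  \det (block_mx L Pb P Lb) * \det C = \det Lb.
Proof.
move=> h1 h3.
have E : block_mx L Pb P Lb *m block_mx C 0 Gb 1%:M = block_mx 1%:M Pb 0 Lb.
  by rewrite mulmx_block h1 h3 !mulmx0 !mulmx1 !add0r.
by have := congr1 determinant E; rewrite det_mulmx det_lblock det_ublock !det1 mulr1 mul1r.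
Qed.

Lemma quot_sandwich m (a b x y : 'M[F]_m) : a \in unitmx -> b \in unitmx -> x \in unitmx ->
  invmx (a *m x *m b) *m (a *m y *m b) = invmx b *m (invmx x *m y) *m b.
Proof.
move=> ua ub ux; rewrite invmx_mul ?unitmx_mul ?ua // (invmx_mul ua) // -!mulmxA.
by rewrite (mulKmx ua).
Qed.

Lemma row_quot m (k z : F) (C1 C2 : 'M[F]_m) (u : 'rV[F]_m) : k != 0 -> k *: C1 \in unitmx ->
  u *m (k *: C2 *m invmx (k *: C1)) = z *: u -> u *m C2 = z *: (u *m C1).
Proof.
move=> k0 uC /(congr1 (fun X => X *m (k *: C1))).
rewrite !mulmxA mulmxKV // -scalemxAl -!scalemxAr scalerA mulrC -scalerA.
exact: (scalerI k0).
Qed.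

Lemma swap_det n : \det (block_mx 0 1%:M 1%:M 0 : 'M[F]_(n + n)) != 0.
Proof.
have E : block_mx 0 1%:M 1%:M 0 *m block_mx 0 1%:M 1%:M 0 = 1%:M :> 'M[F]_(n + n).
  by rewrite mulmx_block !mul0mx !mulmx0 !mulmx1 !add0r !addr0 (@scalar_mx_block _ n n).
have := congr1 determinant E; rewrite det_mulmx det1 => H.
by apply/eqP => d0; move/eqP: H; rewrite d0 mul0r eq_sym oner_eq0.
Qed.

End FieldLemmas.

(** Both sides agree at all x != 0, since
    det H det(x - H^-1) = det(- x (x^-1 - H)). *)
Lemma char_poly_inv_prod (F : numFieldType) n (H : 'M[F]_n) (z : 'I_n -> F) : H \in unitmx ->
  (forall j, z j != 0) ->
  char_poly H = \prod_j ('X - (z j)%:P) -> char_poly (invmx H) = \prod_j ('X - ((z j)^-1)%:P).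
Proof.
move=> uH z0 pH.
have detH : \det H = \prod_j z j.
  have := char_poly_det H; rewrite pH -horner_coef0 horner_prod.
  under eq_bigr => j _ do rewrite hornerXsubC sub0r.
  rewrite prodrN card_ord => /(mulfI (_ : (-1) ^+ n != 0)) -> //.
  by rewrite signr_eq0.
apply/eqP; rewrite -subr_eq0; apply/eqP; set r := _ - _.
suff r0 x : x != 0 -> r.[x] = 0.
  apply: (@roots_geq_poly_eq0 _ _ [seq k.+1%:R | k <- iota 0 (size r)]).
  - by apply/allP => _ /mapP[k _ ->]; rewrite /root r0 // pnatr_eq0.
  - by rewrite map_inj_uniq ?iota_uniq // => i j /eqP; rewrite eqr_nat eqSS => /eqP.
  - by rewrite size_map size_iota.
move=> x0; apply/eqP; rewrite /r hornerD hornerN subr_eq0; apply/eqP.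
rewrite horner_char_poly horner_prod.
apply: (@mulfI _ (\det H)); first by rewrite -unitfE -unitmxE.
rewrite -det_mulmx mulmxBr mulmxV // mul_mx_scalar.
have -> : x *: H - 1%:M = - x *: (x^-1%:M - H).
  by rewrite scalerBr scaleNr scale_scalar_mx mulfV // scaleNr opprK addrC.
rewrite detZ -horner_char_poly pH horner_prod detH -big_split /=.
have -> : (- x) ^+ n = \prod_(j < n) (- x) by rewrite prodr_const card_ord.
rewrite -big_split /=; apply: eq_bigr => j _.
rewrite !hornerXsubC; field.
by rewrite z0 x0.
Qed.

(** The block identities only involve a square root ic of -1 and an involution conj
    that negates ic and fixes the image of r. *)
Section Blocks.
Context {K F : fieldType} {r : {rmorphism K -> F}} {conj : {rmorphism F -> F}} {ic : F}.
Hypotheses (ic2 : ic * ic = -1) (conj_i : conj ic = - ic)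
  (conj_r : forall a, conj (r a) = r a).
Notation cj := (map_mx conj).
Notation rc := (map_mx r).

Definition Bmx n (L P : 'M[F]_n) : 'M[F]_(n + n) := block_mx (ic *: L) 0 (ic *: P) 1%:M.
Definition swapmx n : 'M[F]_(n + n) := block_mx 0 1%:M 1%:M 0.
Definition Amx n (L P : 'M[F]_n) : 'M[F]_(n + n) := cj (invmx (Bmx L P)) *m swapmx n *m Bmx L P.

Lemma cjBmx n (L P : 'M[F]_n) : cj (Bmx L P) = block_mx (- ic *: cj L) 0 (- ic *: cj P) 1%:M.
Proof.
rewrite /Bmx map_block_mx; congr block_mx; apply/matrixP => i j; rewrite !mxE.
- by rewrite rmorphM conj_i.
- by rewrite rmorph0.
- by rewrite rmorphM conj_i.
- by rewrite rmorph_nat.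
Qed.

Lemma det_Bmx n (L P : 'M[F]_n) : \det (Bmx L P) = ic ^+ n * \det L.
Proof. by rewrite /Bmx det_lblock det1 mulr1 detZ. Qed.

Lemma ic0 : ic != 0.
Proof. by apply/eqP => h; move/eqP: ic2; rewrite h mul0r eq_sym oppr_eq0 oner_eq0. Qed.

Lemma Bmx_unit n (L P : 'M[F]_n) : L \in unitmx -> Bmx L P \in unitmx.
Proof.
rewrite !unitmxE det_Bmx !unitfE => uL.
by rewrite mulf_neq0 // expf_neq0 // ic0.
Qed.

Lemma cj_unit n (M : 'M[F]_n) : (cj M \in unitmx) = (M \in unitmx).
Proof. exact: map_unitmx. Qed.

Lemma cjAmx n (L P : 'M[F]_n) : L \in unitmx ->
  cj (Bmx L P) *m Amx L P = swapmx n *m Bmx L P.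
Proof.
move=> uL; rewrite /Amx map_invmx -!mulmxA mulKVmx // cj_unit.
exact: Bmx_unit.
Qed.

(** The triangular and antidiagonal factors of A, see [Amx_factor]. *)
Definition umx n (G : 'M[F]_n) : 'M[F]_(n + n) := block_mx 1%:M (- ic *: G) 0 1%:M.
Definition dmx n (C1 C2 : 'M[F]_n) : 'M[F]_(n + n) := block_mx 0 (ic *: C2) (ic *: invmx C1) 0.
Definition lmx n (P : 'M[F]_n) : 'M[F]_(n + n) := block_mx 1%:M 0 (ic *: P) 1%:M.

Lemma umx_unit n (G : 'M[F]_n) : umx G \in unitmx.
Proof. by rewrite unitmxE det_ublock !det1 mulr1 unitr1. Qed.
Lemma lmx_unit n (G : 'M[F]_n) : lmx G \in unitmx.
Proof. by rewrite unitmxE det_lblock !det1 mulr1 unitr1. Qed.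

Lemma Bmx_shift n (L P Ps : 'M[F]_n) : Bmx L (P + Ps) = Bmx L P *m lmx Ps.
Proof.
rewrite /Bmx /lmx mulmx_block !mulmx1 !mulmx0 !mul0mx !mul1mx !addr0 ?add0r.
by rewrite scalerDr.
Qed.

Lemma Amx_shift n (L P Ps : 'M[F]_n) : L \in unitmx ->
  Amx L (P + Ps) = cj (invmx (lmx Ps)) *m Amx L P *m lmx Ps.
Proof.
move=> uL; have uB := Bmx_unit P uL; have ul := lmx_unit Ps.
rewrite /Amx Bmx_shift invmx_mul // map_mxM !mulmxA //.
Qed.

(** The hypotheses say that [[C1, G], [Gb, Cb]] is the inverse of the complex
    Hessian [[L, conj P], [P, conj L]].  As conj B times A is B with its block
    rows exchanged, it suffices to multiply the factors by conj B. *)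
Lemma Amx_factor n (L P C1 G Gb Cb : 'M[F]_n) : L \in unitmx -> C1 \in unitmx ->
  L *m C1 + cj P *m Gb = 1%:M -> L *m G + cj P *m Cb = 0 ->
  P *m C1 + cj L *m Gb = 0 -> P *m G + cj L *m Cb = 1%:M ->
  Amx L P = umx Gb *m dmx C1 Cb *m umx G.
Proof.
move=> uL uC h1 h2 h3 h4.
have uB : cj (Bmx L P) \in unitmx by rewrite cj_unit Bmx_unit.
apply: (can_inj (mulKmx uB)); rewrite cjAmx // !mulmxA.
have -> : swapmx n *m Bmx L P = block_mx (ic *: P) 1%:M (ic *: L) 0.
  by rewrite /swapmx /Bmx mulmx_block !mul0mx !mul1mx !add0r !addr0.
have -> : cj (Bmx L P) *m umx Gb =
    block_mx (- ic *: cj L) (- (cj L *m Gb)) (- ic *: cj P) (L *m C1).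
  rewrite cjBmx /umx mulmx_block !mulmx1 !mulmx0 !addr0 -!scalemxAl -!scalemxAr.
  rewrite !scalerA mulrNN ic2 !scaleN1r; congr block_mx.
  by rewrite -h1 addrC addrK.
rewrite /dmx mulmx_block !mulmx0 add0r addr0 add0r addr0 -!scalemxAl -!scalemxAr.
rewrite !scalerA !mulNr ic2 !opprK !scale1r mulNmx scalerN -scaleNr.
have e1 : cj L *m Gb = - (P *m C1) by apply/eqP; rewrite -addr_eq0 addrC h3.
rewrite e1 mulNmx -!mulmxA mulmxV // !mulmx1 scaleNr scalerN opprK.
rewrite /umx mulmx_block !mulmx1 !mulmx0 !addr0 -!scalemxAl -!scalemxAr !scalerA mulrN ic2 !opprK !scale1r.
by rewrite h4 h2.
Qed.

(** L and P of the weight with matrix Q, that is 2 Phi''_(xbar x) and 2 Phi''_(xx). *)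
Definition LQ n (Q : 'M[K]_(n + n)) : 'M[F]_n :=
  rc (ulsubmx Q + drsubmx Q) + ic *: rc (dlsubmx Q - ursubmx Q).
Definition PQ n (Q : 'M[K]_(n + n)) : 'M[F]_n :=
  rc (ulsubmx Q - drsubmx Q) - ic *: rc (ursubmx Q + dlsubmx Q).
Definition MQ n (Q : 'M[K]_(n + n)) : 'M[F]_(n + n) :=
  block_mx (LQ Q) (cj (PQ Q)) (PQ Q) (cj (LQ Q)).
(** The change of variables from (Re x, Im x) to (x, conj x), and its adjoint. *)
Definition Wmx n : 'M[F]_(n + n) := block_mx 1%:M (ic%:M) 1%:M (- ic)%:M.
Definition Wsmx n : 'M[F]_(n + n) := block_mx 1%:M 1%:M (- ic)%:M ic%:M.

Lemma WsW n : Wsmx n *m Wmx n = 2%:M.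
Proof.
rewrite mulmx_block (@scalar_mx_block _ n n) !mul1mx !mulmx1 -!scalar_mxM !mulNr !mulrN ic2 opprK.
by rewrite -!raddfD /= ?subrr ?addNr ?raddf0.
Qed.

Lemma WWs n : Wmx n *m Wsmx n = 2%:M.
Proof.
rewrite mulmx_block (@scalar_mx_block _ n n) !mul1mx -!scalar_mxM !mulNr !mulrN ic2 opprK.
by rewrite -!raddfD /= ?subrr ?addNr ?raddf0.
Qed.

Lemma MQE n (Q : 'M[K]_(n + n)) : MQ Q = Wmx n *m rc Q *m Wsmx n.
Proof.
rewrite -[in RHS](submxK Q) map_block_mx !mulmx_block !mul1mx !mulmx1 !mul_scalar_mx !mul_mx_scalar.
rewrite /MQ /LQ /PQ; congr block_mx; apply/matrixP => i j.
- rewrite !mxE; ring: ic2.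
- rewrite !mxE rmorphB rmorphM conj_i !conj_r; ring: ic2.
- rewrite !mxE; ring: ic2.
- rewrite !mxE rmorphD rmorphM conj_i !conj_r; ring: ic2.
Qed.

Lemma MQ_inv n (Q : 'M[K]_(n + n)) : Q \in unitmx ->
  MQ Q *m MQ (invmx Q) = 4%:M.
Proof.
move=> uQ; rewrite !MQE -!mulmxA (mulmxA (Wsmx n)) WsW mul_scalar_mx -scalemxAr.
rewrite (mulmxA (rc Q)) -map_mxM mulmxV // map_mx1 mul1mx -scalemxAr WWs scale_scalar_mx.
by congr (_%:M); rewrite -natrM.
Qed.

Hypothesis two0 : 2 != 0 :> F.

(** Inverting Q between [Wmx] and [Wsmx] shows that the inverse of a complex Hessian
    is a quarter of the complex Hessian of the inverse form. *)
Lemma LQPQ_inv n (Q : 'M[K]_(n + n)) : Q \in unitmx ->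
  let V : 'M[K]_(n + n) := invmx Q in
  [/\ LQ Q *m (4^-1 *: LQ V) + cj (PQ Q) *m (4^-1 *: PQ V) = 1%:M,
     LQ Q *m (4^-1 *: cj (PQ V)) + cj (PQ Q) *m (4^-1 *: cj (LQ V)) = 0,
     PQ Q *m (4^-1 *: LQ V) + cj (LQ Q) *m (4^-1 *: PQ V) = 0 &
     PQ Q *m (4^-1 *: cj (PQ V)) + cj (LQ Q) *m (4^-1 *: cj (LQ V)) = 1%:M].
Proof.
move=> uQ V; have := MQ_inv uQ; rewrite -/V /MQ mulmx_block (@scalar_mx_block _ n n).
move=> /eq_block_mx [h1 h2 h3 h4]; rewrite -!scalemxAr -!scalerDr h1 h2 h3 h4 scaler0 scale_scalar_mx.
by rewrite mulVf // (_ : 4 = 2 * 2) ?mulf_neq0 // -natrM.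
Qed.

Lemma LQE n (Q : 'M[K]_(n + n)) i j : LQ Q i j =
  r (ulsubmx Q i j + drsubmx Q i j) + ic * r (dlsubmx Q i j - ursubmx Q i j).
Proof. by rewrite !mxE. Qed.

Lemma LQ_conj n (Q : 'M[K]_(n + n)) : Q^T = Q -> cj (LQ Q) = (LQ Q)^T.
Proof.
move=> sQ.
have e1 i j : ulsubmx Q i j = ulsubmx Q j i by rewrite !mxE -{1}sQ mxE.
have e2 i j : drsubmx Q i j = drsubmx Q j i by rewrite !mxE -{1}sQ mxE.
have e3 i j : dlsubmx Q i j = ursubmx Q j i by rewrite !mxE -{1}sQ mxE.
apply/matrixP => i j; rewrite mxE [RHS]mxE !LQE rmorphD rmorphM conj_i !conj_r !e3.
by rewrite e1 e2 !rmorphB; ring.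
Qed.

Lemma PQ_add n (Q S : 'M[K]_(n + n)) : PQ (Q + S) = PQ Q + PQ S.
Proof. by apply/matrixP => i j; rewrite !mxE !rmorphB !rmorphD; ring. Qed.

Lemma LQ_add n (Q S : 'M[K]_(n + n)) : LQ (Q + S) = LQ Q + LQ S.
Proof. by apply/matrixP => i j; rewrite !mxE !rmorphB !rmorphD; ring. Qed.

Lemma PQ_opp n (Q : 'M[K]_(n + n)) : PQ (- Q) = - PQ Q.
Proof. by apply/matrixP => i j; rewrite !mxE !rmorphB !rmorphD !rmorphN; ring. Qed.

Lemma LQ_opp n (Q : 'M[K]_(n + n)) : LQ (- Q) = - LQ Q.
Proof. by apply/matrixP => i j; rewrite !mxE !rmorphB !rmorphD !rmorphN; ring. Qed.

Lemma sym_inv m (Q : 'M[K]_m) : Q^T = Q -> (invmx Q)^T = invmx Q.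
Proof. by move=> sQ; rewrite trmx_inv sQ. Qed.

Lemma dmx_quot n (C1 C2 Cb1 Cb2 : 'M[F]_n) :
  C1 \in unitmx -> C2 \in unitmx -> Cb1 \in unitmx -> Cb2 \in unitmx ->
  dmx C2 Cb2 \in unitmx /\
  invmx (dmx C2 Cb2) *m dmx C1 Cb1 = block_mx (C2 *m invmx C1) 0 0 (invmx Cb2 *m Cb1).
Proof.
move=> u1 u2 ub1 ub2.
pose D : 'M[F]_(n + n) := block_mx 0 (- ic *: C2) (- ic *: invmx Cb2) 0.
have DE : D *m dmx C2 Cb2 = 1%:M.
  rewrite mulmx_block !mul0mx !mulmx0 !add0r !addr0 -!scalemxAl -!scalemxAr !scalerA !mulNr ic2 opprK.
  by rewrite !scale1r mulmxV // mulVmx // (@scalar_mx_block _ n n).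
have [uD ud] := mulmx1_unit DE; split => //.
have -> : invmx (dmx C2 Cb2) = D by rewrite -[D]mulmx1 -(mulmxV ud) mulmxA DE mul1mx.
rewrite mulmx_block !mul0mx !mulmx0 !add0r !addr0 -!scalemxAl -!scalemxAr !scalerA !mulNr ic2 opprK.
by rewrite !scale1r.
Qed.

(** A pluriharmonic S changes P and leaves L alone, and shifting P multiplies B by a
    triangular matrix. *)
Section CommonPart.
Context {n : nat}.
Variables (Q S : 'M[K]_(n + n)).
Hypotheses (sQ : Q^T = Q) (sS : S^T = S) (uQ : Q - S \in unitmx) (L0 : LQ S = 0)
  (uL : LQ Q \in unitmx).
Let V : 'M[K]_(n + n) := invmx (Q - S).
Let C : 'M[F]_n := 4^-1 *: LQ V.

Lemma LQ_sub : LQ (Q - S) = LQ Q.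
Proof. by rewrite LQ_add LQ_opp L0 subr0. Qed.

Lemma sym_sub : (Q - S)^T = Q - S.
Proof. by rewrite linearB /= sQ sS. Qed.

Lemma det_LQ_inv : \det (Wmx n *m Wsmx n) * r (\det (Q - S)) * \det C = \det (LQ Q).
Proof.
have [h1 _ h3 _] := LQPQ_inv uQ.
have := two_block_det h1 h3; rewrite LQ_conj ?sym_sub // det_tr LQ_sub => <-.
rewrite -LQ_sub -LQ_conj ?sym_sub // -/(MQ (Q - S)) MQE !det_mulmx -det_map_mx.
by rewrite [X in X * _ = _]mulrAC.
Qed.

Lemma LQ_inv_unit : C \in unitmx.
Proof.
rewrite unitmxE unitfE; apply/eqP => d0; move: uL.
by rewrite unitmxE unitfE -det_LQ_inv d0 mulr0 eqxx.
Qed.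

Lemma LQ_inv_tr : 4^-1 *: cj (LQ V) = C^T.
Proof. by rewrite LQ_conj ?sym_inv ?sym_sub // linearZ. Qed.

Lemma Amx_normal : Amx (LQ Q) (PQ Q) =
  (cj (invmx (lmx (PQ S))) *m umx (4^-1 *: PQ V)) *m dmx C C^T *m
    (umx (4^-1 *: cj (PQ V)) *m lmx (PQ S)).
Proof.
have {1}-> : PQ Q = PQ (Q - S) + PQ S by rewrite PQ_add PQ_opp subrK.
have [h1 h2 h3 h4] := LQPQ_inv uQ.
rewrite Amx_shift // -LQ_inv_tr -LQ_sub.
rewrite (@Amx_factor n _ _ C (4^-1 *: cj (PQ V)) (4^-1 *: PQ V) (4^-1 *: cj (LQ V))) ?LQ_sub ?LQ_inv_unit //.
- by rewrite !mulmxA.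
- by rewrite -LQ_sub.
- by rewrite -LQ_sub.
- by rewrite -LQ_sub.
- by rewrite -LQ_sub.
Qed.
End CommonPart.

(** The outer factors of [Amx_normal] are the same for Q1 and Q2, because the inverse
    forms have the same P; they cancel up to a similarity, leaving the quotient of
    the antidiagonal factors. *)
Lemma quotient_form n (Q1 Q2 S : 'M[K]_(n + n)) (V1 : 'M[K]_(n + n) := invmx (Q1 - S)) (V2 : 'M[K]_(n + n) := invmx (Q2 - S))
    (H : 'M[F]_n := (4^-1 *: LQ V2) *m invmx (4^-1 *: LQ V1)) :
  Q1^T = Q1 -> Q2^T = Q2 -> S^T = S -> Q1 - S \in unitmx -> Q2 - S \in unitmx ->
  LQ S = 0 -> LQ Q1 \in unitmx -> LQ Q2 \in unitmx -> PQ V1 = PQ V2 ->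
  [/\ H \in unitmx,
     char_poly (invmx (Amx (LQ Q2) (PQ Q2)) *m Amx (LQ Q1) (PQ Q1)) =
       char_poly H * char_poly (invmx H) &
     r (\det (Q1 - S) / \det (Q2 - S)) = \det (LQ Q1) / \det (LQ Q2) * \det H].
Proof.
move=> s1 s2 sS u1 u2 L0 uL1 uL2 ePQ.
have uC1 := LQ_inv_unit s1 sS u1 L0 uL1; have uC2 := LQ_inv_unit s2 sS u2 L0 uL2.
rewrite -/V1 -/V2 in uC1 uC2.
have uH : H \in unitmx by rewrite unitmx_mul uC2 unitmx_inv.
have uT1 : (4^-1 *: LQ V1)^T \in unitmx by rewrite unitmx_tr.
have uT2 : (4^-1 *: LQ V2)^T \in unitmx by rewrite unitmx_tr.
split => //.
- rewrite (Amx_normal s1 sS u1 L0 uL1) (Amx_normal s2 sS u2 L0 uL2) -/V1 -/V2 ePQ.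
  have [ud2 dq] := dmx_quot uC1 uC2 uT1 uT2.
  rewrite quot_sandwich ?dq ?unitmx_mul ?umx_unit ?lmx_unit ?cj_unit ?unitmx_inv ?lmx_unit //.
  rewrite char_poly_sim ?unitmx_mul ?umx_unit ?lmx_unit // char_poly_block -/H; congr (_ * _).
  by rewrite /H invmx_mul ?unitmx_inv // invmxK -char_poly_tr trmx_mul trmxK trmx_inv trmxK.
- have e1 := det_LQ_inv s1 sS u1 L0; have e2 := det_LQ_inv s2 sS u2 L0.
  rewrite -/V1 -/V2 in e1 e2.
  have n1 : \det (LQ Q1) != 0 by rewrite -unitfE -unitmxE.
  have n2 : \det (LQ Q2) != 0 by rewrite -unitfE -unitmxE.
  move: n1 n2; rewrite -e1 -e2 !mulf_eq0 !negb_or -!andbA => /and3P[a b c] /and3P[_ b' c'].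
  rewrite /H [\det (_ *m invmx _)]det_mulmx det_inv fmorph_div /=; field.
  by rewrite ?a ?b ?c ?b' ?c'.
Qed.

Lemma PQE n (Q : 'M[K]_(n + n)) i j : PQ Q i j =
  r (ulsubmx Q i j - drsubmx Q i j) - ic * r (ursubmx Q i j + dlsubmx Q i j).
Proof. by rewrite !mxE. Qed.

(** The blocks of Q^J, see [conjJ_quarter]. *)
Definition quarter n (Q : 'M[K]_(n + n)) : 'M[K]_(n + n) :=
  block_mx (drsubmx Q) (- dlsubmx Q) (- ursubmx Q) (ulsubmx Q).

Lemma LQ_quarter n (Q : 'M[K]_(n + n)) : LQ (quarter Q) = LQ Q.
Proof.
apply/matrixP => i j; rewrite !LQE /quarter block_mxKul block_mxKdr block_mxKdl block_mxKur.
by rewrite !mxE !rmorphB !rmorphD !rmorphN; ring.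
Qed.

Lemma PQ_quarter n (Q : 'M[K]_(n + n)) : PQ (quarter Q) = - PQ Q.
Proof.
apply/matrixP => i j; rewrite [RHS]mxE !PQE /quarter block_mxKul block_mxKdr block_mxKdl block_mxKur.
by rewrite !mxE !rmorphB !rmorphD !rmorphN; ring.
Qed.

Lemma eq_opp0 m p (A : 'M[F]_(m, p)) : A = - A -> A = 0.
Proof.
move=> h; have : 2 *: A = 0 by rewrite scaler_nat mulr2n {2}h subrr.
by move/eqP; rewrite scaler_eq0 (negbTE two0) => /eqP.
Qed.

Lemma LQ_factor n (Q : 'M[K]_(n + n)) :
  LQ Q = row_mx 1%:M (ic%:M) *m rc Q *m col_mx 1%:M ((- ic)%:M).
Proof.
rewrite -[in RHS](submxK Q) map_block_mx mul_row_block mul_row_col !mul1mx !mulmx1.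
rewrite !mul_scalar_mx !mul_mx_scalar; apply/matrixP => i j.
rewrite LQE !mxE; ring: ic2.
Qed.

(** L is the compression of Q to the vectors (z, - i z), that is to v - i J v. *)
Lemma LQ_form n (Y : 'M[K]_(n + n)) (a b : 'cV[K]_n) (x : 'cV[F]_n) :
  Y^T = Y -> x = rc a + ic *: rc b ->
  (cj x)^T *m LQ Y *m x =
  rc ((col_mx a b)^T *m Y *m col_mx a b + (col_mx (- b) a)^T *m Y *m col_mx (- b) a).
Proof.
move=> sY ->; set v := col_mx a b; set w := col_mx (- b) a.
have e1 : col_mx 1%:M ((- ic)%:M) *m (rc a + ic *: rc b) = rc v - ic *: rc w.
  rewrite mul_col_mx mul1mx mul_scalar_mx /v /w !map_col_mx scale_col_mx opp_col_mx add_col_mx.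
  rewrite map_mxN scalerN opprK scalerDr scalerA mulNr ic2 opprK scale1r scaleNr.
  by rewrite [in X in col_mx _ X = _]addrC.
have e2 : (cj (rc a + ic *: rc b))^T *m row_mx 1%:M (ic%:M) = (rc v + ic *: rc w)^T.
  have -> : cj (rc a + ic *: rc b) = rc a - ic *: rc b.
    by apply/matrixP => i j; rewrite !mxE rmorphD rmorphM conj_i !conj_r mulNr.
  rewrite mul_mx_row mulmx1 mul_mx_scalar /v /w !map_col_mx scale_col_mx add_col_mx tr_col_mx.
  rewrite map_mxN scalerN -linearZ /= scalerBr scalerA ic2 scaleN1r opprK.
  by rewrite [in X in row_mx _ X]addrC.
rewrite LQ_factor !mulmxA e2 -mulmxA e1.
have e3 : (rc v + ic *: rc w)^T = rc v^T + ic *: rc w^T by apply/matrixP => i j; rewrite !mxE.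
have vw : w^T *m Y *m v = v^T *m Y *m w.
  have -> : v^T *m Y *m w = (w^T *m Y *m v)^T by rewrite !trmx_mul !trmxK sY !mulmxA.
  by apply/matrixP => i j; rewrite !(ord1 i, ord1 j) [RHS]mxE.
rewrite e3 mulmxDl mulmxBr !mulmxDl -!scalemxAl -!scalemxAr -!map_mxM vw /= map_mxD.
by rewrite scalerA ic2 scaleN1r opprD opprK addrA addrK.
Qed.

End Blocks.

(** * Complex Hessians of real forms and their spectrum *)

Section Concrete.
Context {R : realType} {n : nat}.
Notation C := R[i].
Notation rc := (map_mx (real_complex R)).
Notation cj := (map_mx (@conjc R)).
Implicit Types (Q S E Y : 'M[R]_(n + n)).
Let ic : C := 'i%C.
Let ic2 : ic * ic = -1. Proof. by rewrite -expr2 sqr_i. Qed.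
Let conj_i : conjc ic = - ic.
Proof. by apply/eqP; rewrite eq_complex /= oppr0 !eqxx. Qed.
Let two0 : 2 != 0 :> C. Proof. by rewrite pnatr_eq0. Qed.

Definition LC Q : 'M[C]_n := @LQ R C (real_complex R) 'i%C n Q.
Definition PC Q : 'M[C]_n := @PQ R C (real_complex R) 'i%C n Q.

Lemma conjJ_quarter Q : conjJ Q = quarter Q.
Proof.
rewrite /conjJ trJmx JmxE -{1}(submxK Q) opp_block_mx !mulmx_block /quarter.
rewrite !oppr0 !opprK !mulmx0 !mul0mx !mulNmx !mulmxN !mul1mx !mulmx1 !addr0 !add0r.
by rewrite !opprK.
Qed.

Lemma LC_anti S : anti S -> LC S = 0.
Proof.
move=> [_ aS]; apply: (eq_opp0 two0).
by rewrite /LC -[in LHS]LQ_quarter -conjJ_quarter aS LQ_opp.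
Qed.

Lemma PC_inv E : conjJ E = E -> PC E = 0.
Proof.
move=> eE; apply: (eq_opp0 two0).
by rewrite -[in LHS]eE conjJ_quarter /PC PQ_quarter.
Qed.

Lemma LC_pos Y (v : 'cV[R]_(n + n)) : Y^T = Y ->
  (cj (toC v))^T *m LC Y *m toC v = rc (qf Y v + qf Y (Jmx n *m v))%:M.
Proof.
move=> sY.
have e : toC v = rc (usubmx v) + ic *: rc (dsubmx v).
  by apply/matrixP => i j; rewrite !mxE [LHS]complexE /= (ord1 j).
rewrite (@LQ_form R C _ _ _ ic2 conj_i (@conjc_real R) n Y _ _ _ sY e).
have -> : col_mx (- dsubmx v) (usubmx v) = Jmx n *m v.
  by rewrite rotmxE /rot scale0r scale1r scale0r scale1r sub0r addr0.
rewrite vsubmxK; apply/matrixP => i j; rewrite !(ord1 i, ord1 j).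
by rewrite [LHS]mxE [in LHS]mxE [RHS]mxE [in RHS]mxE eqxx mulr1n.
Qed.

Lemma toC_eq0 (v : 'cV[R]_(n + n)) : (toC v == 0) = (v == 0).
Proof.
apply/eqP/eqP => [h|->]; last by apply/colP => j; rewrite !mxE.
have e : col_mx (usubmx v) (dsubmx v) = col_mx 0 0.
  congr col_mx; apply/colP => j.
    by have /colP /(_ j) /(congr1 (@complex.Re R)) := h; rewrite !mxE.
  by have /colP /(_ j) /(congr1 (@complex.Im R)) := h; rewrite !mxE.
by rewrite -(vsubmxK v) e col_mx0.
Qed.

Lemma toC_surj (x : 'cV[C]_n) :
  x = toC (col_mx (map_mx (@complex.Re R) x) (map_mx (@complex.Im R) x)).
Proof. by apply/colP => j; rewrite [RHS]mxE col_mxKu col_mxKd !mxE; case: (x j 0). Qed.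

Lemma LC_val Y (v : 'cV[R]_(n + n)) : Y^T = Y ->
  ((cj (toC v))^T *m LC Y *m toC v) 0 0 = (qf (Y + conjJ Y) v)%:C%C.
Proof. by move=> sY; rewrite LC_pos // qf_addmx qf_conjJ !mxE eqxx mulr1n. Qed.

Lemma Cpos_Jpos Y : Y^T = Y -> posdef (Y + conjJ Y) <->
  forall x : 'cV[C]_n, x != 0 -> 0 < ((cj x)^T *m LC Y *m x) 0 0.
Proof.
move=> sY; have sYY : (Y + conjJ Y)^T = Y + conjJ Y by rewrite linearD /= tr_conjJ sY.
split=> [[_ p] x|p].
  by rewrite (toC_surj x) toC_eq0 LC_val // => v0; rewrite ltcR; exact: p.
split => // v v0; have := p (toC v); rewrite toC_eq0 LC_val // ltcR; exact.
Qed.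

Lemma posdef_Jsym Y : posdef Y -> posdef (Y + conjJ Y).
Proof.
move=> [sY pY]; split; first by rewrite linearD /= tr_conjJ sY.
move=> v v0; rewrite qf_addmx qf_conjJ ltr_wpDr ?pY //.
exact: posdef_ge0.
Qed.

Lemma LC_unit Y : Y^T = Y -> posdef (Y + conjJ Y) -> LC Y \in unitmx.
Proof.
move=> sY /(Cpos_Jpos sY) p; rewrite -row_free_unit -kermx_eq0; apply/rowV0P => u /sub_kermxP uL.
apply/eqP; apply/negPn/negP => u0; have := p (cj u)^T.
have -> : (cj (cj u)^T)^T = u by apply/matrixP => i j; rewrite !mxE conjcK.
rewrite uL mul0mx mxE ltxx => /(_ _) h; suff : false by [].
apply: h; apply/eqP => h; move/eqP: u0; apply; apply/matrixP => i j.
by have /matrixP /(_ j i) := h; rewrite !mxE => /eqP; rewrite conjc_eq0 => /eqP.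
Qed.

(** For a left eigenvector u, u C2 u^* = z u C1 u^* and 0 < u C2 u^* <= u C1 u^*. *)
Lemma pencil_eigen (V1 V2 : 'M[R]_(n + n)) (z : C) :
  posdef V1 -> posdef V2 -> posdef (V1 - V2) ->
  4^-1 *: LC V1 \in unitmx ->
  eigenvalue ((4^-1 *: LC V2) *m invmx (4^-1 *: LC V1)) z ->
  exists2 m : R, 0 < m <= 1 & z = m%:C%C.
Proof.
move=> p1 p2 p12 uC /eigenvalueP[u uH u0].
have uE : u *m LC V2 = z *: (u *m LC V1).
  by apply: row_quot uC uH; rewrite invr_eq0 pnatr_eq0.
have [v vE] : exists v, (cj u)^T = toC v by exact: ex_intro _ _ (toC_surj _).
have uv : (cj (toC v))^T = u by rewrite -vE; apply/matrixP => i j; rewrite !mxE conjcK.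
have v0 : v != 0.
  rewrite -toC_eq0; apply: contra_neq u0 => h; rewrite -uv h.
  by apply/matrixP => i j; rewrite !mxE conjc0.
have e1 := LC_val v (posdef_sym p1); have e2 := LC_val v (posdef_sym p2).
have h1 := (posdef_Jsym p1).2 v v0; have h2 := (posdef_Jsym p2).2 v v0.
have := (posdef_Jsym p12).2 v v0.
have -> : V1 - V2 + conjJ (V1 - V2) = (V1 + conjJ V1) - (V2 + conjJ V2).
  by rewrite conjJB opprD addrACA.
rewrite qf_addmx qf_oppmx subr_gt0 => h12.
set r1 := qf (V1 + _) v in e1 h1 h12; set r2 := qf (V2 + _) v in e2 h2 h12.
exists (r2 / r1).
  by rewrite divr_gt0 // ler_pdivrMr // mul1r ltW.
have r10 : (r1%:C)%C != 0 by rewrite eq_complex /= eqxx andbT gt_eqF.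
rewrite rmorphM fmorphV /= -e2 -e1 uv uE -scalemxAl mxE mulfK //.
by rewrite -uv e1.
Qed.

Definition AC (L P : 'M[C]_n) : 'M[C]_(n + n) := @Amx C conjc 'i%C n L P.

(** The Euler equation says that (Q1 - S)^-1 - (Q2 - S)^-1 has no P part, which is
    what [quotient_form] asks for, and it is positive definite, which is what
    [pencil_eigen] asks for. *)
Lemma strict_spectrum (Q1 Q2 S : 'M[R]_(n + n)) :
  anti S -> posdef (Q1 - S) -> posdef (Q2 - S) -> posdef (Q2 - Q1) ->
  conjJ (invmx (Q1 - S) - invmx (Q2 - S)) = invmx (Q1 - S) - invmx (Q2 - S) ->
  exists mu : 'I_n -> R, [/\ forall j, 0 < mu j <= 1,
    char_poly (invmx (AC (LC Q2) (PC Q2)) *m AC (LC Q1) (PC Q1)) =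
      \prod_j ('X - (mu j)%:C%C%:P) * \prod_j ('X - ((mu j)^-1)%:C%C%:P) &
    (\det (Q1 - S) / \det (Q2 - S))%:C%C =
      \det (LC Q1) / \det (LC Q2) * (\prod_j mu j)%:C%C].
Proof.
move=> aS p1 p2 p12 eE.
have sS := aS.1; have L0 := LC_anti aS.
have sym Q : posdef (Q - S) -> Q^T = Q.
  by move=> [sQ _]; rewrite -(subrK S Q) linearD /= sQ sS.
have s1 := sym _ p1; have s2 := sym _ p2.
have Lsub Q : LC (Q - S) = LC Q by rewrite /LC LQ_add LQ_opp (L0 : LQ S = 0) subr0.
have uL Q : posdef (Q - S) -> LC Q \in unitmx.
  by move=> p; rewrite -Lsub; apply: LC_unit; [exact: posdef_sym|exact: posdef_Jsym].
have u1 := posdef_unitmx p1; have u2 := posdef_unitmx p2.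
have ePQ : PC (invmx (Q1 - S)) = PC (invmx (Q2 - S)).
  apply/eqP; rewrite -subr_eq0; apply/eqP; rewrite -(PC_inv eE) /PC PQ_add PQ_opp //.
have [uH cE dE] := @quotient_form R C (real_complex R) conjc 'i%C ic2 conj_i (@conjc_real R)
  two0 n Q1 Q2 S s1 s2 sS u1 u2 L0 (uL _ p1) (uL _ p2) ePQ.
set H := (_ *m _) in uH cE dE.
have uC1 : 4^-1 *: LC (invmx (Q1 - S)) \in unitmx.
  by rewrite -unitmx_inv; move: uH; rewrite /H unitmx_mul => /andP[].
have pV : posdef (invmx (Q1 - S) - invmx (Q2 - S)).
  apply: (posdef_inv_lt p1 p2).
  move=> x x0; rewrite -subr_gt0 -qf_oppmx -qf_addmx opprB addrA subrK.
  exact: p12.2.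
have ev z : root (char_poly H) z -> exists2 m : R, 0 < m <= 1 & z = m%:C%C.
  rewrite -eigenvalue_root_char => e.
  apply: (pencil_eigen (posdef_invmx p1) (posdef_invmx p2) pV uC1); exact: e.
have [s sE] := closed_field_poly_normal (char_poly H).
rewrite (monicP (char_poly_monic H)) scale1r in sE.
have ss : size s = n.
  by have := size_char_poly H; rewrite sE size_prod_XsubC => -[].
pose mu (j : 'I_n) : R := complex.Re (nth 0 s j).
have muP j : 0 < mu j <= 1 /\ nth 0 s j = (mu j)%:C%C.
  have [|m m01 e] := ev (nth 0 s j).
    rewrite sE root_prod_XsubC; apply: mem_nth; rewrite ss; exact: ltn_ord.
  split; rewrite /mu e; [exact: m01|reflexivity].
have pH : char_poly H = \prod_j ('X - (mu j)%:C%C%:P).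
  rewrite sE (big_nth 0) big_mkord ss; apply: eq_bigr => j _.
  by rewrite (muP j).2.
exists mu; split => [j||]; first exact: (muP j).1.
  rewrite cE pH (char_poly_inv_prod uH _ pH); last first.
    by move=> j; have [/andP[m0 _] _] := muP j; rewrite eq_complex /= eqxx andbT gt_eqF.
  congr (_ * _); apply: eq_bigr => j _; congr (_ - _%:P).
  exact/esym/fmorphV.
rewrite [LHS]dE; congr (_ * _).
have := char_poly_det H; rewrite pH -horner_coef0 horner_prod.
under eq_bigr => j _ do rewrite hornerXsubC sub0r.
rewrite prodrN card_ord => /(mulfI (_ : (-1) ^+ n != 0)) <-; last by rewrite signr_eq0.
by rewrite rmorph_prod.
Qed.
End Concrete.
End Spectrum.

(** * Wirtinger Hessians of quadratic weights *)

Section Hessians.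
Context {R : realType} {n : nat}.
Notation C := R[i].
Implicit Types (Q S : 'M[R]_(n + n)) (u v : 'cV[R]_(n + n)).

Lemma real_quadratic_form (Phi : 'cV[C]_n -> R) : real_quadratic Phi ->
  exists Q : 'M[R]_(n + n), Q^T = Q /\ forall v, Phi (toC v) = qf Q v.
Proof.
move=> [Q QP]; exists (2^-1 *: (Q + Q^T)); split.
  by rewrite linearZ /= linearD /= trmxK addrC.
move=> v; rewrite QP.
have -> : col_mx (map_mx (@complex.Re R) (toC v)) (map_mx (@complex.Im R) (toC v)) = v.
  rewrite -[RHS]vsubmxK; congr col_mx; apply/colP => j; by rewrite !mxE.
rewrite qf_scalemx qf_addmx (_ : qf Q^T v = qf Q v); last first.
  rewrite /qf /bil; have -> : v^T *m Q^T *m v = (v^T *m Q *m v)^T.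
    by rewrite !trmx_mul !trmxK mulmxA.
  by rewrite mxE.
by rewrite -/(bil Q v v) -/(qf Q v); field.
Qed.

(** Restricted to a real line, the weight and its first derivatives are polynomials of
    degree at most 2. *)
Lemma derive1_quadratic (f : R -> R) a b c :
  (forall t, f t = a + b * t + c * t ^+ 2) -> derive1 (f : R -> R^o) 0 = b.
Proof.
move=> fE; have -> : f = (fun t : R => a + b * t + c * t ^+ 2 : R^o) by apply/funext.
rewrite /derive1; apply/cvg_lim; first exact: Rhausdorff.
apply/cvgrPdist_le => eps eps0; have c1 : 0 < `|c| + 1 by rewrite ltr_wpDl.
exists (eps / (`|c| + 1)); first exact: divr_gt0.
move=> h; rewrite /= sub0r normrN => hd h0.
have -> : b - h^-1 *: (a + b * (h + 0) + c * (h + 0) ^+ 2 - (a + b * 0 + c * 0 ^+ 2)) = - (c * h).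
  by rewrite -[_ *: _]/(_ * _); field.
rewrite normrN normrM; apply: le_trans (ler_wpM2l (normr_ge0 c) (ltW hd)) _.
by rewrite mulrA ler_pdivrMr // mulrC ler_pM2l // lerDl.
Qed.

Lemma toCD v u (t : R) : toC v + t%:C%C *: toC u = toC (v + t *: u).
Proof.
apply/colP => j; rewrite !mxE; apply/eqP; rewrite eq_complex /=.
by rewrite !mul0r subr0 addr0 !eqxx.
Qed.

Let e (j : 'I_n) : 'cV[R]_(n + n) := delta_mx (lshift n j) 0.
Let f (j : 'I_n) : 'cV[R]_(n + n) := delta_mx (rshift n j) 0.

Lemma toC_e j : toC (e j) = delta_mx j 0.
Proof.
apply/colP => i; rewrite !mxE eq_lshift eq_rlshift /= !andbT.
by apply/eqP; rewrite eq_complex /=; case: (i == j); rewrite !eqxx.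
Qed.
Lemma toC_f j : toC (f j) = 'i%C *: delta_mx j 0.
Proof.
apply/colP => i; rewrite !mxE eq_rshift eq_lrshift /= !andbT.
by case: (i == j); rewrite ?mulr1 // mulr0.
Qed.

Lemma bil_delta m (Q : 'M[R]_m) i j : bil Q (delta_mx i 0) (delta_mx j 0) = Q i j.
Proof. by rewrite /bil trmx_delta -rowE -colE !mxE. Qed.

Lemma dderiv_quadratic (g : 'cV[C]_n -> C) u v (p1 q1 : R) (p q : 'cV[R]_(n + n) -> R) :
  (forall w, g (toC w) = Complex (p w) (q w)) ->
  (exists c, forall t, p (v + t *: u) = p v + p1 * t + c * t ^+ 2) ->
  (exists c, forall t, q (v + t *: u) = q v + q1 * t + c * t ^+ 2) ->
  real_dderiv g (toC u) (toC v) = Complex p1 q1.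
Proof.
move=> gE [c pE] [d qE]; rewrite /real_dderiv; congr Complex.
  by apply: (@derive1_quadratic _ (p v) _ c) => t; rewrite toCD gE /= pE.
by apply: (@derive1_quadratic _ (q v) _ d) => t; rewrite toCD gE /= qE.
Qed.

Section Hess.
Variables (Phi : 'cV[C]_n -> R) (Q : 'M[R]_(n + n)).
Hypotheses (sQ : Q^T = Q) (PhiE : forall v, Phi (toC v) = qf Q v).

Lemma dderiv_Phi u v : real_dderiv (fun x => (Phi x)%:C%C) (toC u) (toC v) = (2 * bil Q v u)%:C%C.
Proof.
apply: (@dderiv_quadratic (fun x => (Phi x)%:C%C) u v _ 0 (qf Q) (fun=> 0)) => [w||]; first by rewrite PhiE.
  by exists (qf Q u) => t; rewrite qfD // qfZ bilZr; ring.
by exists 0 => t; ring.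
Qed.

Lemma dderiv_lin (g : 'cV[C]_n -> C) u a b :
  (forall w, g (toC w) = Complex (bil Q w a) (- bil Q w b)) ->
  real_dderiv g (toC u) 0 = Complex (bil Q u a) (- bil Q u b).
Proof.
move=> gE; have -> : 0 = toC 0 :> 'cV[C]_n by apply/esym/eqP; rewrite toC_eq0.
apply: (@dderiv_quadratic g u 0 _ _ (bil Q ^~ a) (fun w => - bil Q w b) gE); exists 0 => t; rewrite add0r bilZl bil0l; ring.
Qed.

Lemma wirtinger (a b c d : R) :
  (Complex a b - 'i%C * Complex c d) / 2 = Complex ((a + d) / 2) ((b - c) / 2) /\
  (Complex a b + 'i%C * Complex c d) / 2 = Complex ((a - d) / 2) ((b + c) / 2).
Proof.
have e2 : (2 : C) = (2%:R)%:C%C by rewrite rmorph_nat.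
have n2 : (2 : C) != 0 by rewrite pnatr_eq0.
by split; apply: (mulIf n2); rewrite mulfVK // e2; apply/eqP; rewrite eq_complex /=;
  apply/andP; split; apply/eqP; field.
Qed.

Lemma d_x_Phi k w : d_x k (fun x => (Phi x)%:C%C) (toC w) = Complex (bil Q w (e k)) (- bil Q w (f k)).
Proof.
rewrite /d_x /d_Re /d_Im -toC_f -toC_e !dderiv_Phi (wirtinger _ _ _ _).1.
by congr Complex; field.
Qed.

Lemma hess_xxE : 2 *: hess_xx Phi = PC Q.
Proof.
apply/matrixP => j k; rewrite [LHS]mxE [X in 2 * X]mxE /d_x -/(d_x k _) /d_Re /d_Im -toC_f -toC_e.
rewrite !(dderiv_lin _ (d_x_Phi k)) (wirtinger _ _ _ _).1 /e /f !bil_delta PQE !mxE.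
have -> : (2 : C) = (2%:R)%:C%C by rewrite rmorph_nat.
by apply/eqP; rewrite eq_complex /=; apply/andP; split; apply/eqP; field.
Qed.

Lemma hess_xbarxE : 2 *: hess_xbarx Phi = LC Q.
Proof.
apply/matrixP => j k; rewrite [LHS]mxE [X in 2 * X]mxE /d_xbar -/(d_x k _) /d_Re /d_Im -toC_f -toC_e.
rewrite !(dderiv_lin _ (d_x_Phi k)) (wirtinger _ _ _ _).2 /e /f !bil_delta LQE !mxE.
have -> : (2 : C) = (2%:R)%:C%C by rewrite rmorph_nat.
by apply/eqP; rewrite eq_complex /=; apply/andP; split; apply/eqP; field.
Qed.

Lemma A_mxE : A_mx Phi = AC (LC Q) (PC Q).
Proof. by rewrite /A_mx hess_xxE hess_xbarxE. Qed.

Lemma posdefmx_Jpos : posdefmx (hess_xbarx Phi) -> posdef (Q + conjJ Q).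
Proof.
move=> [_ p]; apply/(Cpos_Jpos sQ) => x x0; rewrite -hess_xbarxE -scalemxAr -scalemxAl mxE.
by rewrite mulr_gt0 ?p // ltr0n.
Qed.

End Hess.
End Hessians.

(** * Holomorphic functions with Gaussian modulus *)

Section HolomorphicForms.
Context {K F : fieldType} {r : {rmorphism K -> F}} {ic : F}.
Hypothesis ic2 : ic * ic = -1.
Notation rc := (map_mx r).

Lemma hol_linear m p q (a b : 'M[K]_(m, p)) (c d : 'M[K]_(p, q)) :
  (rc a - ic *: rc b) *m (rc c + ic *: rc d) =
  rc (a *m c + b *m d) + ic *: rc (a *m d - b *m c).
Proof.
rewrite mulmxBl !mulmxDr -!scalemxAl -!scalemxAr -!map_mxM scalerA ic2 scaleN1r.
by apply/matrixP => i j; rewrite !mxE rmorphD rmorphB; ring.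
Qed.

Lemma hol_quadratic m (A B : 'M[K]_m) (a b : 'cV[K]_m) :
  (rc a + ic *: rc b)^T *m (rc A - ic *: rc B) *m (rc a + ic *: rc b) =
  rc (a^T *m A *m a - b^T *m A *m b + a^T *m B *m b + b^T *m B *m a) +
  ic *: rc (a^T *m A *m b + b^T *m A *m a - a^T *m B *m a + b^T *m B *m b).
Proof.
have -> : (rc a + ic *: rc b)^T = rc a^T + ic *: rc b^T by apply/matrixP => i j; rewrite !mxE.
rewrite -mulmxA hol_linear mulmxDl !mulmxDr -!scalemxAl -!scalemxAr -!map_mxM scalerA ic2 scaleN1r.
rewrite mulmxDr !mulmxBr !mulmxDr !mulmxA !(map_mxD, map_mxB, map_mxN) !(scalerDr, scalerBr, scalerN).
apply/matrixP => i j; rewrite !mxE; ring.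
Qed.
End HolomorphicForms.

Section Exponentials.
Context {R : realType} {n : nat}.
Notation C := R[i].
Notation rc := (map_mx (real_complex R)).
Implicit Types (Q S : 'M[R]_(n + n)) (u v : 'cV[R]_(n + n)).

Lemma holomorphicM (f g : 'cV[C]_n -> C) : holomorphic f -> holomorphic g ->
  holomorphic (fun x => f x * g x).
Proof. by move=> hf hg x; exact: (differentiableM (hf x) (hg x)). Qed.

Lemma holomorphic_cst (c : C) : holomorphic (fun _ : 'cV[C]_n => c).
Proof. by move=> x; exact: differentiable_cst. Qed.

Lemma holomorphicD (f g : 'cV[C]_n -> C) : holomorphic f -> holomorphic g ->
  holomorphic (fun x => f x + g x).
Proof. by move=> hf hg x; exact: (differentiableD (hf x) (hg x)). Qed.

Lemma holomorphic_sum m (f : 'I_m -> 'cV[C]_n -> C) : (forall i, holomorphic (f i)) ->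
  holomorphic (fun x => \sum_i f i x).
Proof.
move=> hf; elim: m f hf => [|m IH] f hf.
  under eq_fun => x do rewrite big_ord0; exact: holomorphic_cst.
under eq_fun => x do rewrite big_ord_recl; apply: holomorphicD => //.
by apply: IH => i.
Qed.

Lemma holomorphic_coord i : holomorphic (fun x : 'cV[C]_n => x i 0).
Proof. by move=> x; exact: (@differentiable_coord _ _ _ (x : 'cV[C^o]_n) i 0). Qed.

Lemma holomorphic_linear (l : 'cV[C]_n) : holomorphic (fun x => (l^T *m x) 0 0).
Proof.
under eq_fun => x do rewrite mxE; apply: holomorphic_sum => i.
by apply: holomorphicM; [exact: holomorphic_cst|exact: holomorphic_coord].
Qed.

Lemma holomorphic_quadratic (M : 'M[C]_n) : holomorphic (fun x => (x^T *m M *m x) 0 0).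
Proof.
under eq_fun => x do rewrite mxE; apply: holomorphic_sum => j.
apply: holomorphicM; last exact: holomorphic_coord.
under eq_fun => x do rewrite mxE; apply: holomorphic_sum => i.
apply: holomorphicM; last exact: holomorphic_cst.
under eq_fun => x do rewrite mxE; exact: holomorphic_coord.
Qed.

Lemma holomorphic_exp (f : 'cV[C]_n -> C) : holomorphic f -> holomorphic (fun x => cexp (f x)).
Proof. by move=> hf x; exact: (differentiable_comp (hf x) (differentiable_cexp (f x))). Qed.

Lemma toCE v : toC v = rc (usubmx v) + 'i%C *: rc (dsubmx v).
Proof. by apply/matrixP => i j; rewrite !mxE [LHS]complexE /= (ord1 j). Qed.

(** S + l is the real part of the holomorphic polynomial with coefficients
    S_aa - i S_ab and l_a - i l_b; halving it accounts for the square. *)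
Lemma exp_pluriharmonic S (l : 'cV[R]_(n + n)) : anti S ->
  exists2 f : 'cV[C]_n -> C, holomorphic f &
    forall v, normC (f (toC v)) ^+ 2 = expR (qf S v + (l^T *m v) 0 0).
Proof.
move=> aS.
pose s : 'M[C]_n := 2^-1 *: (rc (ulsubmx S) - 'i%C *: rc (ursubmx S)).
pose c : 'cV[C]_n := 2^-1 *: (rc (usubmx l) - 'i%C *: rc (dsubmx l)).
exists (fun x => cexp ((x^T *m s *m x) 0 0 + (c^T *m x) 0 0)).
  apply: holomorphic_exp; apply: holomorphicD; first exact: holomorphic_quadratic.
  exact: holomorphic_linear.
move=> v; rewrite normc_cexp -expRM_natl; congr expR.
have ic2 : 'i%C * 'i%C = -1 :> C by rewrite -expr2 sqr_i.
rewrite /s /c toCE -scalemxAr -scalemxAl (hol_quadratic ic2).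
have -> : (2^-1 *: (rc (usubmx l) - 'i%C *: rc (dsubmx l)))^T =
    2^-1 *: (rc (usubmx l)^T - 'i%C *: rc (dsubmx l)^T).
  by apply/matrixP => i j; rewrite !mxE.
rewrite -scalemxAl (hol_linear ic2).
have key (X Y : 'M[C]_1) :
    2 * complex.Re ((2^-1 *: X) 0 0 + (2^-1 *: Y) 0 0) = complex.Re (X 0 0) + complex.Re (Y 0 0).
  rewrite [(2^-1 *: X) _ _]mxE [(2^-1 *: Y) _ _]mxE.
  have -> : (2^-1 : C) = (2^-1)%:C%C by rewrite fmorphV rmorph_nat.
  by case: (X 0 0) (Y 0 0) => x1 y1 [x2 y2] /=; field.
have eRe (M N : 'M[R]_1) : complex.Re ((rc M + 'i%C *: rc N) 0 0) = M 0 0.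
  by rewrite !mxE /= ?(mul0r,mul1r,subr0,addr0).
rewrite key !eRe; congr (_ + _).
  have := aS.2; rewrite conjJ_quarter /quarter => aE.
  have h1 : drsubmx S = - ulsubmx S by have := congr1 ulsubmx aE; rewrite block_mxKul => ->; apply/matrixP => i j; rewrite !mxE.
  have h2 : dlsubmx S = ursubmx S.
    apply: oppr_inj; have := congr1 ursubmx aE; rewrite block_mxKur => ->.
    by apply/matrixP => i j; rewrite !mxE.
  rewrite /qf /bil -[in RHS](vsubmxK v) -[in RHS](submxK S) tr_col_mx mul_row_block mul_row_col h1 h2.
  rewrite !mulmxDl mulmxN mulNmx !mxE; ring.
by rewrite -[in RHS](vsubmxK v) -[in RHS](vsubmxK l) tr_col_mx mul_row_col.
Qed.
End Exponentials.

(** * Weighted integrals: sharp constant and necessity *)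

Section Norms.
Context {R : realType} {n : nat}.
Notation C := R[i].
Notation X := (measurableTypeR R).
Implicit Types (Q S A : 'M[R]_(n + n)) (u v : 'cV[R]_(n + n)) (f g : 'cV[C]_n -> C).

(** The squared weighted norm, for the exponent Q = 4 pi Phi. *)
Definition wint Q f : \bar R :=
  vint (fun v : 'cV[R]_(n + n) => (normC (f (toC v)) ^+ 2 * expR (- qf Q v))%:E).

Lemma wint_ge0 Q f : (0 <= wint Q f)%E.
Proof. by apply: vint_ge0 => v; rewrite lee_fin mulr_ge0 ?expR_ge0 // sqr_ge0. Qed.

Lemma Hnorm_wint (Phi : 'cV[C]_n -> R) A f : (forall v, 4 * pi * Phi (toC v) = qf A v) ->
  holomorphic f -> Hnorm Phi f = (wint A f `^ 2^-1)%E.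
Proof.
move=> PhiE hf; rewrite /Hnorm; congr (_ `^ _)%E.
rewrite /wint -int_pair; last first.
- by move=> v; rewrite lee_fin mulr_ge0 ?expR_ge0 // sqr_ge0.
- exact: vmeas_Ng.
by apply: eq_integral => ab _; rewrite of_ReImE PhiE.
Qed.

Lemma wint_le Q1 Q2 f : holomorphic f -> (forall v, qf Q1 v <= qf Q2 v) ->
  (wint Q2 f <= wint Q1 f)%E.
Proof.
move=> hf le12; apply: le_vint; [exact: vmeas_Ng|exact: vmeas_Ng| |] => v.
  by rewrite lee_fin mulr_ge0 ?expR_ge0 // sqr_ge0.
by rewrite lee_fin ler_wpM2l ?sqr_ge0 // ler_expR lerN2.
Qed.

Lemma wint_scale Q f (a : R) : 0 <= a -> holomorphic f ->
  wint Q (fun x => a%:C%C * f x) = ((a ^+ 2)%:E * wint Q f)%E.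
Proof.
move=> a0 hf; rewrite /wint -vintZ; [|exact: sqr_ge0|exact: vmeas_Ng|]; last first.
  by move=> v; rewrite lee_fin mulr_ge0 ?expR_ge0 // sqr_ge0.
apply: eq_vint => v; rewrite -EFinM; congr EFin.
rewrite Normc.normcM exprMn_comm ?mulrA; last exact: mulrC.
by congr (_ * _ * _); rewrite /= expr0n /= addr0 sqr_sqrtr ?sqr_ge0.
Qed.

Lemma wint_exp Q S (l : 'cV[R]_(n + n)) f : (forall v : 'cV[R]_(n + n), normC (f (toC v)) ^+ 2 = expR (qf S v + (l^T *m v) 0 0)) ->
  wint Q f = vint (fun v : 'cV[R]_(n + n) => (expR (qf S v + (l^T *m v) 0 0 - qf Q v))%:E).
Proof. by move=> fE; apply: eq_vint => v; rewrite fE -expRD. Qed.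

(** K is the square of the norm of the embedding.  Minimality is tested on functions of
    finite norm only, since K' times an infinite integral is no constraint. *)
Definition sharp Q1 Q2 (K : R) := [/\ 0 <= K,
  forall f, holomorphic f -> (wint Q2 f <= K%:E * wint Q1 f)%E &
  forall K', 0 <= K' -> (forall f, holomorphic f -> (wint Q1 f < +oo)%E -> (wint Q2 f <= K'%:E * wint Q1 f)%E) ->
    K <= K'].

Lemma conjJ_invmx (E : 'M[R]_(n + n)) : E \in unitmx -> conjJ E = E -> conjJ (invmx E) = invmx E.
Proof.
move=> uE eE.
have JJ : (Jmx n)^T *m Jmx n = 1%:M :> 'M[R]_(n + n) by rewrite trJmx mulNmx JmxJ opprK.
have [uT uJ] := mulmx1_unit JJ.
have iJ : invmx (Jmx n) = (Jmx n)^T :> 'M[R]_(n + n).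
  by rewrite -[LHS]mul1mx -JJ mulmxK.
have iT : invmx (Jmx n)^T = Jmx n :> 'M[R]_(n + n) by rewrite -iJ invmxK.
by rewrite -[in RHS]eE /conjJ !invmx_mul ?unitmx_mul ?uT // iT iJ mulmxA.
Qed.

(** [convolution_le] applies to f times the function of square modulus exp(- c S); the
    function of square modulus exp(c S) gives equality. *)
Lemma strict_sharp Q1 Q2 S (c : R) : 0 < c -> anti S ->
  posdef (Q1 - S) -> posdef (Q2 - S) -> posdef (Q2 - Q1) ->
  conjJ (invmx (Q1 - S) - invmx (Q2 - S)) = invmx (Q1 - S) - invmx (Q2 - S) ->
  sharp (c *: Q1) (c *: Q2) (Num.sqrt (\det (Q1 - S) / \det (Q2 - S))).
Proof.
move=> c0 aS p1 p2 p12 eE; have cn0 := lt0r_neq0 c0.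
have d1 := posdef_det_gt0 p1; have d2 := posdef_det_gt0 p2.
pose A : 'M[R]_(n + n) := c *: (Q1 - S); pose B : 'M[R]_(n + n) := c *: (Q2 - S).
have pA : posdef A := posdef_scale c0 p1; have pB : posdef B := posdef_scale c0 p2.
have AB x : x != 0 -> qf A x < qf B x.
  move=> x0; rewrite -subr_gt0 -qf_oppmx -qf_addmx -scalerBr qf_scalemx mulr_gt0 //.
  by rewrite opprB addrA subrK; exact: p12.2.
have pE := posdef_inv_lt pA pB AB; have uE := posdef_unitmx pE.
have EJ : conjJ (invmx A - invmx B) = invmx A - invmx B.
  by rewrite !invmxZ ?(posdef_unitmx pA) ?(posdef_unitmx pB) // -scalerBr conjJZ eE.
have pD := posdef_invmx pE; set D := invmx _ in pD.
have rD : rot_invariant D by apply: rot_invariant_conjJ; [exact: posdef_sym|exact: conjJ_invmx].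
have DE : invmx A = invmx B + invmx D by rewrite /D invmxK addrC subrK.
have detE : \det A / \det B = \det (Q1 - S) / \det (Q2 - S).
  by rewrite !detZ; field; rewrite ?gt_eqF // exprn_gt0.
rewrite -detE; split=> [|f hf|K' K'0 HK]; first exact: sqrtr_ge0.
- have [h hh hE] := exp_pluriharmonic 0 (antiZ (- c) aS).
  have hg := holomorphicM hf hh.
  have gE Q : (fun v : 'cV[R]_(n + n) => (normC (f (toC v) * h (toC v)) ^+ 2 * expR (- qf (c *: (Q - S)) v))%:E) =1
      (fun v => (normC (f (toC v)) ^+ 2 * expR (- qf (c *: Q) v))%:E).
    move=> v; congr EFin; rewrite Normc.normcM exprMn_comm ?hE -?mulrA -?expRD; last exact: mulrC.
    congr (_ * (_ * expR _)); rewrite trmx0 mul0mx mxE addr0 !qf_scalemx qf_addmx qf_oppmx; ring.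
  by have := convolution_le hg pA pB pD rD DE; rewrite (eq_vint (gE Q1)) (eq_vint (gE Q2)).
- have [h hh hE] := exp_pluriharmonic 0 (antiZ c aS).
  have hI Q : posdef (c *: (Q - S)) ->
      wint (c *: Q) h = (Num.sqrt (pi ^+ (n + n) / \det (c *: (Q - S))))%:E.
    move=> pQ; rewrite (wint_exp _ hE) -gaussian_integral //; apply: eq_vint => v.
    congr (expR _)%:E; rewrite trmx0 mul0mx mxE addr0 !qf_scalemx qf_addmx qf_oppmx; ring.
  have := HK _ hh; rewrite !hI // ltry => /(_ isT); rewrite -EFinM lee_fin.
  have dA := posdef_det_gt0 pA; have dB := posdef_det_gt0 pB; have pi0 := pi_gt0 R.
  have x0 : 0 < Num.sqrt (pi ^+ (n + n) / \det A) by rewrite sqrtr_gt0 divr_gt0 // exprn_gt0.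
  have -> : Num.sqrt (pi ^+ (n + n) / \det B) =
      Num.sqrt (\det A / \det B) * Num.sqrt (pi ^+ (n + n) / \det A).
    rewrite -sqrtrM ?divr_ge0 ?ltW //; congr Num.sqrt; field.
    by rewrite !gt_eqF.
  by rewrite ler_pM2r.
Qed.

Lemma vint_opp (h : 'cV[R]_(n + n) -> \bar R) : vmeas h -> (forall x, 0 <= h x)%E ->
  vint (fun x => h (- x)) = vint h.
Proof.
move=> mh h0; rewrite -(vint_rot mh h0 (_ : (-1) ^+ 2 + 0 ^+ 2 = 1)); last by ring.
by apply: eq_vint => x; rewrite rotmxJ scale0r addr0 mul_scalar_mx scaleN1r.
Qed.

Lemma measurable_lin d (T : measurableType d) m (l : 'rV[R]_m) (c : T -> 'cV[R]_m) :
  (forall i, measurable_fun setT (fun t => c t i 0)) ->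
  measurable_fun setT (fun t => (l *m c t) 0 0).
Proof.
move=> mc; under eq_fun => t do rewrite mxE.
apply: measurable_sum => i; apply: measurable_funM => //.
Qed.

Lemma vint_average (F : 'cV[R]_(n + n) -> \bar R) u : vmeas F -> (forall x, 0 <= F x)%E ->
  vmeas (fun h => F (h + u)%R + F (- h + u)%R)%E /\
  vint (fun h => F (h + u)%R + F (- h + u)%R)%E = (2%:E * vint F)%E.
Proof.
move=> mF F0.
have mG : vmeas (fun h : 'cV[R]_(n + n) => F (h + u)).
  apply: (vmeas_comp (c := fun t : (n + n).-tuple X => tcol t + u)) => // i.
  under eq_fun => t do rewrite mxE.
  by apply: measurable_funD => //; exact: measurable_tcol.
have mG' : vmeas (fun h : 'cV[R]_(n + n) => F (- h + u)).
  apply: (vmeas_comp (c := fun t : (n + n).-tuple X => - tcol t + u)) => // i.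
  under eq_fun => t do rewrite mxE [(- tcol t) i 0]mxE.
  by apply: measurable_funD => //; apply: measurable_funN; exact: measurable_tcol.
split; first exact: emeasurable_funD.
have IG : vint (fun h => F (h + u)) = vint F := vint_shift u mF F0.
have IG' := vint_opp mG (fun x => F0 (x + u)).
have -> : (2%:E * vint F = vint F + vint F)%E by rewrite mule_natl mule2n.
rewrite -[X in (X + _)%E]IG -[X in (_ + X)%E](etrans IG' IG); apply: (@ge0_integralD _ _ _ (lebesgue_tuple R (n + n)) _ measurableT
  (fun a => F (tcol a + u)) (fun a => F (- tcol a + u))) => //.
Qed.

(** Centre the integral at u and average over h and - h: the odd part of the exponent
    enters through exp(m) + exp(- m) >= 2. *)
Lemma gauss_linear_lower (T : 'M[R]_(n + n)) (l u : 'cV[R]_(n + n)) : T^T = T ->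
  ((expR ((l^T *m u) 0 0 - qf T u))%:E * vint (fun h : 'cV[R]_(n + n) => (expR (- qf T h))%:E) <=
   vint (fun v : 'cV[R]_(n + n) => (expR ((l^T *m v) 0 0 - qf T v))%:E))%E.
Proof.
move=> sT.
pose F (v : 'cV[R]_(n + n)) := (expR ((l^T *m v) 0 0 - qf T v))%:E.
have mF : vmeas F.
  apply: vmeas_EFin; apply: measurableT_comp => //; apply: measurable_funB.
    by apply: (measurable_lin l^T (c := @tcol R (n + n))) => i; exact: measurable_tcol.
  by apply: (measurable_qf T (c := @tcol R (n + n))) => i; exact: measurable_tcol.
have F0 v : (0 <= F v)%E by rewrite lee_fin expR_ge0.
have [mGG GD] := vint_average u mF F0.
rewrite -(@lee_pmul2l _ 2%:E) //.
rewrite -GD muleA -EFinM -vintZ; [|by rewrite mulr_ge0 ?expR_ge0|exact: vmeas_gaussian|]; last first.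
  by move=> x; rewrite lee_fin expR_ge0.
apply: le_vint => [| | x | x].
- apply: vmeas_EFin; apply: measurable_funM => //.
  by apply: measurable_gaussian => i; exact: measurable_tcol.
- exact: mGG.
- by rewrite lee_fin mulr_ge0 ?mulr_ge0 ?expR_ge0.
rewrite -EFinM -EFinD lee_fin; set m := (l^T *m x) 0 0 - 2 * bil T u x.
have lD y : (l^T *m (y + u)) 0 0 = (l^T *m y) 0 0 + (l^T *m u) 0 0 by rewrite mulmxDr [LHS]mxE.
have lN : (l^T *m - x) 0 0 = - (l^T *m x) 0 0 by rewrite mulmxN [LHS]mxE.
have e1 : (l^T *m (x + u)) 0 0 - qf T (x + u) = ((l^T *m u) 0 0 - qf T u) + - qf T x + m.
  by rewrite /m qfD // lD (bilC x u sT); ring.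
have e2 : (l^T *m (- x + u)) 0 0 - qf T (- x + u) = ((l^T *m u) 0 0 - qf T u) + - qf T x - m.
  by rewrite /m qfD // lD lN (bilC (- x) u sT) bilNr qfN; ring.
rewrite e1 e2 -mulrA -expRD !(expRD (_ + - qf T x)) -mulrDr mulrC ler_pM2l ?expR_gt0 //.
by have := expR_ge1Dx m; have := expR_ge1Dx (- m); lra.
Qed.

(** The test function for u has square modulus exp(Qa(v) + 2 Qc(u, v)), where Q1 = Qc + Qa
    splits Q1 into the parts that J preserves and negates.  Its first norm is
    exp(Qc(u)) times a constant, and its second is at least a constant times
    exp(Qc(u) + (Q1 - Q2)(u)). *)
Lemma necessity Q1 Q2 (C0 : R) : Q1^T = Q1 -> Q2^T = Q2 -> posdef (Q1 + conjJ Q1) -> 0 <= C0 ->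
  (forall f, holomorphic f -> (wint Q1 f < +oo)%E -> (wint Q2 f <= C0%:E * wint Q1 f)%E) ->
  forall v, qf Q1 v <= qf Q2 v.
Proof.
move=> s1 s2 p1 C00 H x0; rewrite leNgt; apply/negP => lt21.
pose Qc : 'M[R]_(n + n) := 2^-1 *: (Q1 + conjJ Q1).
pose Qa : 'M[R]_(n + n) := 2^-1 *: (Q1 - conjJ Q1).
have pc : posdef Qc by apply: posdef_scale.
have aQ : anti Qa by apply: antiZ; exact: conjJ_sub_anti.
have Q1E : Q1 = Qa + Qc by apply/matrixP => i j; rewrite !mxE; field.
pose T : 'M[R]_(n + n) := Q2 - Qa.
have sT : T^T = T by rewrite /T linearB /= s2 aQ.1.
pose Z : R := Num.sqrt (pi ^+ (n + n) / \det Qc).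
have [k k0 kT] := posdef_dominates T pc.
have pk : posdef (k *: Qc) := posdef_scale k0 pc.
pose z : R := Num.sqrt (pi ^+ (n + n) / \det (k *: Qc)).
have Z0 : 0 < Z by rewrite sqrtr_gt0 divr_gt0 ?exprn_gt0 ?pi_gt0 // posdef_det_gt0.
have z0 : 0 < z by rewrite sqrtr_gt0 divr_gt0 ?exprn_gt0 ?pi_gt0 // posdef_det_gt0.
have key u : expR (qf Q1 u - qf Q2 u) * z <= C0 * Z.
  pose l : 'cV[R]_(n + n) := 2 *: (Qc *m u).
  have lE v : (l^T *m v) 0 0 = 2 * bil Qc u v.
    by rewrite /l linearZ /= trmx_mul (posdef_sym pc) -scalemxAl mxE.
  have [f hf fE] := exp_pluriharmonic l aQ.
  have w1 : wint Q1 f = (expR (qf Qc u) * Z)%:E.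
    rewrite (wint_exp _ fE) EFinM -gaussian_integral // -vintZ; [|exact: expR_ge0|exact: vmeas_gaussian|by move=> v; rewrite lee_fin expR_ge0].
    rewrite -[RHS](@vint_shift _ _ (- u)); first last.
    - by move=> v; rewrite lee_fin mulr_ge0 ?expR_ge0.
    - apply: vmeas_EFin; apply: measurable_funM => //.
      by apply: measurable_gaussian => i; exact: measurable_tcol.
    apply: eq_vint => v; rewrite -EFinM -expRD lE Q1E qf_addmx qfB ?(posdef_sym pc) //.
    by rewrite (bilC u v (posdef_sym pc)); congr (expR _)%:E; ring.
  have w2 : ((expR (2 * qf Qc u - qf T u) * z)%:E <= wint Q2 f)%E.
    rewrite (wint_exp _ fE).
    have -> : vint (fun v => (expR (qf Qa v + (l^T *m v) 0 0 - qf Q2 v))%:E) =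
        vint (fun v : 'cV[R]_(n + n) => (expR ((l^T *m v) 0 0 - qf T v))%:E).
      by apply: eq_vint => v; congr (expR _)%:E; rewrite /T qf_addmx qf_oppmx; ring.
    apply: le_trans (gauss_linear_lower l u sT); rewrite lE EFinM lee_pmul2l ?lte_fin ?expR_gt0 //.
    rewrite /z -(gaussian_integral pk).
    apply: (le_vint (vmeas_gaussian (k *: Qc)) (vmeas_gaussian T)) => v.
    - by rewrite lee_fin expR_ge0.
    - rewrite lee_fin ler_expR lerN2 qf_scalemx.
      exact: le_trans (ler_norm _) (kT v).
  have := H f hf; rewrite w1 ltry => /(_ isT); move/(le_trans w2); rewrite -EFinM lee_fin.
  have -> : 2 * qf Qc u - qf T u = qf Qc u + (qf Q1 u - qf Q2 u).
    by rewrite Q1E /T !qf_addmx qf_oppmx; ring.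
  by rewrite expRD -mulrA (mulrCA C0) ler_pM2l // expR_gt0.
pose d := qf Q1 x0 - qf Q2 x0; have d0 : 0 < d by rewrite subr_gt0.
pose w := C0 * Z / z; have w0 : 0 <= w := divr_ge0 (mulr_ge0 C00 (ltW Z0)) (ltW z0).
(* At this multiple of x0 the exponent is w, and exp(w) >= 1 + w > w. *)
have := key (Num.sqrt (w / d) *: x0); rewrite !qfZ -mulrBr (sqr_sqrtr (divr_ge0 w0 (ltW d0))).
rewrite -/d divfK ?(lt0r_neq0 d0) // -(ler_pdivlMr _ _ z0) -/w => h.
by have := le_trans (expR_ge1Dx w) h; rewrite -subr_ge0 opprD addrCA subrr addr0 oppr_ge0 ler10.
Qed.

End Norms.

(** * From weighted integrals to the embedding *)

Opaque wint Hnorm.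

Section Embedding.
Context {R : realType} {n : nat}.
Notation C := R[i].
Notation X := (measurableTypeR R).
Implicit Types (Q S : 'M[R]_(n + n)) (u v : 'cV[R]_(n + n)) (f g : 'cV[C]_n -> C).

Lemma fine_eq (x : \bar R) : (0 <= x)%E -> (x < +oo)%E -> x = (fine x)%:E.
Proof. by move=> x0 x1; rewrite fineK // ge0_fin_numE. Qed.

Lemma poweR12_le (w : \bar R) (s : R) : (0 <= w)%E -> 0 <= s ->
  (w `^ 2^-1 <= s%:E)%E = (w <= (s ^+ 2)%:E)%E.
Proof.
move=> w0 s0; case: w w0 => [r r0||//]; last first.
  by move=> _; rewrite poweRyr ?invr_eq0 ?pnatr_eq0 // !leye_eq.
rewrite lee_fin in r0; rewrite poweR_EFin !lee_fin powR12_sqrt //.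
by rewrite -{1}(ger0_norm s0) -sqrtr_sqr ler_sqrt ?sqr_ge0.
Qed.

Section Pair.
Variables (Phi1 Phi2 : 'cV[C]_n -> R) (A1 A2 : 'M[R]_(n + n)).
Hypotheses (e1 : forall v, 4 * pi * Phi1 (toC v) = qf A1 v) (e2 : forall v, 4 * pi * Phi2 (toC v) = qf A2 v).

Lemma HspaceE (Phi : 'cV[C]_n -> R) Q f : (forall v, 4 * pi * Phi (toC v) = qf Q v) ->
  Hspace Phi f <-> holomorphic f /\ (wint Q f < +oo)%E.
Proof.
move=> eP; rewrite /Hspace /=; split=> -[hf]; rewrite (Hnorm_wint eP hf) => h; split => //.
  by apply: lty_poweRy h; rewrite invr_eq0 pnatr_eq0.
exact: poweR_lty.
Qed.

Lemma bounded_wint (k : R) : 0 <= k ->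
  (forall f, holomorphic f -> (wint A2 f <= k%:E * wint A1 f)%E) -> embedding_bounded Phi1 Phi2.
Proof.
move=> k0 H; split.
  move=> f /(HspaceE _ e1)[hf f1]; apply/(HspaceE _ e2); split; first exact: hf.
  apply: le_lt_trans (H f hf) _; move: f1 {H}.
  by rewrite -ge0_fin_numE ?wint_ge0 // => f1; rewrite -(fineK f1) -EFinM ltry.
exists (Num.sqrt k); first exact: sqrtr_ge0.
move=> f /(HspaceE _ e1)[hf f1]; rewrite (Hnorm_wint e1 hf) (Hnorm_wint e2 hf).
rewrite -powR12_sqrt // -poweR_EFin -poweRM ?wint_ge0 ?lee_fin //.
apply: gt0_ler_poweR; rewrite ?invr_ge0 ?in_itv /= ?andbT ?wint_ge0 ?mule_ge0 ?lee_fin ?wint_ge0 ?leey //.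
exact: H.
Qed.

Lemma wint_bounded : embedding_bounded Phi1 Phi2 -> exists2 k : R, 0 <= k &
  forall f, holomorphic f -> (wint A1 f < +oo)%E -> (wint A2 f <= k%:E * wint A1 f)%E.
Proof.
move=> [_ [k k0 H]]; exists (k ^+ 2); first exact: sqr_ge0.
move=> f hf f1; have := H f; rewrite (Hnorm_wint e1 hf) (Hnorm_wint e2 hf) {H}.
have w1 := wint_ge0 A1 f; have w2 := wint_ge0 A2 f.
have w1E := fine_eq w1 f1.
have w10 := fine_ge0 w1.
rewrite w1E poweR_EFin -EFinM powR12_sqrt // poweR12_le ?mulr_ge0 ?sqrtr_ge0 //.
rewrite exprMn_comm ?sqr_sqrtr //; last exact: mulrC.
by apply; apply/(HspaceE _ e1).
Qed.

(** Scaling reduces minimality of k to functions in the unit ball. *)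
Lemma sharp_norm (k : R) : sharp A1 A2 k ->
  embedding_norm Phi1 Phi2 = (Num.sqrt k)%:E.
Proof.
move=> [k0 up low]; apply/eqP; rewrite eq_le; apply/andP.
have upper : (embedding_norm Phi1 Phi2 <= (Num.sqrt k)%:E)%E.
  apply: ge_ereal_sup => _ [f [/(HspaceE _ e1)[hf f1] n1] <-].
  rewrite (Hnorm_wint e2 hf) poweR12_le ?wint_ge0 ?sqrtr_ge0 // sqr_sqrtr //.
  apply: le_trans (up f hf) _; rewrite -[leRHS]mule1 lee_wpmul2l ?lee_fin //.
  by move: n1; rewrite (Hnorm_wint e1 hf) (@poweR12_le _ 1) ?wint_ge0 // expr1n.
split; first exact: upper.
have mem g : holomorphic g -> (wint A1 g <= 1)%E ->
    (wint A2 g `^ 2^-1 <= embedding_norm Phi1 Phi2)%E.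
  move=> hg g1; apply: ereal_sup_ubound; exists g; last exact: Hnorm_wint.
  split; first by apply/(HspaceE _ e1); split => //; apply: le_lt_trans g1 _; rewrite ltry.
  by rewrite (Hnorm_wint e1 hg) (@poweR12_le _ 1) ?wint_ge0 // expr1n.
have sup0 : (0 <= embedding_norm Phi1 Phi2)%E.
  have h0 : holomorphic (fun _ : 'cV[C]_n => 0 : C) by exact: holomorphic_cst.
  apply: le_trans (mem _ h0 _); first exact: poweR_ge0.
  have := wint_scale A1 (lexx 0) h0.
  rewrite (_ : (fun _ : 'cV[C]_n => 0%:C%C * 0) = (fun _ : 'cV[C]_n => 0 : C)); last by apply/funext => x; rewrite mulr0.
  by rewrite expr0n /= mul0e => ->.
have supE : embedding_norm Phi1 Phi2 = (fine (embedding_norm Phi1 Phi2))%:E.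
  by rewrite fineK // ge0_fin_numE //; apply: le_lt_trans upper _; rewrite ltry.
move: mem sup0; rewrite supE; set s := fine _; rewrite lee_fin => mem s0.
rewrite lee_fin -(ger0_norm s0) -sqrtr_sqr ler_sqrt ?sqr_ge0 //; apply: low => [|f hf f1].
  exact: sqr_ge0.
have w1 := wint_ge0 A1 f.
have w1E := fine_eq w1 f1.
move: w1 w1E (up f hf); set w := fine _ => w1 w1E upf; rewrite w1E -EFinM in upf *.
rewrite w1E lee_fin in w1.
move: w1; rewrite le_eqVlt => /predU1P[w0|w0].
  by move: upf; rewrite -w0 mulr0 mule0.
pose a := (Num.sqrt w)^-1; have a0 : 0 < a by rewrite invr_gt0 sqrtr_gt0.
have a2 : a ^+ 2 = w^-1 by rewrite exprVn sqr_sqrtr // ltW.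
have hg := holomorphicM (holomorphic_cst a%:C%C) hf.
have := mem _ hg; rewrite !(wint_scale _ (ltW a0) hf) a2 w1E -EFinM mulVf ?(lt0r_neq0 w0) // lexx => /(_ isT).
rewrite (poweR12_le _ s0) ?mule_ge0 ?wint_ge0 ?lee_fin ?invr_ge0 ?(ltW w0) //.
by rewrite lee_pdivrMl // -EFinM mulrC.
Qed.
End Pair.

Lemma cvg_expRN (a : nat -> R) (l : R) : a @ \oo --> l ->
  (fun m => expR (- a m)) @ \oo --> expR (- l).
Proof.
move=> al; have h : (fun m => - a m) @ \oo --> - l by exact: cvgN.
exact: (cvg_comp (fun m => - a m) expR h (@continuous_expR R (- l))).
Qed.

(** The constants of a decreasing sequence of forms increase, and monotone convergence
    transfers the upper bound to the limit form. *)
Lemma sharp_limit (A1 A2 : 'M[R]_(n + n)) (B : nat -> 'M[R]_(n + n)) (K : nat -> R) :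
  (forall m v, qf A1 v <= qf (B m) v) -> (forall m v, qf A2 v <= qf (B m) v) ->
  (forall m p v, (m <= p)%N -> qf (B p) v <= qf (B m) v) ->
  (forall v, (fun m => qf (B m) v) @ \oo --> qf A2 v) ->
  (forall m, sharp A1 (B m) (K m)) ->
  exists k, [/\ sharp A1 A2 k, forall m, 0 <= K m <= k & K @ \oo --> k].
Proof.
move=> AB1 AB2 Bd BA hK.
have K1 m : K m <= 1.
  have [_ _ low] := hK m; apply: (low 1) => // f hf _.
  by rewrite mul1e; apply: wint_le hf (AB1 m).
have Knd : nondecreasing_seq K.
  move=> m p mp; have [_ _ low] := hK m; have [p0 up _] := hK p; apply: (low (K p) p0) => f hf _.
  by apply: le_trans (up f hf); apply: wint_le hf _ => v; exact: Bd.
have ubK : has_ubound (range K) by exists 1 => _ [m _ <-]; exact: K1.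
have Kk := nondecreasing_cvgn Knd ubK; set k := sup _ in Kk.
have lek m : K m <= k by apply: ub_le_sup => //; exists m.
have K0 m : 0 <= K m by have [] := hK m.
exists k; split=> // [|m]; last by rewrite K0 lek.
split=> [|f hf|K' K'0 H]; first exact: le_trans (K0 0) (lek 0).
- pose g m (a : (n + n).-tuple X) := (normC (f (toC (tcol a))) ^+ 2 * expR (- qf (B m) (tcol a)))%:E.
  have mg m : measurable_fun setT (g m) by exact: (vmeas_Ng hf (B m)).
  have g0 m a : setT a -> (0 <= g m a)%E.
    by move=> _; rewrite lee_fin mulr_ge0 ?expR_ge0 // sqr_ge0.
  have ndg a : setT a -> nondecreasing_seq (g ^~ a).
    move=> _ m p mp; rewrite lee_fin ler_wpM2l ?sqr_ge0 // ler_expR lerN2; exact: Bd.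
  have := @cvg_monotone_convergence _ _ _ (lebesgue_tuple R (n + n)) _ measurableT g mg g0 ndg.
  have -> : (\int[lebesgue_tuple R (n + n)]_a limn (g ^~ a))%E = wint A2 f.
    apply: eq_integral => a _; apply/cvg_lim => //.
    apply: cvg_EFin; first exact: nearW.
    apply: cvgM; first exact: cvg_cst.
    exact: (cvg_expRN (BA _)).
  move=> gI; apply: (cvge_to_le gI); apply: nearW => m.
  have [_ up _] := hK m; apply: le_trans (up f hf) _.
  by rewrite lee_wpmul2r ?wint_ge0 // lee_fin.
- apply: ge_sup; first by exists (K 0), 0.
  move=> _ [m _ <-]; have [_ _ low] := hK m; apply: (low K' K'0) => f hf f1.
  by apply: le_trans (H f hf f1); apply: wint_le hf (AB2 m).
Qed.

End Embedding.

(** * Passing to the limit in the spectrum *)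

Section Limit.
Context {R : realType}.
Notation C := R[i].
Let ic2 : 'i%C * 'i%C = -1 :> C. Proof. by rewrite -expr2 sqr_i. Qed.
Let conj_i : conjc ('i%C : C) = - 'i%C.
Proof. by apply/eqP; rewrite eq_complex /= oppr0 !eqxx. Qed.

Lemma continuous_real_complex : continuous (fun x : R => (x%:C)%C : C^o).
Proof.
move=> x; apply/cvgrPdist_le => e e0; have [e0' eE] := cgt0E e0.
apply/nbhs_ballP; exists (complex.Re e) => //= y; rewrite /ball_ /= => xy.
rewrite eE -rmorphB lec_norm /= expr0n /= addr0 sqrtr_sqr; exact: ltW.
Qed.

Lemma continuous_conjc (T : topologicalType) (f : T -> C^o) : continuous f ->
  continuous (fun v => conjc (f v) : C^o).
Proof.
move=> cf v; apply/cvgrPdist_le => e e0; have /cvgrPdist_le /(_ _ e0) := cf v.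
apply: filterS => u; rewrite -[X in _ -> is_true (X <= _)]normcJ.
by rewrite (rmorphB (@conjc R)) /= !conjcK.
Qed.

Section Cluster.
Variables (T : topologicalType) (w : nat -> T) (w0 : T).
Hypothesis cl : cluster (w @ \oo) w0.

Lemma cluster_closed (P : set T) : closed P -> (\forall m \near \oo, P (w m)) -> P w0.
Proof.
move=> cP Pw; apply: cP => B nB; exact: cl Pw nB.
Qed.

Lemma cluster_limit (f : T -> R) (l : R) : continuous f ->
  (fun m => f (w m)) @ \oo --> l -> f w0 = l.
Proof.
move=> cf fl; apply/eqP; rewrite -subr_eq0 -normr_le0; apply/ler_addgt0Pl => e e0.
have cl0 s : `|s| = 1 -> 0 <= e - s * (f w0 - l).
  move=> s1; apply: (@cluster_closed [set v | 0 <= e - s * (f v - l)]).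
    apply: closed_ge0; apply: continuous_subR; first exact: continuous_cstR.
    apply: continuous_mulR; first exact: continuous_cstR.
    by apply: continuous_subR; last exact: continuous_cstR.
  have /cvgrPdist_le /(_ _ e0) := fl; apply: filterS => m /=.
  rewrite distrC => h; rewrite subr_ge0; apply: le_trans (ler_norm _) _.
  by rewrite normrM s1 mul1r.
rewrite addr0 ler_norml.
have := cl0 1 (normr1 _); have := cl0 (-1) (normrN1 _); rewrite mulN1r mul1r; lra.
Qed.

Lemma cluster_eq (f g : T -> C^o) : continuous f -> continuous g ->
  (forall m, f (w m) = g (w m)) -> f w0 = g w0.
Proof.
move=> cf cg fg; apply/eqP; rewrite -subr_eq0; apply/eqP.
apply: (@cluster_closed [set v | f v - g v = 0]); last by apply: nearW => m /=; rewrite fg subrr.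
rewrite (_ : [set v | _] = (fun v => f v - g v) @^-1` [set x | x = 0]) //.
apply: closed_comp; first by move=> v _; exact: (continuous_subR cf cg).
by apply: accessible_closed_set1; apply: hausdorff_accessible; exact: norm_hausdorff.
Qed.
End Cluster.

(** The vectors (eps, d, mu) stay in a compact cube; polynomial identities between their
    coordinates are closed conditions, and eps and d converge. *)
Lemma limit_data n (N : R -> R -> C^o) (D L : R -> C^o) (l1 : C) (mu : nat -> 'I_n -> R)
    (eps d : nat -> R) (d0 : R) :
  (forall x, continuous (N x)) -> continuous D -> continuous L ->
  (forall m j, 0 <= mu m j <= 1) -> (forall m, 0 <= eps m <= 1) -> (forall m, 0 <= d m <= 1) ->
  eps @ \oo --> 0 -> d @ \oo --> d0 ->
  (forall m x, N x (eps m) * (\prod_j mu m j)%:C%C =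
     D (eps m) * (\prod_j ((x - mu m j) * (mu m j * x - 1)))%:C%C) ->
  (forall m, (d m)%:C%C * L (eps m) = l1 * (\prod_j mu m j)%:C%C) ->
  exists mu0 : 'I_n -> R, [/\ forall j, 0 <= mu0 j <= 1,
    forall x, N x 0 * (\prod_j mu0 j)%:C%C =
      D 0 * (\prod_j ((x - mu0 j) * (mu0 j * x - 1)))%:C%C &
    d0%:C%C * L 0 = l1 * (\prod_j mu0 j)%:C%C].
Proof.
move=> cN cD cL mu01 eps01 d01 epsl dl HN HL.
pose i0 : 'I_n.+2 := ord0; pose i1 : 'I_n.+2 := lift ord0 ord0.
pose im (j : 'I_n) : 'I_n.+2 := lift ord0 (lift ord0 j).
pose w m : 'rV[R]_n.+2 := \row_i
  if unlift ord0 i is Some i' then (if unlift ord0 i' is Some j then mu m j else d m) else eps m.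
have w0E m : w m 0 i0 = eps m by rewrite mxE unlift_none.
have w1E m : w m 0 i1 = d m by rewrite mxE liftK unlift_none.
have wmE m j : w m 0 (im j) = mu m j by rewrite mxE !liftK.
have cc i : continuous (fun v : 'rV[R]_n.+2 => v 0 i) by exact: coord_continuous.
have [v [vA vcl]] : [set v : 'rV[R]_n.+2 | forall i, `[0, 1]%classic (v 0 i)] `&` cluster (w @ \oo) !=set0.
  apply: (@rV_compact _ _ (fun=> `[0 : R, 1]%classic)).
    by move=> i; exact: segment_compact.
  exists 0%N => // m _ i; rewrite /= mxE in_itv /=.
  by case: (unlift _ _) => [i'|]; [case: (unlift _ _) => [j|]|].
have v0 : v 0 i0 = 0.
  by apply: (cluster_limit vcl (cc i0)); under eq_fun => m do rewrite w0E.
have v1 : v 0 i1 = d0.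
  by apply: (cluster_limit vcl (cc i1)); under eq_fun => m do rewrite w1E.
have cC (f : 'rV[R]_n.+2 -> R) : continuous f -> continuous (fun v => (f v)%:C%C : C^o).
  by move=> cf x; apply: (cvg_comp f _ (cf x)); exact: continuous_real_complex.
have cE (F : R -> C^o) i : continuous F -> continuous (fun v : 'rV[R]_n.+2 => F (v 0 i)).
  by move=> cF x; apply: (cvg_comp _ F (cc i x)); exact: cF.
have cprod : continuous (fun v : 'rV[R]_n.+2 => \prod_j v 0 (im j)).
  by apply: continuous_prodR => j; exact: cc.
exists (fun j => v 0 (im j)); split => [j|x|].
- by have := vA (im j); rewrite /= in_itv.
- rewrite -v0; apply: (cluster_eq vcl
    (f := fun v => N x (v 0 i0) * (\prod_j v 0 (im j))%:C%C)
    (g := fun v => D (v 0 i0) * (\prod_j ((x - v 0 (im j)) * (v 0 (im j) * x - 1)))%:C%C)).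
  + exact: (continuous_mulR (cE (N x) i0 (cN x)) (cC _ cprod)).
  + apply: (continuous_mulR (cE D i0 cD)).
    apply: cC; apply: continuous_prodR => j; apply: continuous_mulR.
      by apply: continuous_subR; [exact: continuous_cstR|exact: cc].
    apply: continuous_subR; last exact: continuous_cstR.
    by apply: continuous_mulR; [exact: cc|exact: continuous_cstR].
  + move=> m; rewrite w0E; under eq_bigr => j _ do rewrite wmE.
    by rewrite HN; congr (_ * (_)%:C%C); apply: eq_bigr => j _; rewrite wmE.
- rewrite -v0 -v1; apply: (cluster_eq vcl
    (f := fun v => (v 0 i1)%:C%C * L (v 0 i0)) (g := fun v => l1 * (\prod_j v 0 (im j))%:C%C)).
  + exact: (continuous_mulR (cC _ (cc i1)) (cE L i0 cL)).
  + exact: (continuous_mulR (@continuous_cstR _ C l1) (cC _ cprod)).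
  + move=> m; rewrite w0E w1E HL; congr (_ * (_)%:C%C).
    by apply: eq_bigr => j _; rewrite wmE.
Qed.

Section DegenerateSpectrum.
Context {n : nat}.
Implicit Types (Q : 'M[R]_(n + n)).
Notation cj := (map_mx (@conjc R)).

Lemma conjJ_scalar e : conjJ (e *: 1%:M) = e *: 1%:M :> 'M[R]_(n + n).
Proof. by rewrite conjJZ /conjJ mulmx1 trJmx mulNmx JmxJ opprK. Qed.

Lemma LC_shift Q e : LC (Q + e *: 1%:M) = LC Q + ((2 * e)%:C%C)%:M.
Proof.
rewrite /LC LQ_add; congr (_ + _); apply/matrixP => i j.
rewrite LQE [RHS]mxE !mxE eq_lrshift eq_rlshift eq_lshift eq_rshift !mulr0 subrr rmorph0 mulr0 addr0.
by rewrite -rmorphMn; congr (_%:C)%C; case: (i == j); rewrite /= ?mulr1 ?mulr0 ?addr0 ?mulr1n ?mulr0n //; ring.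
Qed.

Lemma PC_shift Q e : PC (Q + e *: 1%:M) = PC Q.
Proof. by rewrite /PC PQ_add -/(PC (e *: 1%:M)) PC_inv ?addr0 // conjJ_scalar. Qed.

Notation BC L P := (@Bmx C 'i%C n L P).

(** Clearing the inverse makes the characteristic polynomial of A_2^-1 A_1 polynomial in
    L2 and P2. *)
Lemma char_poly_clear (L1 P1 L2 P2 : 'M[C]_n) (x : C) : L2 \in unitmx ->
  \det (swapmx n *m BC L2 P2) * (char_poly (invmx (AC L2 P2) *m AC L1 P1)).[x] =
  \det (x *: (swapmx n *m BC L2 P2) - cj (BC L2 P2) *m AC L1 P1).
Proof.
move=> u2; rewrite horner_char_poly -det_mulmx mulmxBr mul_mx_scalar; congr (\det (_ - _)).
have uS : swapmx n *m BC L2 P2 \in unitmx.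
  rewrite unitmx_mul (Bmx_unit ic2 P2 u2) andbT.
  by rewrite unitmxE unitfE; exact: swap_det.
have uA : AC L2 P2 \in unitmx.
  by have := uS; rewrite -(cjAmx (conj := (@conjc R : {rmorphism C -> C})) ic2 P2 u2) unitmx_mul => /andP[].
by rewrite -(cjAmx (conj := (@conjc R : {rmorphism C -> C})) ic2 P2 u2) -mulmxA (mulKVmx uA).
Qed.

Lemma cleared_prod (x : R) (mu : 'I_n -> R) : (forall j, mu j != 0) ->
  (\prod_j ('X - (mu j)%:C%C%:P) * \prod_j ('X - ((mu j)^-1)%:C%C%:P)).[x%:C%C] * (\prod_j mu j)%:C%C =
  (\prod_j ((x - mu j) * (mu j * x - 1)))%:C%C.
Proof.
move=> mu0; rewrite hornerM !horner_prod !rmorph_prod -!big_split /=; apply: eq_bigr => j _.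
rewrite !hornerXsubC -!rmorphB -!rmorphM; congr (_%:C)%C.
by field.
Qed.

Lemma real_points_eq (p q : {poly C}) : (forall x : R, p.[x%:C%C] = q.[x%:C%C]) -> p = q.
Proof.
move=> pq; apply/eqP; rewrite -subr_eq0; apply/eqP; set r := p - q.
apply: (@roots_geq_poly_eq0 _ _ [seq (k%:R : C) | k <- iota 0 (size r)]).
- apply/allP => _ /mapP[k _ ->]; rewrite /root /r hornerD hornerN subr_eq0.
  by have := pq k%:R; rewrite rmorph_nat => ->.
- by rewrite map_inj_uniq ?iota_uniq // => i j /eqP; rewrite eqr_nat => /eqP.
- by rewrite size_map size_iota.
Qed.

(** Adding a small multiple of the identity makes a nonnegative gap positive definite. *)
Definition nudge Q (m : nat) : 'M[R]_(n + n) := Q + m.+1%:R^-1 *: 1%:M.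

Section Degenerate.
Variables (Q1 Q2 : 'M[R]_(n + n)).
Hypotheses (s2 : Q2^T = Q2) (p2 : posdef (Q2 + conjJ Q2)).

Let Ne (x e : R) : C^o := \det ((x%:C)%C *: (swapmx n *m BC (LC Q2 + ((2 * e)%:C%C)%:M) (PC Q2))
   - cj (BC (LC Q2 + ((2 * e)%:C%C)%:M) (PC Q2)) *m AC (LC Q1) (PC Q1)).
Let De (e : R) : C^o := \det (swapmx n *m BC (LC Q2 + ((2 * e)%:C%C)%:M) (PC Q2)).
Let Le (e : R) : C^o := \det (LC Q2 + ((2 * e)%:C%C)%:M).

Let cL i j : continuous (fun e : R => (LC Q2 + ((2 * e)%:C%C)%:M) i j : C^o).
Proof.
under eq_fun => e do rewrite mxE [(_%:M) i j]mxE.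
apply: continuous_addR; first exact: continuous_cstR.
case: (i == j); last by under eq_fun => e do rewrite mulr0n; exact: continuous_cstR.
under eq_fun => e do rewrite mulr1n rmorphM.
apply: continuous_mulR; first exact: continuous_cstR.
exact: continuous_real_complex.
Qed.

Let cB i j : continuous (fun e : R => BC (LC Q2 + ((2 * e)%:C%C)%:M) (PC Q2) i j : C^o).
Proof.
rewrite /Bmx; case: (split_ordP i) => i' ->; case: (split_ordP j) => j' ->.
- under eq_fun => e do rewrite block_mxEul mxE.
  by apply: continuous_mulR; [exact: continuous_cstR|exact: cL].
- by under eq_fun => e do rewrite block_mxEur mxE; exact: continuous_cstR.
- by under eq_fun => e do rewrite block_mxEdl mxE; exact: continuous_cstR.
- by under eq_fun => e do rewrite block_mxEdr; exact: continuous_cstR.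
Qed.

Let csB i j : continuous (fun e : R =>
  (swapmx n *m BC (LC Q2 + ((2 * e)%:C%C)%:M) (PC Q2)) i j : C^o).
Proof.
under eq_fun => e do rewrite mxE.
apply: continuous_sumR => k; apply: continuous_mulR; first exact: continuous_cstR.
exact: cB.
Qed.

Let cN x : continuous (Ne x).
Proof.
apply: continuous_detR => i j.
under eq_fun => e do rewrite mxE [X in X + _]mxE [X in _ + X]mxE [X in _ - X]mxE.
apply: continuous_subR.
  by apply: continuous_mulR; [exact: continuous_cstR|exact: csB].
apply: continuous_sumR => k; apply: continuous_mulR; last exact: continuous_cstR.
under eq_fun => e do rewrite mxE.
have H := continuous_conjc (@cB i k).
move=> e; exact: (H e).
Qed.

Let cD : continuous De.
Proof. by apply: continuous_detR. Qed.

Let cLe : continuous Le.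
Proof. by apply: continuous_detR. Qed.

(** At x = -1 the limit identity has the nonzero right-hand side
    det * prod (1 + mu_j)^2, so no limit mu_j vanishes and dividing is allowed. *)
Lemma degenerate_spectrum (mu : nat -> 'I_n -> R) (d : nat -> R) (d0 : R) :
  (forall m j, 0 < mu m j <= 1) -> (forall m, 0 <= d m <= 1) -> d @ \oo --> d0 ->
  (forall m, LC (nudge Q2 m) \in unitmx) ->
  (forall m, char_poly (invmx (AC (LC (nudge Q2 m)) (PC (nudge Q2 m))) *m AC (LC Q1) (PC Q1)) =
      \prod_j ('X - (mu m j)%:C%C%:P) * \prod_j ('X - ((mu m j)^-1)%:C%C%:P)) ->
  (forall m, (d m)%:C%C = \det (LC Q1) / \det (LC (nudge Q2 m)) * (\prod_j mu m j)%:C%C) ->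
  exists mu0 : 'I_n -> R, [/\ forall j, 0 < mu0 j <= 1,
    char_poly (invmx (AC (LC Q2) (PC Q2)) *m AC (LC Q1) (PC Q1)) =
      \prod_j ('X - (mu0 j)%:C%C%:P) * \prod_j ('X - ((mu0 j)^-1)%:C%C%:P) &
    d0%:C%C = \det (LC Q1) / \det (LC Q2) * (\prod_j mu0 j)%:C%C].
Proof.
move=> mu01 d01 dl uL hchar hd.
have u2 := LC_unit s2 p2.
have [mu0 [mu01' HN HL]] : exists mu0 : 'I_n -> R, [/\ forall j, 0 <= mu0 j <= 1,
    forall x, Ne x 0 * (\prod_j mu0 j)%:C%C =
      De 0 * (\prod_j ((x - mu0 j) * (mu0 j * x - 1)))%:C%C &
    d0%:C%C * Le 0 = \det (LC Q1) * (\prod_j mu0 j)%:C%C].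
  apply: (limit_data (mu := mu) (eps := fun m => m.+1%:R^-1) cN cD cLe _ _ d01 _ dl).
  - by move=> m j; have /andP[/ltW -> ->] := mu01 m j.
  - by move=> m; rewrite invr_ge0 ler0n /= invf_le1 ?ltr0n // ler1n.
  - exact: cvg_harmonic.
  - move=> m x; rewrite /Ne /De -LC_shift -(PC_shift Q2 m.+1%:R^-1) -/(nudge Q2 m).
    rewrite -(char_poly_clear _ _ _ _ (uL m)) -mulrA hchar; congr (_ * _).
    by apply: cleared_prod => j; have /andP[h _] := mu01 m j; rewrite gt_eqF.
  - move=> m; rewrite /Le -LC_shift -/(nudge Q2 m) hd.
    have lm : \det (LC (nudge Q2 m)) != 0 by have := uL m; rewrite unitmxE unitfE.
    by rewrite mulrAC (divfK lm).
have d2 : De 0 != 0.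
  rewrite /De mulr0 raddf0 addr0 -unitfE -unitmxE unitmx_mul (Bmx_unit ic2 _ u2) andbT.
  by rewrite unitmxE unitfE; exact: swap_det.
have H0 x : (char_poly (invmx (AC (LC Q2) (PC Q2)) *m AC (LC Q1) (PC Q1))).[x%:C%C] *
    (\prod_j mu0 j)%:C%C = (\prod_j ((x - mu0 j) * (mu0 j * x - 1)))%:C%C.
  apply: (mulfI d2); rewrite -HN mulrA; congr (_ * _).
  rewrite /De /Ne mulr0 raddf0 addr0; exact: char_poly_clear.
have prod0 : \prod_j mu0 j != 0.
  apply/eqP => p0; have := H0 (-1); rewrite p0 mulr0 => /esym/eqP.
  rewrite eq_complex /= eqxx andbT; apply/negP; apply/prodf_neq0 => j _.
  have /andP[m0 _] := mu01' j; rewrite mulf_neq0 // lt_eqF //; lra.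
have mu0gt j : 0 < mu0 j.
  have /andP[m0 _] := mu01' j; rewrite lt_def m0 andbT.
  by move/prodf_neq0: prod0; apply.
exists mu0; split => [j||].
- by rewrite mu0gt; have /andP[] := mu01' j.
- apply: real_points_eq => x; apply: (@mulIf _ (\prod_j mu0 j)%:C%C).
    by rewrite eq_complex /= eqxx andbT.
  by rewrite H0 -cleared_prod // => j; rewrite gt_eqF.
- have l2 : \det (LC Q2) != 0 by have := u2; rewrite unitmxE unitfE.
  by apply: (mulIf l2); rewrite mulrAC (divfK l2) -HL /Le mulr0 raddf0 addr0.
Qed.

End Degenerate.
End DegenerateSpectrum.
End Limit.

(** * Bounds, spectrum and norm of the embedding *)

Lemma det_ratio_scale (F : fieldType) m (k : F) (A B A' B' : 'M[F]_m) : k != 0 ->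
  k *: A = A' -> k *: B = B' -> \det A' / \det B' = \det A / \det B.
Proof.
move=> k0 <- <-; rewrite !detZ invfM mulrACA mulfV ?mul1r //.
exact: expf_neq0.
Qed.

Section Main.
Context {R : realType} {n : nat}.
Notation C := R[i].
Implicit Types (Q : 'M[R]_(n + n)).

Lemma qf1 m (x : 'cV[R]_m) : qf 1%:M x = \sum_i x i 0 ^+ 2.
Proof.
rewrite /qf /bil mulmx1 mxE; apply: eq_bigr => i _.
by rewrite mxE expr2.
Qed.

Lemma posdef1 m : posdef (1%:M : 'M[R]_m).
Proof.
split=> [|x x0]; first exact: trmx1.
rewrite qf1 lt_def sumr_ge0 ?andbT => [|i _]; last exact: sqr_ge0.
apply: contra x0 => /eqP s0; apply/eqP/colP => i; rewrite mxE; apply/eqP.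
rewrite -sqrf_eq0; have := psumr_eq0P _ s0 => -> //.
by move=> j _; exact: sqr_ge0.
Qed.

Section Data.
Variables (Q1 Q2 : 'M[R]_(n + n)) (c : R).
Hypotheses (s1 : Q1^T = Q1) (s2 : Q2^T = Q2) (c0 : 0 < c)
  (p1 : posdef (Q1 + conjJ Q1)) (p2 : posdef (Q2 + conjJ Q2))
  (le12 : forall v, qf Q1 v <= qf Q2 v).

Let eps0 (m : nat) : 0 < m.+1%:R^-1 :> R. Proof. by rewrite invr_gt0 ltr0n. Qed.

Let qfe m v : qf (nudge Q2 m) v = qf Q2 v + m.+1%:R^-1 * qf 1%:M v.
Proof. by rewrite qf_addmx qf_scalemx. Qed.

Let sQe m : (nudge Q2 m)^T = nudge Q2 m.
Proof. by rewrite linearD linearZ /= s2 trmx1. Qed.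

Let pQe m : posdef (nudge Q2 m + conjJ (nudge Q2 m)).
Proof.
have -> : nudge Q2 m + conjJ (nudge Q2 m) = (Q2 + conjJ Q2) + m.+1%:R^-1 *: (1%:M + conjJ 1%:M).
  by rewrite /nudge conjJD conjJZ addrACA scalerDr.
apply: posdefD => //; first by rewrite linearZ linearD /= tr_conjJ trmx1.
move=> x; rewrite qf_scalemx qf_addmx qf_conjJ mulr_ge0 ?addr_ge0 ?(ltW (eps0 m)) //.
  exact/posdef_ge0/posdef1.
exact/posdef_ge0/posdef1.
Qed.

Let p12e m : posdef (nudge Q2 m - Q1).
Proof.
have -> : nudge Q2 m - Q1 = m.+1%:R^-1 *: 1%:M + (Q2 - Q1) by rewrite /nudge addrAC addrC.
apply: posdefD.
- by apply: posdef_scale; [exact: eps0|exact: posdef1].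
- by rewrite linearB /= s1 s2.
- by move=> x; rewrite qf_addmx qf_oppmx subr_ge0.
Qed.

(** Each [nudge Q2 m] - Q1 is positive definite, so [strict_sharp] and [strict_spectrum]
    apply to it; [sharp_limit] and [degenerate_spectrum] take m to infinity. *)
Lemma embedding_data : exists (mu : 'I_n -> R) (k : R),
  [/\ forall j, 0 < mu j <= 1, sharp (c *: Q1) (c *: Q2) k,
    char_poly (invmx (AC (LC Q2) (PC Q2)) *m AC (LC Q1) (PC Q1)) =
      \prod_j ('X - (mu j)%:C%C%:P) * \prod_j ('X - ((mu j)^-1)%:C%C%:P) &
    (k ^+ 2)%:C%C = \det (LC Q1) / \det (LC Q2) * (\prod_j mu j)%:C%C].
Proof.
have step m : exists x : ('I_n -> R) * R, [/\ forall j, 0 < x.1 j <= 1,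
    sharp (c *: Q1) (c *: nudge Q2 m) x.2,
    char_poly (invmx (AC (LC (nudge Q2 m)) (PC (nudge Q2 m))) *m AC (LC Q1) (PC Q1)) =
      \prod_j ('X - (x.1 j)%:C%C%:P) * \prod_j ('X - ((x.1 j)^-1)%:C%C%:P) &
    (x.2 ^+ 2)%:C%C = \det (LC Q1) / \det (LC (nudge Q2 m)) * (\prod_j x.1 j)%:C%C].
  have [S [aS q1 q2 eE]] := extremal_shift s1 (sQe m) p1 (p12e m).
  have [mu [mu01 hc hd]] := strict_spectrum aS q1 q2 (p12e m) eE.
  exists (mu, Num.sqrt (\det (Q1 - S) / \det (nudge Q2 m - S))); split => //=.
    exact: (strict_sharp c0 aS q1 q2 (p12e m) eE).
  by rewrite sqr_sqrtr // divr_ge0 // ltW // posdef_det_gt0.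
have [x xP] := choice step.
have qf1ge0 v : 0 <= qf (1%:M : 'M[R]_(n + n)) v by exact/posdef_ge0/posdef1.
have [k [shk Kk Kcvg]] : exists k, [/\ sharp (c *: Q1) (c *: Q2) k, forall m, 0 <= (x m).2 <= k &
    (fun m => (x m).2) @ \oo --> k].
  apply: (sharp_limit (B := fun m => c *: nudge Q2 m)) => [m v|m v|m p v mp|v|m].
  - rewrite !qf_scalemx ler_wpM2l ?(ltW c0) // qfe (le_trans (le12 v)) // lerDl.
    by rewrite mulr_ge0 // ltW.
  - by rewrite !qf_scalemx ler_wpM2l ?(ltW c0) // qfe lerDl mulr_ge0 // ltW.
  - rewrite !qf_scalemx ler_wpM2l ?(ltW c0) // !qfe lerD2l ler_wpM2r //.
    by rewrite lef_pV2 ?posrE ?ltr0n // ler_nat.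
  - under eq_fun => m do rewrite qf_scalemx qfe.
    rewrite qf_scalemx; apply: cvgM; first exact: cvg_cst.
    rewrite -[X in _ --> X]addr0 -(mul0r (qf 1%:M v)).
    apply: cvgD; first exact: cvg_cst.
    apply: cvgM; last exact: cvg_cst.
    exact: cvg_harmonic.
  - by have [] := xP m.
have k1 : k <= 1.
  have [_ _ low] := shk; apply: (low 1) => // f hf _; rewrite mul1e.
  by apply: wint_le hf _ => v; rewrite !qf_scalemx ler_wpM2l ?(ltW c0).
have [mu [mu01 hc hd]] : exists mu0 : 'I_n -> R, [/\ forall j, 0 < mu0 j <= 1,
    char_poly (invmx (AC (LC Q2) (PC Q2)) *m AC (LC Q1) (PC Q1)) =
      \prod_j ('X - (mu0 j)%:C%C%:P) * \prod_j ('X - ((mu0 j)^-1)%:C%C%:P) &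
    (k ^+ 2)%:C%C = \det (LC Q1) / \det (LC Q2) * (\prod_j mu0 j)%:C%C].
  apply: (@degenerate_spectrum R n Q1 Q2 s2 p2 (fun m => (x m).1) (fun m => (x m).2 ^+ 2)).
  - by move=> m; have [] := xP m.
  - move=> m; have /andP[h0 hk] := Kk m; rewrite exprn_ge0 //= exprn_ile1 //.
    exact: le_trans hk k1.
  - by rewrite expr2; under eq_fun => m do rewrite expr2; exact: cvgM.
  - by move=> m; exact: LC_unit (sQe m) (pQe m).
  - by move=> m; have [] := xP m.
  - by move=> m; have [] := xP m.
by exists mu, k.
Qed.
End Data.

Lemma toC_eq_all (P1 P2 : 'cV[C]_n -> R) : (forall v, P1 (toC v) <= P2 (toC v)) <->
  forall x, P1 x <= P2 x.
Proof. by split=> h x; [rewrite (toC_surj x)|]; exact: h. Qed.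

Lemma spectrum_prod m (M : 'M[C]_m) (s : seq C) :
  char_poly M = \prod_(z <- s) ('X - z%:P) -> spectrum_with_mult M s.
Proof. by move=> cM z; rewrite cM mu_prod_XsubC. Qed.
End Main.

Theorem theorem1 (R : realType) (n : nat) (Phi1 Phi2 : 'cV[R[i]]_n -> R)
    (hq1 : real_quadratic Phi1) (hq2 : real_quadratic Phi2)
    (hp1 : posdefmx (hess_xbarx Phi1)) (hp2 : posdefmx (hess_xbarx Phi2)) :
  (embedding_bounded Phi1 Phi2 <-> forall x, Phi1 x <= Phi2 x) /\
  (embedding_bounded Phi1 Phi2 ->
   exists mu : 'I_n -> R,
     [/\ forall j, 0 < mu j <= 1,
         spectrum_with_mult (invmx (A_mx Phi2) *m A_mx Phi1)
           ([seq (mu j)%:C%C | j <- enum 'I_n]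
            ++ [seq ((mu j)^-1)%:C%C | j <- enum 'I_n]) &
         (* both determinants are positive reals, Re only changes the type *)
         embedding_norm Phi1 Phi2 =
           ((complex.Re (\det (hess_xbarx Phi1) / \det (hess_xbarx Phi2))
             * \prod_(j < n) mu j) `^ 4^-1)%:E]).
Proof.
have [Q1 [s1 e1]] := real_quadratic_form hq1; have [Q2 [s2 e2]] := real_quadratic_form hq2.
have p1 := posdefmx_Jpos s1 e1 hp1; have p2 := posdefmx_Jpos s2 e2 hp2.
pose c : R := 4 * pi; have c0 : 0 < c by rewrite mulr_gt0 ?pi_gt0.
have f1 v : 4 * pi * Phi1 (toC v) = qf (c *: Q1) v by rewrite e1 qf_scalemx.
have f2 v : 4 * pi * Phi2 (toC v) = qf (c *: Q2) v by rewrite e2 qf_scalemx.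
have nec : embedding_bounded Phi1 Phi2 -> forall v, qf Q1 v <= qf Q2 v.
  move=> /(wint_bounded f1 f2)[k k0 H] v.
  have := @necessity R n (c *: Q1) (c *: Q2) k _ _ _ k0 H v.
  rewrite !qf_scalemx ler_pM2l //; apply.
  - by rewrite linearZ /= s1.
  - by rewrite linearZ /= s2.
  - by rewrite conjJZ -scalerDr; exact: posdef_scale.
split=> [|bd].
  split=> [/nec h|h].
    by apply/toC_eq_all => v; rewrite e1 e2; exact: h.
  apply: (bounded_wint f1 f2 ler01) => f hf; rewrite mul1e; apply: wint_le hf _ => v.
  by rewrite !qf_scalemx ler_wpM2l ?(ltW c0) // -e1 -e2; exact: h.
have [mu [k [mu01 shk hc hk]]] := embedding_data s1 s2 c0 p1 p2 (nec bd).
exists mu; split => //.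
  apply: spectrum_prod; rewrite (A_mxE s1 e1) (A_mxE s2 e2) hc.
  have eP (F : 'I_n -> {poly R[i]}) : \prod_j F j = \prod_(j <- enum 'I_n) F j.
    by rewrite big_enum.
  by rewrite !eP big_cat !big_map.
rewrite (sharp_norm f1 f2 shk); congr EFin.
have k0 : 0 <= k by have [] := shk.
have two0 : (2 : R[i]) != 0 by rewrite pnatr_eq0.
rewrite -(det_ratio_scale two0 (hess_xbarxE s1 e1) (hess_xbarxE s2 e2)).
have -> : complex.Re (\det (LC Q1) / \det (LC Q2)) * \prod_(j < n) mu j = k ^+ 2.
  have /(congr1 (@complex.Re R)) := hk; case: (\det (LC Q1) / _) => a b /= ->.
  by rewrite mulr0 subr0.
rewrite -powR12_sqrt // -powR_mulrn // -powRrM; congr (_ `^ _).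
by field.
Qed.
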